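(* Let $P$ be a convex polygon with triangulation $T$, equipped with decorated super-Teichmüller coordinates as described in the context, and let $a,b$ be vertices of $P$ such that $(a,b)$ is not an arc of $T$. Suppose that the diagonals $d_1,\dots,d_{m-1}$ crossed by $(a,b)$ carry the default orientation. Then \[\lambda_{ab}=\sum_{t\in\mathcal T_{a,b}}\mathrm{wt}(t),\] where $\mathcal T_{a,b}$ is the set of super $T$-paths from $a$ to $b$.
   Context: Coordinates: to each arc $e$ of $T$ (diagonals and boundary edges) is attached an even $\lambda$-length $x_e$, and to each triangle $\Delta$ of $T$ an odd $\mu$-invariant $\theta_\Delta$; one works in the supercommutative $\mathbb R$-algebra $\mathbb R[x_e^{\pm1/2}\mid\theta_\Delta]$ (the $x$'s commuting and invertible, the $\theta$'s pairwise anticommuting with square zero). Square roots are taken of even elements whose body (the part free of odd generators) is positive, and are chosen with positive body. Every arc carries an orientation. Super Ptolemy flip: let $e$ be a diagonal oriented from $P_1$ to $R$, the diagonal of a quadrilateral $P_1QRS$ where triangle $P_1RS$ lies to the left of $e$ (μ-invariant $\theta$) and $P_1QR$ to its right (μ-invariant $\sigma$); let $a',b',c',d'$ be the $\lambda$-lengths of $P_1S,SR,RQ,QP_1$ and $e$ also denote the $\lambda$-length of $e$. The flip replaces $e$ by $f=QS$ oriented $Q\to S$, with $ef=a'c'+b'd'+\sqrt{a'b'c'd'}\,\sigma\theta$; the new triangle $QSP_1$ (left of $f$) gets $\theta'=(\theta\sqrt{b'd'}+\sigma\sqrt{a'c'})/\sqrt{a'c'+b'd'}$ and $QRS$ (right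 of $f$) gets $\sigma'=(\sigma\sqrt{b'd'}-\theta\sqrt{a'c'})/\sqrt{a'c'+b'd'}$; the orientation of side $SR$ is reversed, others unchanged. $\lambda_{ab}$ denotes the $\lambda$-length of $(a,b)$ obtained, as an element of the algebra above, by any sequence of flips starting from $T$ that produces $(a,b)$ (it is independent of the sequence). Setup for the arc $(a,b)$: let $\Delta_1,\dots,\Delta_m$ ($m\ge2$) be the triangles of $T$ met by $(a,b)$, in order from $a$ to $b$, and $d_1,\dots,d_{m-1}$ the diagonals crossed, in order, so $d_k$ is the common side of $\Delta_k,\Delta_{k+1}$; write $\theta_k$ for the μ-invariant of $\Delta_k$. For $2\le k\le m-1$ let $v_k$ be the common endpoint of $d_{k-1}$ and $d_k$. Centers: $u_k=v_k$ for $2\le k\le m-1$; if $m\ge3$, $u_1=v_2$ and $u_m=v_{m-1}$; if $m=2$, $u_1,u_2$ are each an (arbitrarily chosen) endpoint of $d_1$. Default orientation: each $d_k$ is oriented away from $u_k$. Positive ordering: the total order on $\{\theta_1,\dots,\theta_m\}$ such that for each $k\le m-1$, if $\Delta_k$ lies to the right of the oriented $d_k$ then $\theta_k>\theta_i$ for all $i>k$, and otherwise $\theta_k<\theta_i$ for all $i>k$. Auxiliary graph: vertices are the vertices of the triangles $\Delta_k$ together with new vertices $\theta_1,\dots,\theta_m$ (one inside each $\Delta_k$); edges are the sides of the $\Delta_k$ (arcs of $T$), the $\sigma$-edges $\sigma_k$ joining $\theta_k$ to $u_k$, and the $\tau$-edges $\tau_{ij}$ joining $\theta_i,\theta_j$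 ($i<j$). The edges $d_k$ (position $k+\tfrac12$) and $\sigma_k$ (position $k$) are said to cross $(a,b)$; no other edge does. A super $T$-path from $a$ to $b$ is a sequence $(a_0,\dots,a_\ell\mid t_1,\dots,t_\ell)$ of graph vertices $a_0=a,\ a_\ell=b$ and edges $t_i$ joining $a_{i-1},a_i$, such that: the $t_i$ are pairwise distinct; $\ell$ is odd; $t_i$ crosses $(a,b)$ whenever $i$ is even; $\sigma$-edges occur only at even $i$ and $\tau$-edges only at odd $i$; if $i<j$ and $t_i,t_j$ both cross $(a,b)$ then the position of $t_i$ is less than that of $t_j$. Weights: an arc $e$ of $T$ used as $t_i$ has weight $x_e$ if $i$ is odd and $x_e^{-1}$ if $i$ even; $\sigma_k$ has weight $\sqrt{x_{o}/(x_{p}x_{q})}\,\theta_k$ where $x_o$ is the λ-length of the side of $\Delta_k$ opposite $u_k$ and $x_p,x_q$ those of the two sides at $u_k$; $\tau$-edges have weight $1$. $\mathrm{wt}(t)$ is the product of the weights of its edges, with the odd generators written in decreasing positive ordering from left to right. *)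

(* Defs.v *)
From HB Require Import structures.
From mathcomp Require Import all_boot all_order all_algebra ring.

Set Implicit Arguments.
Unset Strict Implicit.
Unset Printing Implicit Defensive.

Import Order.TTheory GRing.Theory Num.Theory.
Local Open Scope ring_scope.

(** * The Grassmann algebra K[theta_i | i in I]

    An element is the family of its coefficients: [u A] is the coefficient of
    the monomial theta_A, the product of the theta_i, i in A, written in the
    order of [enum I]. *)

Definition grassmann (K : comNzRingType) (I : finType) : Type :=
  {ffun {set I} -> K^o}.

HB.instance Definition _ (K : comNzRingType) (I : finType) :=
  GRing.Lmodule.copy (grassmann K I) {ffun {set I} -> K^o}.

Section Grassmann.
Variables (K : comNzRingType) (I : finType).
Implicit Types (A B C D : {set I}) (u v w : grassmann K I).

(* theta_A * theta_B = (-1) ^+ inversions A B *: theta_(A :|: B) when A and B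
   are disjoint *)
Definition inversions A B : nat :=
  (\sum_(i in A) \sum_(j in B) (enum_rank j < enum_rank i))%N.

Definition gone : grassmann K I := [ffun A : {set I} => (A == set0)%:R].

Definition gmul u v : grassmann K I :=
  [ffun A : {set I} => \sum_(B : {set I} | B \subset A)
     (-1) ^+ inversions B (A :\: B) * (u B * v (A :\: B))].

Definition gen (i : I) : grassmann K I := [ffun A : {set I} => (A == [set i])%:R].

Definition body u : K := u set0.

Lemma inversions0l A : inversions set0 A = 0%N.
Proof. by rewrite /inversions big_set0. Qed.

Lemma inversions0r A : inversions A set0 = 0%N.
Proof. by rewrite /inversions big1 // => i _; rewrite big_set0. Qed.

Lemma inversionsUl A B C : [disjoint A & B] ->
  inversions (A :|: B) C = (inversions A C + inversions B C)%N.
Proof.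
move=> dAB; rewrite /inversions -bigU //=.
by apply: eq_bigl => i; rewrite !inE.
Qed.

Lemma inversionsUr A B C : [disjoint A & B] ->
  inversions C (A :|: B) = (inversions C A + inversions C B)%N.
Proof.
move=> dAB; rewrite /inversions -big_split /=.
by apply: eq_bigr => i _; rewrite -bigU //=; apply: eq_bigl => j; rewrite !inE.
Qed.

Lemma gmulA : associative gmul.
Proof.
move=> u v w; apply/ffunP => A; rewrite !ffunE.
transitivity (\sum_(C : {set I} | C \subset A)
  \sum_(B : {set I} | (B \subset A) && (C \subset B))
  (-1) ^+ inversions B (A :\: B) * ((-1) ^+ inversions C (B :\: C) *
    (u C * v (B :\: C)) * w (A :\: B))); last first.
  rewrite (exchange_big_dep (fun B => B \subset A)) /=; last by move=> ? ? _ /andP[].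
  apply: eq_bigr => B sBA; rewrite ffunE mulr_suml mulr_sumr.
  apply: eq_bigl => C; rewrite sBA andTb.
  by case sCB: (C \subset B); rewrite ?andbF // (subset_trans sCB sBA).
apply: eq_bigr => C sCA; rewrite ffunE !mulr_sumr.
rewrite [RHS](reindex_onto (fun D => C :|: D) (fun B => B :\: C)) /=; last first.
  by move=> B /andP[_ sCB]; rewrite setDE setUIr setUCr setIT; apply/setUidPr.
apply: eq_big => D.
  rewrite subUset sCA subsetUl andbT setDUl setDv set0U subsetD /=.
  by congr (_ && _); apply/setDidPl/eqP.
rewrite subsetD => /andP[sDA dDC].
have dCD : [disjoint C & D] by rewrite disjoint_sym.
have -> : (C :|: D) :\: C = D by rewrite setDUl setDv set0U; apply/setDidPl.
have eE : A :\: (C :|: D) = (A :\: C) :\: D by rewrite setDDl.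
rewrite eE; set E := (A :\: C) :\: D.
have eAC : A :\: C = D :|: E.
  rewrite -{1}(setID (A :\: C) D); congr (_ :|: _).
  by apply/setIidPr; rewrite subsetD sDA.
have dDE : [disjoint D & E] by rewrite disjoint_sym /E disjoints_subset setDE subsetIr.
rewrite eAC inversionsUl // inversionsUr // !exprD.
by ring.
Qed.

Lemma gmul1r : left_id gone gmul.
Proof.
move=> u; apply/ffunP => A; rewrite ffunE (bigD1 set0) ?sub0set //=.
rewrite big1 ?addr0 => [|B /andP[_ /negbTE nB]]; last by rewrite ffunE nB mul0r mulr0.
by rewrite ffunE eqxx inversions0l expr0 !mul1r setD0.
Qed.

Lemma gmulr1 : right_id gone gmul.
Proof.
move=> u; apply/ffunP => A; rewrite ffunE (bigD1 A) //=.
rewrite big1 ?addr0 => [|B /andP[sBA nB]].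
  by rewrite setDv ffunE eqxx inversions0r expr0 mul1r mulr1.
rewrite ffunE setD_eq0; case: (boolP (A \subset B)) => [sAB|_]; last by rewrite !mulr0.
by rewrite eqEsubset sBA sAB in nB.
Qed.

Lemma gmulDl : left_distributive gmul +%R.
Proof.
move=> u v w; apply/ffunP => A; rewrite !ffunE -big_split /=.
by apply: eq_bigr => B _; rewrite ffunE mulrDl mulrDr.
Qed.

Lemma gmulDr : right_distributive gmul +%R.
Proof.
move=> u v w; apply/ffunP => A; rewrite !ffunE -big_split /=.
by apply: eq_bigr => B _; rewrite ffunE !mulrDr.
Qed.

Lemma gone_neq0 : gone != 0 :> grassmann K I.
Proof.
by apply/eqP => /ffunP/(_ set0); rewrite !ffunE eqxx => /eqP; rewrite oner_eq0.
Qed.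

HB.instance Definition _ := GRing.Zmodule_isNzRing.Build (grassmann K I)
  gmulA gmul1r gmulr1 gmulDl gmulDr gone_neq0.

Lemma gscalerAl (k : K) u v : k *: (u * v) = (k *: u) * v.
Proof.
apply/ffunP => A; rewrite !ffunE scaler_sumr; apply: eq_bigr => B _.
by rewrite ffunE /GRing.scale /=; ring.
Qed.

HB.instance Definition _ :=
  GRing.Lmodule_isLalgebra.Build K (grassmann K I) gscalerAl.

Lemma gscalerAr (k : K) u v : k *: (u * v) = u * (k *: v).
Proof.
apply/ffunP => A; rewrite !ffunE scaler_sumr; apply: eq_bigr => B _.
by rewrite ffunE /GRing.scale /=; ring.
Qed.

HB.instance Definition _ :=
  GRing.Lalgebra_isAlgebra.Build K (grassmann K I) gscalerAr.

Lemma gen_mulE (i j : I) (A : {set I}) : (gen i * gen j) A =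
  if (i != j) && (A == [set i; j])
  then (-1) ^+ (enum_rank j < enum_rank i)%N else 0.
Proof.
rewrite ffunE.
case: ifP => [/andP[nij /eqP->] | nA].
  rewrite (bigD1 [set i]) /=; last by rewrite sub1set !inE eqxx.
  rewrite big1 ?addr0 => [|B /andP[_ /negbTE nB]]; last first.
    by rewrite ffunE nB mul0r mulr0.
  have -> : [set i; j] :\: [set i] = [set j].
    apply/setP => k; rewrite !inE; case: (eqVneq k i) => //= ->.
    by rewrite (negbTE nij).
  by rewrite !ffunE !eqxx !mulr1 /inversions !big_set1.
apply: big1 => B sBA; rewrite !ffunE.
case: eqP => [eB|_]; last by rewrite mul0r mulr0.
case: eqP => [eD|_]; last by rewrite !mulr0.
have eA : A = [set i; j].
  by rewrite -(setID A B) (setIidPr sBA) eD eB.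
move: nA; rewrite eA eqxx andbT => /negbFE/eqP eij.
have : j \in A :\: B by rewrite eD set11.
by rewrite eB eij !inE eqxx.
Qed.

Lemma gen_anticomm (i j : I) : gen i * gen j = - (gen j * gen i).
Proof.
apply/ffunP => A; rewrite [in RHS]ffunE !gen_mulE eq_sym setUC.
case: eqVneq => [|nij] /=; first by rewrite oppr0.
case: eqP => _; last by rewrite oppr0.
have: enum_rank i != enum_rank j by rewrite (inj_eq enum_rank_inj) eq_sym.
by rewrite -val_eqE /=; case: ltngtP => //; rewrite ?expr0 ?expr1 ?opprK.
Qed.

Lemma gen_sqr (i : I) : gen i * gen i = 0.
Proof. by apply/ffunP => A; rewrite gen_mulE eqxx ffunE. Qed.

End Grassmann.

(* the square root of u with positive body; there is at most one *)
Definition is_sqrt (K : rcfType) (I : finType) (u s : grassmann K I) : Prop :=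
  s * s = u /\ 0 < body s.

(** * Triangulations of the convex n-gon

    The vertices are 'I_n, in counterclockwise order; an arc is a set of two
    vertices. *)

Section Polygon.
Variable n : nat.
Implicit Types (p q r s v w a b : 'I_n) (e f D : {set 'I_n})
  (T : {set {set 'I_n}}).

(* p, q, r are distinct and in counterclockwise order, i.e. r lies strictly to
   the left of the line from p to q *)
Definition ccw p q r : bool :=
  [|| (p < q < r)%N, (q < r < p)%N | (r < p < q)%N].

Definition is_arc e : bool := #|e| == 2.

Definition crosses e f : bool :=
  [exists p, exists q, exists r, exists s,
    [&& e == [set p; q], f == [set r; s], ccw p q r & ccw q p s]].

Definition triangulation T : Prop :=
  [/\ forall e, e \in T -> is_arc e,
      forall e f, e \in T -> f \in T -> ~~ crosses e f
    & forall e, is_arc e -> (forall f, f \in T -> ~~ crosses e f) -> e \in T].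

(* In a polygon with no interior vertices, three arcs of T that pairwise share
   endpoints always bound a triangle of T. *)
Definition triangles T : {set {set 'I_n}} :=
  [set D : {set 'I_n} | (#|D| == 3) &&
     [forall e : {set 'I_n}, is_arc e && (e \subset D) ==> (e \in T)]].

(* An orientation is given by the tail of each arc. *)
Definition arc_head (tail : {set 'I_n} -> 'I_n) e : 'I_n :=
  odflt (tail e) [pick q in e :\ tail e].

(* D lies to the right of e, for e a side of D *)
Definition right_of (tail : {set 'I_n} -> 'I_n) e D : bool :=
  [exists w in D, ccw (arc_head tail e) (tail e) w].

End Polygon.

Section Flips.
Variables (n : nat) (K : rcfType) (I : finType).

(* The values of tail and lam outside arcs, and those of mu outside the
   triangles of arcs, are irrelevant. *)
Record state := State {
  arcs : {set {set 'I_n}};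
  tail : {set 'I_n} -> 'I_n;
  lam : {set 'I_n} -> grassmann K I;
  mu : {set 'I_n} -> grassmann K I
}.

(* The diagonal PR of the quadrilateral PQRS, oriented from P to R, with S on
   its left and Q on its right, is replaced by QS. The three quotients are
   written as products: e and racbd are invertible, having positive bodies, and
   they are even, hence central; rac, rbd, rabcd and racbd are the square
   roots of ac, bd, abcd and ac + bd. *)
Definition flip (s s' : state) : Prop :=
  exists (P Q R S : 'I_n) (f theta' sigma' : grassmann K I)
         (rac rbd rabcd racbd : grassmann K I),
  let a := lam s [set P; S] in
  let b := lam s [set S; R] in
  let c := lam s [set R; Q] in
  let d := lam s [set Q; P] in
  let e := lam s [set P; R] in
  let theta := mu s [set P; R; S] in
  let sigma := mu s [set P; Q; R] in
  [/\ [&& [set P; R] \in arcs s, [set P; S] \in arcs s, [set S; R] \in arcs s,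
          [set R; Q] \in arcs s & [set Q; P] \in arcs s],
      [&& tail s [set P; R] == P, ccw P R S & ccw R P Q],
      [/\ is_sqrt (a * c) rac, is_sqrt (b * d) rbd,
          is_sqrt (a * b * c * d) rabcd & is_sqrt (a * c + b * d) racbd],
      [/\ e * f = a * c + b * d + rabcd * sigma * theta,
          theta' * racbd = theta * rbd + sigma * rac
        & sigma' * racbd = sigma * rbd - theta * rac]
    & s' = State
        ([set Q; S] |: arcs s :\ [set P; R])
        [eta tail s with [set Q; S] |-> Q,
                         [set S; R] |-> arc_head (tail s) [set S; R]]
        [eta lam s with [set Q; S] |-> f]
        [eta mu s with [set Q; S; P] |-> theta', [set Q; R; S] |-> sigma']].

Inductive flips (s : state) : state -> Prop :=
| flips_refl : flips s s
| flips_step s' s'' : flips s s' -> flip s' s'' -> flips s s''.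

(* v is the lambda-length of (a, b) obtained by some sequence of flips *)
Definition is_lambda_length (s : state) (a b : 'I_n) (v : grassmann K I) : Prop :=
  exists s', [/\ flips s s', [set a; b] \in arcs s' & v = lam s' [set a; b]].

End Flips.

(** * Initial coordinates

    The lambda-lengths x_e are arbitrary positive elements of a real closed
    field K; K may be the field of real numbers, or a real closed extension of
    it in which the x_e are independent indeterminates. *)

Section Coordinates.
Variables (n : nat) (K : rcfType) (T : {set {set 'I_n}}).

Definition super_alg := grassmann K {D : {set 'I_n} | D \in triangles T}.

Definition theta (D : {set 'I_n}) : super_alg :=
  if insub D is Some i then gen K i else 0.

Definition initial (tail : {set 'I_n} -> 'I_n) (x : {set 'I_n} -> K) :
    state n K {D : {set 'I_n} | D \in triangles T} :=
  State T tail (fun e => (x e)%:A) theta.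

End Coordinates.

(** * The triangles met by (a, b)

    Indices start from 0: tri k and u k (k < m) are Delta_(k+1) and u_(k+1),
    and d k (k + 1 < m) is d_(k+1). *)

Section Setup.
Variables (n : nat) (T : {set {set 'I_n}}) (a b : 'I_n).
Variables (m : nat) (tri d : nat -> {set 'I_n}) (u : nat -> 'I_n).
Variable (tail : {set 'I_n} -> 'I_n).

Definition meets (D : {set 'I_n}) : bool :=
  [exists e : {set 'I_n},
    [&& is_arc e, e \subset D & crosses [set a; b] e]].

Record met_in_order : Prop := MetInOrder {
  met_size : (1 < m)%N;
  met_inj : {in gtn m &, injective tri};
  metP : forall D, D \in triangles T /\ meets D <->
                   exists2 k, (k < m)%N & tri k = D;
  met_first : a \in tri 0;
  met_last : b \in tri m.-1;
  met_diag : forall k, (k.+1 < m)%N ->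
    [/\ d k = tri k :&: tri k.+1, d k \in T & crosses [set a; b] (d k)]
}.

Definition centers : Prop :=
  [/\ forall k, (0 < k)%N -> (k.+1 < m)%N -> u k \in d k.-1 :&: d k,
      (2 < m)%N -> u 0 = u 1 /\ u m.-1 = u m.-2
    & m = 2%N -> u 0 \in d 0 /\ u 1 \in d 0].

Definition default_orientation : Prop :=
  forall k, (k.+1 < m)%N -> tail (d k) = u k.

(* theta_i >= theta_j in the positive ordering *)
Definition pos_ge (i j : nat) : bool :=
  (i == j) || (if (i < j)%N then right_of tail (d i) (tri i)
               else ~~ right_of tail (d j) (tri j)).

End Setup.

Inductive gedge (n m : nat) : Type :=
| Arc of {set 'I_n}
| Sigma of 'I_m
| Tau of 'I_m & 'I_m.

Section GedgeFinite.
Variables n m : nat.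

Definition gedge_code (e : gedge n m) : {set 'I_n} + 'I_m + 'I_m * 'I_m :=
  match e with
  | Arc s => inl (inl s) | Sigma k => inl (inr k) | Tau i j => inr (i, j)
  end.

Definition gedge_decode (c : {set 'I_n} + 'I_m + 'I_m * 'I_m) : gedge n m :=
  match c with
  | inl (inl s) => Arc m s | inl (inr k) => Sigma n k | inr (i, j) => Tau n i j
  end.

Lemma gedge_codeK : cancel gedge_code gedge_decode.
Proof. by case. Qed.

HB.instance Definition _ := Finite.copy (gedge n m) (can_type gedge_codeK).

End GedgeFinite.

(* inl v is the polygon vertex v, inr k is the vertex theta_(k+1) *)
Definition gvertex (n m : nat) : Type := ('I_n + 'I_m)%type.

HB.instance Definition _ (n m : nat) :=
  Finite.copy (gvertex n m) ('I_n + 'I_m)%type.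

Section Paths.
Variables (n m : nat) (tri d : nat -> {set 'I_n}) (u : nat -> 'I_n).

Definition ends (e : gedge n m) : {set gvertex n m} :=
  match e with
  | Arc s => [set inl v | v in s]
  | Sigma k => [set inr k; inl (u k)]
  | Tau i j => [set inr i; inr j]
  end.

Definition in_graph (e : gedge n m) : bool :=
  match e with
  | Arc s => is_arc s && [exists k : 'I_m, s \subset tri k]
  | Sigma _ => true
  | Tau i j => (i < j)%N
  end.

Definition is_sigma (e : gedge n m) : bool := if e is Sigma _ then true else false.
Definition is_tau (e : gedge n m) : bool := if e is Tau _ _ then true else false.

(* twice the position at which e crosses (a, b), None if e does not cross *)
Definition position (e : gedge n m) : option nat :=
  match e with
  | Arc s => omap (fun k : 'I_m => k.*2.+1)
               [pick k : 'I_m | (k.+1 < m)%N && (d k == s)]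
  | Sigma k => Some k.*2
  | Tau _ _ => None
  end.

(* A path (a_0, ..., a_l | t_1, ..., t_l) starting at a_0 = a is encoded by the
   list of the pairs (t_i, a_i), i = 1, ..., l. *)
Notation steps := (seq (gedge n m * gvertex n m)).

(* The edge of index i < l in this list is t_(i+1), so that even i here are odd
   indices of the t_i. *)
Definition super_path (a b : 'I_n) (t : steps) : bool :=
  let es := unzip1 t in
  let vs := inl a :: unzip2 t in
  let edge := nth (Arc m set0) es in
  let vertex := nth (inl a) vs in
  [&& uniq es, odd (size t), last (inl a) vs == inl b,
      [forall i : 'I_(size t),
        [&& in_graph (edge i), ends (edge i) == [set vertex i; vertex i.+1],
            odd i ==> (position (edge i) != None),
            is_sigma (edge i) ==> odd i
          & is_tau (edge i) ==> ~~ odd i]]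
    & pairwise ltn (pmap position es)].

Variables (K : rcfType) (T : {set {set 'I_n}}).
Variables (tail : {set 'I_n} -> 'I_n) (x : {set 'I_n} -> K).

Definition scalar_weight (i : nat) (e : gedge n m) : K :=
  match e with
  | Arc s => if odd i then (x s)^-1 else x s
  | Sigma k => Num.sqrt (x (tri k :\ u k) /
                         \prod_(w in tri k :\ u k) x [set u k; w])
  | Tau _ _ => 1
  end.

Definition sigma_index (e : gedge n m) : option 'I_m :=
  if e is Sigma k then Some k else None.

Definition path_weight (t : steps) : super_alg K T :=
  let es := unzip1 t in
  (\prod_(i < size t) scalar_weight i (nth (Arc m set0) es i)) *:
  \prod_(k <- sort (fun i j : 'I_m => pos_ge tri d tail i j)
                   (pmap sigma_index es)) theta K T (tri k).

End Paths.

(* The edges of a super T-path are pairwise distinct, so its length is at most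
   the number of values of gedge and the set of super T-paths is finite. *)
Definition super_path_sum (n m : nat) (T : {set {set 'I_n}})
    (tri d : nat -> {set 'I_n}) (u : nat -> 'I_n) (a b : 'I_n) (K : rcfType)
    (tail : {set 'I_n} -> 'I_n) (x : {set 'I_n} -> K) : super_alg K T :=
  \sum_(t : #|{: gedge n m}|.-bseq (gedge n m * gvertex n m)
        | super_path tri d u a b t) path_weight tri d u T tail x t.

(* Main.v *)
(** Attach to each vertex i a spinor (p_i, q_i | xi_i), with p_i, q_i even and
    xi_i odd. Its OSp(1|2)-invariants, the pairing
    L_ij = p_i q_j - q_i p_j - xi_i xi_j and the volume
    N_ijk = xi_i L_jk - xi_j L_ik + xi_k L_ij + xi_i xi_j xi_k, satisfy
      L_ik (L_ik L_jl - L_ij L_kl - L_il L_jk) = N_ijk N_ikl,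
      L_ik N_ijl = L_ij N_ikl + L_il N_ijk.
    When the lambda-lengths of a triangulation are pairings and its mu-invariants
    are volumes divided by the square root of the product of the sides, up to
    signs governed by the orientation, these relations are the super Ptolemy
    flip, so that a flip and its inverse preserve such a realization by spinors.
    A fan is realized by explicit spinors and every triangulation is flipped to
    a fan; hence the initial coordinates are realized by spinors, and
    lambda_ab = L_ab up to sign, whatever the flips.

    The weights of the super T-paths are summed by a recursion along the strip of
    triangles met by (a, b): the paths that start at an end v of d_k and remain
    beyond d_k sum up to lambda_vb, those starting at theta_k to N divided by
    x_(d_k), where N is the volume of d_k and b. Both follow by downward induction
    on k from the same two relations. *)

From HB Require Import structures.
Require Import Defs.
From mathcomp Require Import all_boot all_order all_algebra ring zify.

Set Implicit Arguments.
Unset Strict Implicit.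
Unset Printing Implicit Defensive.

(** * Cyclic order and triangulations *)

(** A given triangulation has no evident spinors: they are built on a fan and carried back against
    the flips. But a flip is not an involution: flipping back negates one mu-invariant and reverses
    the three sides of its triangle. Realizations are therefore taken up to a sign g on each
    triangle, tied to the orientations; the discrepancy only alters g. A second obstacle is that the
    new mu-invariants have the denominator sqrt(ac + bd), while normalized volumes ask for sqrt(ef).
    As ef and ac + bd differ by a multiple of sigma theta, the two roots agree once multiplied by
    theta or sigma. Since L_XY is antisymmetric, its sign is fixed by comparing X and Y as integers.
    One additive law for counterclockwise triples reduces all signs to checks over booleans. On the
    side of paths, two conditions are not local. Distinctness of the edges is shown to follow from
    the other conditions, so that paths can be summed by their first step. The positive ordering
    becomes local because the theta of least index in a product is either the greatest or the least
    of its factors: the sign splits into one factor per sigma-edge. *)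

Section Cyclic.
Variable n : nat.
Implicit Types (p q r s x y z P Q R S : 'I_n) (T : {set {set 'I_n}}) (e f D : {set 'I_n}).

(** The shape is that of the guard of [flip]: S and Q lie on the two sides of the diagonal PR. It
    amounts to P, Q, R, S being in counterclockwise order. *)
Definition cyc4 P Q R S := ccw P R S && ccw R P Q.

Lemma ccw_rot p q r : ccw p q r = ccw q r p.
Proof. by rewrite /ccw; apply/idP/idP; lia. Qed.

Lemma ccw_neq p q r : ccw p q r -> [/\ p != q, q != r & p != r].
Proof. by rewrite /ccw -!val_eqE /= => h; split; lia. Qed.

Lemma ccw_asym p q r : ccw p q r -> ~~ ccw q p r.
Proof. rewrite /ccw; clear; lia. Qed.

Lemma ccw_total p q r : p != q -> q != r -> p != r -> ccw p q r || ccw q p r.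
Proof. rewrite /ccw -!val_eqE /=; lia. Qed.

Lemma cyc4_rot P Q R S : cyc4 P Q R S = cyc4 Q R S P.
Proof. by rewrite /cyc4 /ccw; apply/idP/idP; lia. Qed.

Lemma cyc4P P Q R S : cyc4 P Q R S ->
  [\/ (P < Q < R)%N /\ (R < S)%N, (Q < R < S)%N /\ (S < P)%N,
      (R < S < P)%N /\ (P < Q)%N | (S < P < Q)%N /\ (Q < R)%N].
Proof.
rewrite /cyc4 /ccw => h.
have: ((P < Q < R) && (R < S) || (Q < R < S) && (S < P) ||
      ((R < S < P) && (P < Q) || (S < P < Q) && (Q < R)))%N by lia.
by case/orP => /orP[] /andP[]; [constructor 1|constructor 2|constructor 3|constructor 4].
Qed.

Lemma eq_set2 (U : finType) (a b c d : U) : [set a; b] = [set c; d] ->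
  (a = c /\ b = d) \/ (a = d /\ b = c).
Proof.
move=> e; have := set21 a b; have := set22 a b; rewrite e !inE.
have := set21 c d; have := set22 c d; rewrite -e !inE.
by do 4![case/orP => /eqP ?]; subst; auto.
Qed.

Lemma set2C (U : finType) (a b : U) : [set a; b] = [set b; a].
Proof. by rewrite setUC. Qed.

Lemma crosses2 p q r s : crosses [set p; q] [set r; s] =
  (ccw p q r && ccw q p s) || (ccw p q s && ccw q p r).
Proof.
rewrite {1}/crosses; apply/idP/idP => [/existsP[p' /existsP[q' /existsP[r' /existsP[s' /and4P[]]]]]|].
  move=> /eqP/eq_set2[[-> ->]|[-> ->]] /eqP/eq_set2[[-> ->]|[-> ->]] h1 h2.
  - by rewrite h1 h2.
  - by rewrite h1 h2 orbT.
  - by rewrite h1 h2 orbT.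
  - by rewrite h1 h2.
case/orP => /andP[h1 h2]; apply/existsP; exists p; apply/existsP; exists q; apply/existsP.
  by exists r; apply/existsP; exists s; rewrite !eqxx h1 h2.
by exists s; apply/existsP; exists r; rewrite eqxx [X in _ && (X && _)]eq_sym set2C eqxx h1 h2.
Qed.

Lemma is_arc2 p q : is_arc [set p; q] = (p != q).
Proof. by rewrite /is_arc cards2; case: (p != q). Qed.

Lemma is_arcP e : reflect (exists p q, p != q /\ e = [set p; q]) (is_arc e).
Proof.
apply: (iffP idP) => [/cards2P[p [q [hp ->]]]|[p [q [hp ->]]]]; last by rewrite is_arc2.
by exists p, q.
Qed.

Definition arcset T := forall e, e \in T -> is_arc e.
(** Only one of the two ways for {r, s} to straddle pq is spelled out; the other is obtained by
    writing the set as {s, r}. *)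
Definition noncrossing T := forall p q r s, [set p; q] \in T -> [set r; s] \in T ->
  ccw p q r -> ccw q p s -> False.
Definition saturated T := forall p q, p != q ->
  (forall r s, [set r; s] \in T -> ccw p q r -> ccw q p s -> False) -> [set p; q] \in T.

Lemma triangulationP T : triangulation T <-> [/\ arcset T, noncrossing T & saturated T].
Proof.
split=> [[h1 h2 h3]|[h1 h2 h3]]; split=> //.
- move=> p q r s hpq hrs c1 c2; have /negP[] := h2 _ _ hpq hrs.
  by rewrite crosses2 c1 c2.
- move=> p q npq h; apply: h3 => [|f fT]; first by rewrite is_arc2.
  have /is_arcP[r [s [nrs ef]]] := h1 _ fT; rewrite ef in fT *.
  rewrite crosses2; apply/negP => /orP[] /andP[c1 c2]; first exact: (h r s).
  by apply: (h s r) => //; rewrite set2C.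
- move=> e f eT fT; have /is_arcP[p [q [npq ee]]] := h1 _ eT.
  have /is_arcP[r [s [nrs ef]]] := h1 _ fT; subst.
  rewrite crosses2; apply/negP => /orP[] /andP[c1 c2]; first exact: (h2 p q r s).
  by apply: (h2 p q s r) => //; rewrite set2C.
- move=> e /is_arcP[p [q [npq ->]]] h; apply: h3 => // r s rsT c1 c2.
  by have /negP[] := h _ rsT; rewrite crosses2 c1 c2.
Qed.

(** Two distinct apexes on the same side of xz would make a side of one triangle cross a side of the
    other: xv and wz, or xw and vz. *)
Lemma apex_uniq T x z v w : noncrossing T ->
  [set x; v] \in T -> [set z; v] \in T -> [set x; w] \in T -> [set z; w] \in T ->
  ccw x z v -> ccw x z w -> v = w.
Proof.
move=> nT xv zv xw zw cv cw; apply/eqP/negPn/negP => nvw.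
have [h|h] : ccw v w x \/ ccw w v x.
  by apply/orP; move: nvw cv cw; rewrite /ccw -val_eqE /=; lia.
- by apply: (nT x v w z) => //; rewrite 1?(set2C w) //; move: nvw cv cw h; rewrite /ccw; clear; lia.
- by apply: (nT x w v z) => //; rewrite 1?(set2C v) //; move: nvw cv cw h; rewrite /ccw; clear; lia.
Qed.

(* The only segments crossing a diagonal of a quadrilateral but none of its
   sides is the other diagonal. *)
Lemma other_diagonal P Q R S x y : cyc4 P Q R S -> ccw P R y -> ccw R P x ->
  (ccw P Q y -> ccw Q P x -> False) -> (ccw Q R y -> ccw R Q x -> False) ->
  (ccw R S x -> ccw S R y -> False) -> (ccw S P x -> ccw P S y -> False) ->
  x = Q /\ y = S.
Proof.
rewrite /cyc4 => /andP[c1 c2] hy hx h1 h2 h3 h4.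
have [ex|nx] := eqVneq x Q.
  split=> //; subst x; have [//|ny] := eqVneq y S.
  have [h|h] : ccw R y S \/ ccw S y P.
    by apply/orP; move: ny c1 hy; rewrite /ccw -val_eqE /=; lia.
  - by case: h3; move: c1 c2 h; rewrite /ccw; clear; lia.
  - by case: h4; move: c1 c2 h; rewrite /ccw; clear; lia.
have [h|h] : ccw P x Q \/ ccw Q x R.
  by apply/orP; move: nx c2 hx; rewrite /ccw -val_eqE /=; lia.
- by case: h1; move: hy h c2; rewrite /ccw; clear; lia.
- by case: h2; move: hy h c2; rewrite /ccw; clear; lia.
Qed.

End Cyclic.

(** * Flips preserve triangulations *)

Section FlipTriangulation.
Variable n : nat.
Implicit Types (p q r s x y z P Q R S : 'I_n) (T : {set {set 'I_n}}) (e f D : {set 'I_n}).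

Lemma ccw_trans p q r s : ccw p q r -> ccw p r s -> ccw p q s.
Proof. rewrite /ccw; clear; lia. Qed.

Lemma cyc4_ccw P Q R S : cyc4 P Q R S -> [/\ ccw P Q R, ccw P Q S, ccw P R S & ccw Q R S].
Proof. by case/andP; rewrite /ccw => h1 h2; split; lia. Qed.

Lemma cyc4_neq P Q R S : cyc4 P Q R S ->
  [/\ P != Q, P != R, P != S, Q != R & (Q != S) && (R != S)].
Proof.
case/cyc4_ccw => /ccw_neq[-> -> ->] /ccw_neq[_ h1 h2] /ccw_neq[_ h3 _] _.
by rewrite h1 h2 h3.
Qed.

Definition flip_arcs T P Q R S := [set Q; S] |: T :\ [set P; R].

Definition quad T P Q R S := [/\ [set P; Q] \in T, [set Q; R] \in T,
  [set R; S] \in T & [set S; P] \in T].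

Lemma side_neq P R x : x != P -> x != R ->
  forall y, [set x; y] != [set P; R].
Proof.
move=> nP nR y; apply/eqP => /eq_set2[[e _]|[e _]]; move: nP nR; by rewrite e eqxx.
Qed.

Lemma quad_flip T P Q R S : cyc4 P Q R S -> quad T P Q R S ->
  quad (flip_arcs T P Q R S) P Q R S.
Proof.
move=> c; have [h1 h2 h3 h4 /andP[h5 h6]] := cyc4_neq c.
have nQ := @side_neq P R Q; have nS := @side_neq P R S.
case=> a1 a2 a3 a4; rewrite /flip_arcs; split; rewrite !inE; apply/orP; right; apply/andP; split=> //.
- by rewrite set2C nQ // eq_sym.
- by rewrite nQ // eq_sym.
- by rewrite set2C nS // eq_sym.
- by rewrite nS // eq_sym.
Qed.

(** An old arc crossing QS crosses no side of the quadrilateral, so [other_diagonal], applied after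
    a rotation, identifies it with PR, which has been removed. *)
Lemma flip_noncrossing T P Q R S : arcset T -> noncrossing T -> cyc4 P Q R S ->
  quad T P Q R S -> noncrossing (flip_arcs T P Q R S).
Proof.
move=> aT nT c qT.
have key x y : [set x; y] \in T -> ccw Q S y -> ccw S Q x -> [set x; y] = [set P; R].
  move=> xyT c1 c2; case: qT => a1 a2 a3 a4.
  have xyT' : [set y; x] \in T by rewrite set2C.
  have [] := @other_diagonal _ Q R S P x y _ c1 c2.
  - by move: c; rewrite cyc4_rot.
  - by move=> d1 d2; apply: (nT Q R y x).
  - by move=> d1 d2; apply: (nT R S y x).
  - by move=> d1 d2; apply: (nT S P x y).
  - by move=> d1 d2; apply: (nT P Q x y).
  by move=> -> ->; rewrite set2C.
have key2 p q x y : [set p; q] = [set Q; S] -> [set x; y] \in T -> [set x; y] != [set P; R] ->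
    ccw p q x -> ccw q p y -> False.
  move=> /eq_set2[[-> ->]|[-> ->]] xyT /eqP nxy c1 c2; apply: nxy.
    by rewrite set2C; apply: key; rewrite // set2C.
  exact: key.
have qsd p q x y : [set p; q] = [set Q; S] -> [set x; y] = [set Q; S] -> ccw p q x -> False.
  move=> /eq_set2[[-> ->]|[-> ->]] /eq_set2[[-> _]|[-> _]] /ccw_neq[];
  by rewrite eqxx.
move=> p q r s; rewrite !inE => /orP[/eqP e1|/andP[n1 a1]] /orP[/eqP e2|/andP[n2 a2]] c1 c2.
- exact: (qsd p q r s).
- exact: (key2 p q r s).
- have [d1 d2] : ccw r s q /\ ccw s r p by move: c1 c2; rewrite /ccw; clear; lia.
  by apply: (key2 r s q p) => //; rewrite set2C.
- exact: (nT p q r s).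
Qed.

(** A segment that crosses no new arc either crosses PR, and is then QS by [other_diagonal], or
    crosses no old arc and lies in T; it is not PR, since PR crosses QS. *)
Lemma flip_saturated T P Q R S : saturated T -> cyc4 P Q R S ->
  quad T P Q R S -> saturated (flip_arcs T P Q R S).
Proof.
move=> sT c qT p q npq hpq.
have [b1 b2 b3 b4] := quad_flip c qT.
have hpq' r s : [set r; s] \in flip_arcs T P Q R S -> ccw p q s -> ccw q p r -> False.
  by move=> h d1 d2; apply: (hpq s r); rewrite 1?(set2C s).
have QS : [set Q; S] \in flip_arcs T P Q R S by rewrite !inE eqxx.
have sw x y r s : ccw x y s -> ccw y x r -> ccw r s x /\ ccw s r y.
  by rewrite /ccw => d1 d2; split; lia.
have key x y : [set x; y] = [set p; q] -> ccw P R y -> ccw R P x -> [set p; q] = [set Q; S].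
  move=> /[dup] exy /eq_set2 dxy c1 c2; rewrite -exy.
  have nx r s : [set r; s] \in flip_arcs T P Q R S -> ccw r s y -> ccw s r x -> False.
    move=> h d1 d2; have [d3 d4] := sw _ _ _ _ d1 d2.
    by case: dxy => [[? ?]|[? ?]]; subst; [apply: (hpq r s)|apply: (hpq' r s)].
  have [] := @other_diagonal _ P Q R S x y c c1 c2.
  - exact: nx.
  - exact: nx.
  - by move=> d1 d2; apply: (nx S R) => //; rewrite set2C.
  - by move=> d1 d2; apply: (nx P S) => //; rewrite set2C.
  by move=> -> ->.
have [h|] := boolP (crosses [set P; R] [set p; q]).
  move: h; rewrite crosses2 => /orP[] /andP[c1 c2].
    by rewrite (key q p) // set2C.
  by rewrite (key p q).
move=> ncr.
rewrite !inE; case: eqP => //= _; apply/andP; split.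
  apply/eqP => epq; have [c1 c2] := andP (etrans (esym (cyc4_rot P Q R S)) c).
  move: epq => /eq_set2[[? ?]|[? ?]]; subst.
    have [_ d1 _ _] := cyc4_ccw c; have [d0 _ d2 d3] := cyc4_ccw c.
    by apply: (hpq' Q S QS) => //; move: d0 d2; rewrite /ccw; clear; lia.
  have [d0 _ d2 d3] := cyc4_ccw c.
  by apply: (hpq Q S QS) => //; move: d0 d2; rewrite /ccw; clear; lia.
apply: sT => // r s rsT c1 c2.
apply: (hpq r s) => //; rewrite !inE rsT andbT; apply/orP; right.
apply/eqP => ers; move: ncr; rewrite -ers crosses2 => /norP[]; rewrite !negb_and.
by move: c1 c2; rewrite /ccw; clear; lia.
Qed.

Lemma flip_triangulation T P Q R S : triangulation T -> cyc4 P Q R S ->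
  quad T P Q R S -> triangulation (flip_arcs T P Q R S).
Proof.
move=> /triangulationP[h1 h2 h3] c qT; apply/triangulationP; split.
- move=> e; rewrite !inE => /orP[/eqP->|/andP[_ /h1] //].
  by rewrite is_arc2; have [_ _ _ _ /andP[]] := cyc4_neq c.
- exact: flip_noncrossing.
- exact: flip_saturated.
Qed.

End FlipTriangulation.

(** * The flip that adds a neighbour to a given vertex *)

Section Neighbours.
Variable n : nat.
Implicit Types (b c p q r s u v x y z P Q R S : 'I_n) (T : {set {set 'I_n}}) (e f D : {set 'I_n}).

(** The number of counterclockwise steps from p to x. Once an origin is fixed, the cyclic order
    becomes a comparison of integers. *)
Definition offset p x : nat := if (p <= x)%N then (x - p)%N else (x + n - p)%N.

Lemma ccw_offset p x q : ccw p x q = (0 < offset p x < offset p q)%N.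
Proof.
rewrite /ccw /offset; have hp := ltn_ord p; have hx := ltn_ord x; have hq := ltn_ord q.
by case: (leqP p x) => h1; case: (leqP p q) => h2; apply/idP/idP; lia.
Qed.

Lemma offset_inj p : injective (offset p).
Proof.
move=> x y; rewrite /offset; have hp := ltn_ord p; have hx := ltn_ord x; have hy := ltn_ord y.
by case: (leqP p x) => h1; case: (leqP p y) => h2 h; apply: val_inj => /=; lia.
Qed.

Lemma offset_lt c x y : ccw c x y -> (offset c x < offset c y)%N.
Proof. by rewrite ccw_offset => /andP[]. Qed.

(** The witness is the vertex that follows c: no segment separates it from c, so saturation puts the
    boundary edge in T. The vertex y ensures that this neighbour comes before b. *)
Lemma first_neighbour T c y b : saturated T -> ccw c y b ->
  exists x, ccw c x b && ([set c; x] \in T).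
Proof.
move=> sT cy; have [x cx xmin] := arg_minnP (P := fun z => ccw c z b) (offset c) cy; exists x; rewrite cx /=.
apply: sT => [|u v _ cu cv]; first by case/ccw_neq: cx.
have cvx : ccw c v x by rewrite ccw_rot ccw_rot.
have := xmin v (ccw_trans cvx cx); by rewrite leqNgt (offset_lt cvx).
Qed.

Lemma last_neighbour T c y b : saturated T -> ccw c b y ->
  exists x, ccw c b x && ([set c; x] \in T).
Proof.
move=> sT cy; have [x cx xmax] := arg_maxnP (P := fun z => ccw c b z) (offset c) cy; exists x; rewrite cx /=.
apply: sT => [|u v _ cu cv]; first by case/ccw_neq: cx.
have : (offset c u <= offset c x)%N by apply: xmax; exact: ccw_trans cx cu.
by rewrite leqNgt (offset_lt cu).
Qed.

(** r is the last neighbour of p before q. A segment crossing rq would end at p, against this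
    choice, or else cross pq or pr. *)
Lemma third_vertex T p q x : triangulation T -> [set p; q] \in T -> ccw p x q ->
  exists r, [/\ ccw p r q, [set p; r] \in T & [set r; q] \in T].
Proof.
case/triangulationP => aT nT sT pqT cx; have [y hy] := first_neighbour sT cx.
have [r /andP[cr prT] rmax] := arg_maxnP (P := fun z => ccw p z q && ([set p; z] \in T)) (offset p) hy; exists r; split=> //.
apply: sT => [|u v uvT cu cv]; first by case/ccw_neq: cr.
have cpv : ccw p r v && ccw p v q.
  by move: cr cv; rewrite /ccw; clear; lia.
case/andP: cpv => cpv cvq.
have [eu|nu] := eqVneq u p.
  rewrite eu in uvT; have : (offset p v <= offset p r)%N by apply: rmax; rewrite cvq uvT.
  by rewrite leqNgt (offset_lt cpv).
have [h|h] : ccw p q u \/ ccw p u r.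
  by apply/orP; move: nu cu cr; rewrite /ccw -val_eqE /=; clear; lia.
- by apply: (nT p q u v) => //; rewrite ccw_rot.
- by apply: (nT p r v u) => //; rewrite 1?(set2C v) // ccw_rot.
Qed.

(** p and q are the neighbours of c closest to b on either side, so that cpq is the triangle through
    which the segment cb leaves c; r is the apex of the other triangle on pq, and flipping pq
    creates cr. *)
Lemma flip_towards_ex T b c : triangulation T -> c != b -> [set c; b] \notin T ->
  exists p r q, [/\ cyc4 p r q c, quad T p r q c & [set p; q] \in T].
Proof.
move=> tT ncb nE; have /triangulationP[aT nT sT] := tT.
have sep : exists u v, ccw c b u && ccw c v b.
  have [/existsP[u /existsP[v h]]|h] := boolP [exists u, exists v, ccw c b u && ccw c v b].
    by exists u, v.
  case/negP: nE; apply: sT => // u v _ c1 c2; case/negP: h.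
  by apply/existsP; exists u; apply/existsP; exists v; rewrite c1 ccw_rot ccw_rot.
have [u0 [v0 /andP[cu cv]]] := sep.
have [q0 hq0] := last_neighbour sT cu; have [p0 hp0] := first_neighbour sT cv.
have [q /andP[cq cqT] qmin] := arg_minnP (P := fun z => ccw c b z && ([set c; z] \in T)) (offset c) hq0.
have [p /andP[cp cpT] pmax] := arg_maxnP (P := fun z => ccw c z b && ([set c; z] \in T)) (offset c) hp0.
have cpq : ccw c p q := ccw_trans cp cq.
have cpb : ccw p b q by move: cp cq; rewrite /ccw; clear; lia.
(* A segment crossing pq either ends at c, against the choice of p and q or the assumption on cb, or
   crosses cq or cp. *)
have pqT : [set p; q] \in T.
  apply: sT => [|u v uvT c1 c2]; first by case/ccw_neq: cpq.
  have [eu|nu] := eqVneq u c.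
    rewrite eu in uvT; have [ev|nv] := eqVneq v b; first by case/negP: nE; rewrite -ev.
    have [h|h] : ccw p v b \/ ccw b v q.
      by apply/orP; move: nv c2 cpb; rewrite /ccw -val_eqE /=; clear; lia.
    - have [h' h''] : ccw c v b /\ ccw c p v by move: h cp; rewrite /ccw; clear; lia.
      have : (offset c v <= offset c p)%N by apply: pmax; rewrite h' uvT.
      by rewrite leqNgt (offset_lt h'').
    - have [h' h''] : ccw c b v /\ ccw c v q by move: h cq; rewrite /ccw; clear; lia.
      have : (offset c q <= offset c v)%N by apply: qmin; rewrite h' uvT.
      by rewrite leqNgt (offset_lt h'').
  have [h|h] : ccw q u c \/ ccw c u p.
    by apply/orP; move: nu c1 cpq; rewrite /ccw -val_eqE /=; clear; lia.
  - apply: (nT c q u v) => //; first by rewrite ccw_rot.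
    by move: c2 cpq; rewrite /ccw; clear; lia.
  - apply: (nT c p v u) => //; rewrite 1?(set2C v) //; last by rewrite ccw_rot.
    by move: c2 cpq; rewrite /ccw; clear; lia.
have [r [cr prT rqT]] := third_vertex tT pqT cpb.
exists p, r, q; rewrite /quad; split=> //; last first.
  by split=> //; rewrite set2C.
by rewrite /cyc4; apply/andP; split; move: cr cpq; rewrite /ccw; clear; lia.
Qed.

End Neighbours.

(** * The strip of triangles met by a diagonal *)

Section Strip.
Variables (n : nat) (T : {set {set 'I_n}}) (a b : 'I_n).
Variables (m : nat) (tri d : nat -> {set 'I_n}).
Hypothesis tT : triangulation T.
Hypothesis nab : a != b.
Hypothesis met : met_in_order T a b m tri d.
Implicit Types (v w x y z r l : 'I_n) (D : {set 'I_n}).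

Notation rho := (offset a).

Lemma ccw_rho x y z : ccw x y z =
  [|| rho x < rho y < rho z, rho y < rho z < rho x | rho z < rho x < rho y].
Proof.
rewrite /ccw /offset; have ha := ltn_ord a; have hx := ltn_ord x; have hy := ltn_ord y.
have hz := ltn_ord z.
by case: (leqP a x) => h1; case: (leqP a y) => h2; case: (leqP a z) => h3; apply/idP/idP; lia.
Qed.

Lemma rho_a : rho a = 0.
Proof. by rewrite /offset leqnn subnn. Qed.

Lemma crosses_rho e : crosses [set a; b] e ->
  exists r l, e = [set r; l] /\ 0 < rho r < rho b /\ rho b < rho l.
Proof.
have key r s : ccw a b r -> ccw b a s -> 0 < rho s < rho b /\ rho b < rho r.
  by rewrite !ccw_rho rho_a; lia.
move=> h; case/existsP: h => p /existsP[q /existsP[r /existsP[s /and4P[/eqP e1 /eqP-> c1 c2]]]].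
case: (eq_set2 e1) => -[? ?]; subst p q.
  by exists s, r; split; [rewrite set2C | exact: key].
by exists r, s; split => //; apply: key.
Qed.

Lemma tri_T k : k < m -> tri k \in triangles T.
Proof. by move=> km; have [_ h] := metP met (tri k); have [] := h (ex_intro2 _ _ k km erefl). Qed.

Lemma triangles_arc D x y : D \in triangles T -> x \in D -> y \in D -> x != y ->
  [set x; y] \in T.
Proof.
rewrite inE => /andP[_ /forallP h] xD yD nxy.
apply: (implyP (h _)); rewrite is_arc2 nxy /=.
by apply/subsetP => z /set2P[] ->.
Qed.

Lemma triangles_card D : D \in triangles T -> #|D| = 3.
Proof. by rewrite inE => /andP[/eqP]. Qed.

Lemma set3_of D x y : #|D| = 3 -> x \in D -> y \in D -> x != y ->
  exists z, [/\ D = [set x; y; z], z != x & z != y].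
Proof.
move=> c xD yD nxy.
have : #|D :\ x :\ y| = 1.
  have yDx : y \in D :\ x by rewrite !inE eq_sym nxy.
  by move: (cardsD1 x D) (cardsD1 y (D :\ x)); rewrite yDx xD c !add1n => -[<-] [].
move/eqP/cards1P => [z ez].
have : z \in D :\ x :\ y by rewrite ez set11.
rewrite !inE => /and3P[nzy nzx zD]; exists z; split=> //.
apply/setP => t; have := congr1 (fun A : {set 'I_n} => t \in A) ez; rewrite !inE.
case: (eqVneq t x) => [-> _|_]; first by rewrite xD.
by case: (eqVneq t y) => [-> _|_ /= ->]; rewrite ?yD ?orbT.
Qed.

(** r and l are the ends of the diagonal to the right and to the left of ab. The offsets between
    theirs form the side of b, so the diagonal separates the triangles up to j from the next one;
    [separated_later] extends this to all later ones. *)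
Definition separated (j : nat) r l := [/\ d j = [set r; l], 0 < rho r < rho b,
  rho b < rho l, (forall i v, i <= j -> v \in tri i -> rho v <= rho r \/ rho l <= rho v)
  & (forall v, v \in tri j.+1 -> rho r <= rho v <= rho l)].

Lemma rho_inj : injective rho. Proof. exact: offset_inj. Qed.

Lemma d_sub j v : j.+1 < m -> v \in d j -> v \in tri j /\ v \in tri j.+1.
Proof. by move=> jm; have [-> _ _] := met_diag met jm; rewrite inE => /andP. Qed.

(** Two apexes on the same side would coincide by [apex_uniq], and so would the triangles. *)
Lemma opposite_apex D D' r l v w : D \in triangles T -> D' \in triangles T ->
  D = [set r; l; v] -> D' = [set r; l; w] -> D != D' -> rho r < rho l ->
  v != r -> v != l -> w != r -> w != l ->
  (rho r < rho v < rho l) = ~~ (rho r < rho w < rho l).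
Proof.
have /triangulationP[aT nT sT] := tT.
move=> hD hD' eD eD' nD lt vr vl wr wl; apply/eqP/negPn/negP => e0.
have e : (rho r < rho v < rho l) = (rho r < rho w < rho l).
  by move: e0; case: (rho r < rho v < rho l); case: (rho r < rho w < rho l).
case/negP: nD; rewrite eD eD'; suff -> : v = w by [].
have neq x y : x != y -> rho x != rho y by rewrite (inj_eq rho_inj).
have mem D0 x : D0 = [set r; l; x] -> [/\ r \in D0, l \in D0 & x \in D0].
  by move=> ->; rewrite !inE !eqxx ?orbT.
have [m1 m2 m3] := mem _ _ eD; have [m4 m5 m6] := mem _ _ eD'.
have rv : [set r; v] \in T by apply: (triangles_arc hD); rewrite // eq_sym.
have lv : [set l; v] \in T by apply: (triangles_arc hD); rewrite // eq_sym.
have rw : [set r; w] \in T by apply: (triangles_arc hD'); rewrite // eq_sym.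
have lw : [set l; w] \in T by apply: (triangles_arc hD'); rewrite // eq_sym.
move: (neq _ _ vr) (neq _ _ vl) (neq _ _ wr) (neq _ _ wl) => n1 n2 n3 n4.
have [h|h] := boolP (rho r < rho v < rho l).
  have h' : rho r < rho w < rho l by rewrite -e.
  by apply: (apex_uniq nT lv rv lw rw); rewrite ccw_rho; move: lt h h'; clear; lia.
have h' : ~~ (rho r < rho w < rho l) by rewrite -e.
apply: (apex_uniq nT rv lv rw lw); rewrite ccw_rho.
  by move: lt h n1 n2; clear; lia.
by move: lt h' n3 n4; clear; lia.
Qed.

(** The next diagonal is a side of [tri j.+1] that crosses ab, hence joins the new apex w to r or to
    l, and the interval of offsets shrinks. *)
Lemma separated_ex j : j.+1 < m -> exists r l, separated j r l.
Proof.
have /triangulationP[aT nT sT] := tT.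
have neq x y : x != y -> rho x != rho y by rewrite (inj_eq rho_inj).
have tri_neq i k : i < m -> k < m -> i != k -> tri i != tri k.
  by move=> im km; apply: contraNneq => /(met_inj met im km) ->.
elim: j => [|j IH] jm.
  have [_ _ cr] := met_diag met jm; have [r [l [ed [h1 h2]]]] := crosses_rho cr.
  have lt : rho r < rho l by case/andP: h1 => _ /ltn_trans; apply.
  have nrl : r != l by apply: contraTneq lt => ->; rewrite ltnn.
  have [rt rt1] : r \in tri 0 /\ r \in tri 1 by apply: d_sub; rewrite // ed set21.
  have [lt0 lt1] : l \in tri 0 /\ l \in tri 1 by apply: d_sub; rewrite // ed set22.
  have t0 := tri_T (ltnW jm); have t1 := tri_T jm.
  have [v [ev vr vl]] := set3_of (triangles_card t0) rt lt0 nrl.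
  have [w [ew wr wl]] := set3_of (triangles_card t1) rt1 lt1 nrl.
  have eva : v = a.
    have := met_first met; rewrite ev !inE => /orP[/orP[]|] /eqP // e.
      by move: h1; rewrite -e rho_a.
    by move: h2; rewrite -e rho_a ltn0.
  have := opposite_apex t0 t1 ev ew (tri_neq 0 1 (ltnW jm) jm isT) lt vr vl wr wl.
  rewrite eva rho_a ltn0 /= => /esym/negbFE hw.
  exists r, l; split=> // [i x|x].
    rewrite leqn0 => /eqP->; rewrite ev eva !inE => /orP[/orP[]|] /eqP ->; rewrite ?rho_a; by [left|right].
  by rewrite ew !inE => /orP[/orP[]|] /eqP ->; move: lt hw; clear; lia.
have [r [l [ed h1 h2 ha hb]]] := IH (ltnW jm).
have lt : rho r < rho l by case/andP: h1 => _ /ltn_trans; apply.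
have nrl : r != l by apply: contraTneq lt => ->; rewrite ltnn.
have [rt rt1] : r \in tri j /\ r \in tri j.+1 by apply: d_sub; rewrite ?(ltnW jm) // ed set21.
have [lt0 lt1] : l \in tri j /\ l \in tri j.+1 by apply: d_sub; rewrite ?(ltnW jm) // ed set22.
have jm0 : j < m by do 2!apply: ltnW.
have t0 := tri_T jm0; have t1 := tri_T (ltnW jm); have t2 := tri_T jm.
have [v [ev vr vl]] := set3_of (triangles_card t0) rt lt0 nrl.
have [w [ew wr wl]] := set3_of (triangles_card t1) rt1 lt1 nrl.
have hw : rho r < rho w < rho l.
  have := hb w; rewrite ew !inE eqxx !orbT => /(_ isT).
  by move: (neq _ _ wr) (neq _ _ wl); clear; lia.
have [_ _ cr] := met_diag met jm; have [r' [l' [ed' [h3 h4]]]] := crosses_rho cr.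
have lt' : rho r' < rho l' by case/andP: h3 => _ /ltn_trans; apply.
have nrl' : r' != l' by apply: contraTneq lt' => ->; rewrite ltnn.
have [rt1' rt2'] : r' \in tri j.+1 /\ r' \in tri j.+2 by apply: d_sub; rewrite // ed' set21.
have [lt1' lt2'] : l' \in tri j.+1 /\ l' \in tri j.+2 by apply: d_sub; rewrite // ed' set22.
have [y [ey yr yl]] := set3_of (triangles_card t2) rt2' lt2' nrl'.
have n12 : tri j.+1 != tri j.+2 := tri_neq _ _ (ltnW jm) jm (negbT (ltn_eqF (ltnSn _))).
have n02 : tri j != tri j.+2 := tri_neq _ _ jm0 jm (negbT (ltn_eqF (leqnSn _))).
have n01 : tri j != tri j.+1 := tri_neq _ _ jm0 (ltnW jm) (negbT (ltn_eqF (ltnSn _))).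
have key z : tri j.+1 = [set r'; l'; z] -> z != r' -> z != l' -> ~~ (rho r' < rho z < rho l') ->
    rho r <= rho r' -> rho l' <= rho l -> separated j.+1 r' l'.
  move=> ez zr zl out le1 le2.
  have := opposite_apex t1 t2 ez ey n12 lt' zr zl yr yl; rewrite (negbTE out) => /esym/negbFE hy.
  have nz1 := neq _ _ zr; have nz2 := neq _ _ zl.
  split=> // [i x|x].
    rewrite leq_eqVlt ltnS => /orP[/eqP->|ij xi].
      by rewrite ez !inE => /orP[/orP[]|] /eqP ->; move: out nz1 nz2; clear; lia.
    by move: (ha i x ij xi) le1 le2; clear; lia.
  by rewrite ey !inE => /orP[/orP[]|] /eqP ->; move: lt' hy; clear; lia.
move: (rt1') (lt1'); rewrite {1 2}ew !inE.
case/orP => [/orP[]|] /eqP er; case/orP => [/orP[]|] /eqP el.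
- by move: h1 h2 h3 h4 hw; rewrite ?er ?el; clear; lia.
(* Here two consecutive diagonals coincide: three distinct triangles would share this segment, which
   has only two sides. *)
- subst r' l'; have h5 := opposite_apex t0 t1 ev ew n01 lt vr vl wr wl.
  have h6 := opposite_apex t1 t2 ew ey n12 lt wr wl yr yl.
  have h7 := opposite_apex t0 t2 ev ey n02 lt vr vl yr yl.
  by rewrite -h6 h5 hw in h7.
- exists r', l'; subst r' l'; apply: (key l); rewrite 1?(eq_sym l) //; try by move: hw; clear; lia.
  by rewrite ew; apply/setP => t; rewrite !inE; case: (t == r); case: (t == l); case: (t == w).
- by move: h1 h2 h3 h4 hw; rewrite ?er ?el; clear; lia.
- by move: h1 h2 h3 h4 hw; rewrite ?er ?el; clear; lia.
- by move: h1 h2 h3 h4 hw; rewrite ?er ?el; clear; lia.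
- by move: h1 h2 h3 h4 hw; rewrite ?er ?el; clear; lia.
- exists r', l'; subst r' l'; apply: (key r); rewrite 1?(eq_sym r w) //; try by move: hw; clear; lia.
  by rewrite ew; apply/setP => t; rewrite !inE; case: (t == r); case: (t == l); case: (t == w).
- by move: h1 h2 h3 h4 hw; rewrite ?er ?el; clear; lia.
Qed.

Lemma separated_later j k r l : j < k -> k < m -> separated j r l ->
  forall v, v \in tri k -> rho r <= rho v <= rho l.
Proof.
move=> jk; elim: k jk => // k IH; rewrite ltnS leq_eqVlt => /orP[/eqP<- _ []//|jk km sj v vk].
have [r' [l' [ed _ _ _ h]]] := separated_ex km.
have [rt _] : r' \in tri k /\ r' \in tri k.+1 by apply: d_sub; rewrite // ed set21.
have [lt _] : l' \in tri k /\ l' \in tri k.+1 by apply: d_sub; rewrite // ed set22.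
have h1 := IH jk (ltnW km) sj _ rt; have h2 := IH jk (ltnW km) sj _ lt.
by move: (h v vk) h1 h2; clear; lia.
Qed.

(** Because of [tri i], v is outside the open interval of offsets cut off by the diagonal; because
    of [tri k], it is inside the closed one. Only the two ends remain. *)
Lemma strip_meet i j k v : i <= j -> j < k -> k < m -> v \in tri i -> v \in tri k -> v \in d j.
Proof.
move=> ij jk km vi vk; have [r [l sj]] := separated_ex (leq_ltn_trans jk km).
have h1 := separated_later jk km sj vk; have [ed _ _ h2 _] := sj.
move: (h2 i v ij vi) h1; rewrite ed !inE -!(inj_eq rho_inj); clear; lia.
Qed.

Lemma strip_convex i j k v : i <= j -> j <= k -> k < m -> v \in tri i -> v \in tri k -> v \in tri j.
Proof.
rewrite [j <= k]leq_eqVlt => ij /orP[/eqP-> //|jk] km vi vk.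
have jm : j.+1 < m := leq_ltn_trans jk km.
by have [] := d_sub jm (strip_meet ij jk km vi vk).
Qed.

Lemma strip_first j : j.+1 < m -> a \notin d j.
Proof.
move=> jm; have [r [l [-> h1 h2 _ _]]] := separated_ex jm.
by move: h1 h2; rewrite !inE -!(inj_eq rho_inj) rho_a; clear; lia.
Qed.

Lemma strip_last j : j.+1 < m -> b \notin d j.
Proof.
move=> jm; have [r [l [-> h1 h2 _ _]]] := separated_ex jm.
by move: h1 h2; rewrite !inE -!(inj_eq rho_inj); clear; lia.
Qed.

Lemma strip_sides j x y v : j.+1 < m -> d j = [set x; y] -> ccw x y b ->
  (v \in tri j -> v \notin d j -> ccw y x v) /\
  (v \in tri j.+1 -> v \notin d j -> ccw x y v).
Proof.
move=> jm e; have [r [l [ed h1 h2 h3 h4]]] := separated_ex jm.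
have h5 : ccw l r b by move: h1 h2; rewrite ccw_rho; clear; lia.
have : [set x; y] = [set r; l] by rewrite -e.
case/eq_set2 => -[? ?]; subst x y; first by move=> c; have := ccw_asym c; rewrite h5.
move=> _; split=> [vt|vt]; rewrite ed !inE -!(inj_eq rho_inj) ccw_rho.
  by move: (h3 j v (leqnn _) vt) h1 h2; clear; lia.
by move: (h4 v vt) h1 h2; clear; lia.
Qed.

End Strip.

(** * Incidences along the strip *)

Section StripCombinatorics.
Variables (n : nat) (T : {set {set 'I_n}}) (a b : 'I_n).
Variables (m : nat) (tri d : nat -> {set 'I_n}) (u : nat -> 'I_n).
Hypothesis tT : triangulation T.
Hypothesis nab : a != b.
Hypothesis met : met_in_order T a b m tri d.
Hypothesis cen : centers m d u.
Implicit Types (v w x y z r l : 'I_n) (D : {set 'I_n}).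

Lemma m_gt1 : 1 < m. Proof. exact: met_size met. Qed.

Lemma predn2_succ : m.-2.+1 = m.-1. Proof. by move: m_gt1; clear; lia. Qed.

Lemma predn2_lt : m.-2.+1 < m. Proof. by move: m_gt1; clear; lia. Qed.

Lemma d_card k : k.+1 < m -> #|d k| = 2.
Proof.
move=> km; have [_ dT _] := met_diag met km.
by have [h _ _] := tT; have := h _ dT; rewrite /is_arc => /eqP.
Qed.

Lemma dE k : k.+1 < m -> d k = tri k :&: tri k.+1.
Proof. by move=> km; have [] := met_diag met km. Qed.

Lemma tri_card k : k < m -> #|tri k| = 3.
Proof. by move=> km; apply: (triangles_card (tri_T met km)). Qed.

Lemma apex_ex k : k.+1 < m -> exists2 v, v \in tri k & v \notin d k.
Proof.
move=> km; apply/subsetPn; apply: contraTN (leqnn 3) => /subset_leq_card.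
by rewrite tri_card ?(ltnW km) // d_card // -ltnNge.
Qed.

Lemma apexS_ex k : k.+1 < m -> exists2 v, v \in tri k.+1 & v \notin d k.
Proof.
move=> km; apply/subsetPn; apply: contraTN (leqnn 3) => /subset_leq_card.
by rewrite tri_card // d_card // -ltnNge.
Qed.

Lemma tri_side_T k v w : k < m -> v \in tri k -> w \in tri k -> v != w -> [set v; w] \in T.
Proof. by move=> km; exact: triangles_arc (tri_T met km). Qed.

Lemma d_in_tri k v : k.+1 < m -> v \in d k -> v \in tri k.
Proof. by move=> km; rewrite dE // inE => /andP[]. Qed.

Lemma d_in_triS k v : k.+1 < m -> v \in d k -> v \in tri k.+1.
Proof. by move=> km; rewrite dE // inE => /andP[]. Qed.

Lemma center_d k : k.+1 < m -> u k \in d k.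
Proof.
move=> km; have [c1 c2 c3] := cen; case: k km => [|k] km; last first.
  by have := c1 k.+1 isT km; rewrite inE => /andP[].
have := m_gt1; rewrite leq_eqVlt => /orP[/eqP e|lt]; first by have [] := c3 (esym e).
by have [-> _] := c2 lt; have := c1 1 isT lt; rewrite inE => /andP[].
Qed.

Lemma center_dS k : k.+1 < m -> u k.+1 \in d k.
Proof.
move=> km; have [c1 c2 c3] := cen.
have [km2|] := ltnP k.+2 m; first by have := c1 k.+1 isT km2; rewrite inE => /andP[].
move=> h; have e : m = k.+2 by apply/eqP; rewrite eqn_leq h km.
case: k km h e => [|k] km h e; first by have [] := c3 e.
have lt : 2 < m by rewrite e.
have [_] := c2 lt; rewrite e /= => ->.
by have := c1 k.+1 isT; rewrite e => /(_ (ltnSn _)); rewrite inE => /andP[].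
Qed.

Lemma center_tri k : k < m -> u k \in tri k.
Proof.
case: k => [|k] km; first by apply: d_in_tri; rewrite ?m_gt1 // center_d ?m_gt1.
by apply: d_in_triS => //; apply: center_dS.
Qed.

Lemma d_neqS k : k.+2 < m -> d k != d k.+1.
Proof.
move=> km; apply/eqP => e.
have km1 : k.+1 < m by apply: ltnW.
have [r [l [ed h1 h2 _ _]]] := separated_ex tT nab met km1.
have c : ccw l r b by move: h1 h2; rewrite (ccw_rho nab); clear; lia.
have [v vt vd] := apexS_ex km1.
have ed' : d k = [set l; r] by rewrite set2C.
have [_ /(_ vt vd) c1] := strip_sides tT nab met v km1 ed' c.
rewrite e in ed' vd.
have [/(_ vt vd) c2 _] := strip_sides tT nab met v km ed' c.
by have := ccw_asym c1; rewrite c2.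
Qed.

(** If d_i recurred at some j > i, convexity of the strip would place it in [tri i.+2] as well, and
    it would equal d_(i+1). *)
Lemma d_inj i j : i.+1 < m -> j.+1 < m -> d i = d j -> i = j.
Proof.
wlog ltij : i j / i < j => [wl im jm e|im jm e].
  have [lt|lt|//] := ltngtP i j; first exact: wl.
  by apply/esym/wl.
have im2 : i.+2 < m by apply: leq_ltn_trans jm.
case/negP: (d_neqS im2); rewrite eqEcard !d_card // andbT.
apply/subsetP => v vd; rewrite (dE im2) inE (d_in_triS im vd) /=.
have vj : v \in tri j.+1 by apply: d_in_triS; rewrite // -e.
by apply: (strip_convex tT nab met (i := i.+1) (k := j.+1)) => //; apply: d_in_triS.
Qed.

(* {v, w} is a side of tri k, before which all triangles at w and after which
   all triangles at v lie *)
Definition forward k v w := (forall j, j < m -> v \in tri j -> j <= k) /\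
  (forall j, j < m -> w \in tri j -> k <= j).

(** Each end may continue into the next triangle ([up]) or the preceding one ([down]). Both ends
    going the same way would make the side a crossed diagonal. If one end goes both ways, the other
    goes at least one way: otherwise both diagonals of [tri k] would consist of the two remaining
    vertices, hence be equal. *)
Lemma side_forward k v w : k < m -> v != w -> v \in tri k -> w \in tri k ->
  (forall j, j.+1 < m -> d j != [set v; w]) -> forward k v w \/ forward k w v.
Proof.
move=> km nvw vk wk nd.
have pair j : j.+1 < m -> v \in d j -> w \in d j -> False.
  move=> jm vd wd; case/negP: (nd j jm); rewrite eq_sym eqEcard cards2 nvw d_card // andbT.
  by apply/subsetP => z /set2P[] ->.
pose up z := (k.+1 < m) && (z \in tri k.+1).
pose down z := (0 < k) && (z \in tri k.-1).
have upP z : z \in tri k -> ~~ up z -> forall j, j < m -> z \in tri j -> j <= k.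
  move=> zk nz j jm zj; rewrite leqNgt; apply/negP => lt; case/negP: nz.
  have k1 : k.+1 < m by apply: leq_ltn_trans jm.
  by rewrite /up k1 /=; apply: (strip_convex tT nab met (i := k) (k := j)).
have downP z : z \in tri k -> ~~ down z -> forall j, j < m -> z \in tri j -> k <= j.
  move=> zk nz j jm zj; rewrite leqNgt; apply/negP => lt; case/negP: nz.
  have k1 : 0 < k by apply: leq_ltn_trans lt.
  rewrite /down k1 /=; apply: (strip_convex tT nab met (i := j) (k := k)) => //; first by lia.
  by lia.
have up2 : up v -> up w -> False.
  by move=> /andP[k1 v1] /andP[_ w1]; apply: (pair k k1); rewrite dE // inE ?vk ?wk.
have down2 : down v -> down w -> False.
  move=> /andP[k0 v1] /andP[_ w1]; have ek := prednK k0.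
  have k1 : k.-1.+1 < m by rewrite ek.
  by apply: (pair k.-1 k1); rewrite dE // inE ek ?v1 ?w1.
have mid z t : z \in tri k -> t \in tri k -> z != t -> up z -> down z -> ~~ up t -> ~~ down t -> False.
  move=> zk tk nzt /andP[k1 z1] /andP[k0 z2] nt1 nt2; have ek := prednK k0.
  have km0 : k.-1.+1 < m by rewrite ek.
  have nd1 : d k.-1 != d k by rewrite -[in d k]ek; apply: d_neqS; rewrite ek.
  case/negP: nd1.
  have sub j : j.+1 < m -> (d j \subset tri k) -> t \notin d j -> d j = tri k :\ t.
    move=> jm s1 td; have c2 : #|tri k :\ t| = 2.
      by have := cardsD1 t (tri k); rewrite tk tri_card // add1n => -[].
    by apply/eqP; rewrite eqEcard d_card // c2 leqnn andbT subsetD1 s1.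
  have s1 : d k.-1 \subset tri k.
    by rewrite -[in tri k]ek; apply/subsetP => y; apply: d_in_triS.
  have s2 : d k \subset tri k by apply/subsetP => y; apply: d_in_tri.
  have t1 : t \notin d k.-1 by rewrite dE // inE negb_and; move: nt2; rewrite /down k0 /= => ->.
  have t2 : t \notin d k by rewrite dE // inE tk /=; move: nt1; rewrite /up k1.
  by rewrite (sub _ km0 s1 t1) (sub _ k1 s2 t2).
have [uv|uv] := boolP (up v); have [dv|dv] := boolP (down v).
- have [uw|uw] := boolP (up w); first by case: up2.
  have [dw|dw] := boolP (down w); first by case: down2.
  by case: (mid v w).
- have [uw|uw] := boolP (up w); first by case: up2.
  by right; split; [apply: upP | apply: downP].
- have [dw|dw] := boolP (down w); first by case: down2.
  by left; split; [apply: upP | apply: downP].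
- have [uw|uw] := boolP (up w); last by right; split; [apply: upP | apply: downP].
  have [dw|dw] := boolP (down w); last by left; split; [apply: upP | apply: downP].
  by case: (mid w v); rewrite // eq_sym.
Qed.

Lemma position_d k : k.+1 < m -> position d (Arc m (d k)) = Some k.*2.+1.
Proof.
move=> km; rewrite /position; case: pickP => [i /andP[im /eqP e]|/(_ (Ordinal (ltnW km)))].
  by rewrite /= (d_inj im km e).
by rewrite /= km eqxx.
Qed.

Lemma position_ArcP s q : position d (Arc m s) = Some q ->
  exists k, [/\ k.+1 < m, s = d k & q = k.*2.+1].
Proof.
rewrite /position; case: pickP => //= i /andP[im /eqP e] [<-].
by exists i.
Qed.

Lemma position_Arc_none s : position d (Arc m s) = None -> forall k, k.+1 < m -> d k != s.
Proof.
move=> h k km; apply: contra_eqN h => /eqP <-; by rewrite position_d.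
Qed.

Lemma fan_step k : k.+2 < m -> exists o w, [/\ d k = [set u k.+1; o],
  d k.+1 = [set u k.+1; w], tri k.+1 = [set u k.+1; o; w],
  [/\ u k.+1 != o, u k.+1 != w & o != w] & o \notin d k.+1].
Proof.
move=> km; have k1 : k.+1 < m := ltnW km.
have u1 := center_dS k1; have u2 := center_d km.
have := d_card k1; have := d_card km => /eqP/cards2P[y1 [y2 [ny ey]]] /eqP/cards2P[z1 [z2 [nz ez]]].
have [w nw ew] : exists2 w, u k.+1 != w & d k.+1 = [set u k.+1; w].
  move: u2; rewrite ey => /set2P[] ->; first by exists y2.
  by exists y1; rewrite 1?eq_sym // set2C.
have [o no eo] : exists2 o, u k.+1 != o & d k = [set u k.+1; o].
  move: u1; rewrite ez => /set2P[] ->; first by exists z2.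
  by exists z1; rewrite 1?eq_sym // set2C.
have now : o != w by apply: contraNneq (d_neqS km) => e; rewrite eo ew e.
exists o, w; split=> //; last by rewrite ew !inE negb_or eq_sym no now.
apply/esym/eqP; rewrite eqEcard; apply/andP; split; last first.
  by rewrite tri_card // -setUA cardsU1 cards2 !inE negb_or no nw now.
apply/subsetP => y; rewrite !inE => /orP[/orP[]|] /eqP ->.
- exact: center_tri.
- by apply: d_in_triS; rewrite // eo set22.
- by apply: d_in_tri; rewrite // ew set22.
Qed.

End StripCombinatorics.

(** * Super T-paths as walks *)

Section Walks.
Variables (n m : nat) (tri d : nat -> {set 'I_n}) (u : nat -> 'I_n) (a b : 'I_n).
Notation step := (gedge n m * gvertex n m)%type.
Implicit Types (e : gedge n m) (v w : gvertex n m) (t : seq step).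

(* [walk v par p t] states that t leads from v to b, where par tells whether
   the next edge has even index (in the numbering from 1), and that all the
   crossings of t have position at least p. *)
Definition step_ok v (par : bool) (p : nat) (s : step) :=
  [&& in_graph tri s.1, ends u s.1 == [set v; s.2],
      par ==> (position d s.1 != None), is_sigma s.1 ==> par,
      is_tau s.1 ==> ~~ par & if position d s.1 is Some q then p <= q else true].

Definition next_pos e (p : nat) := if position d e is Some q then q.+1 else p.

Fixpoint walk v par p t : bool :=
  if t is s :: t' then step_ok v par p s && walk s.2 (~~ par) (next_pos s.1 p) t'
  else (v == inl b) && par.

Definition edge_ok (v0 : gvertex n m) v par t (i : nat) :=
  let e := nth (Arc m set0) (unzip1 t) i in
  [&& in_graph tri e, ends u e == [set nth v0 (v :: unzip2 t) i; nth v0 (v :: unzip2 t) i.+1],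
      (odd i (+) par) ==> (position d e != None), is_sigma e ==> (odd i (+) par)
    & is_tau e ==> ~~ (odd i (+) par)].

Lemma walkP v0 v par p t :
  walk v par p t <-> [/\ odd (size t) = ~~ par, last v (unzip2 t) = inl b,
    forall i, i < size t -> edge_ok v0 v par t i &
    pairwise ltn (pmap (position d) (unzip1 t)) && all (leq p) (pmap (position d) (unzip1 t))].
Proof.
elim: t v par p => [|[e w] t IH] v par p /=.
  by split=> [/andP[/eqP-> ->]|[h -> _ _]] //; rewrite eqxx; case: par h.
have pos : pairwise ltn (pmap (position d) (e :: unzip1 t)) &&
      all (leq p) (pmap (position d) (e :: unzip1 t)) =
    (if position d e is Some q then p <= q else true) &&
    (pairwise ltn (pmap (position d) (unzip1 t)) &&
     all (leq (next_pos e p)) (pmap (position d) (unzip1 t))).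
  rewrite /next_pos /=; case: (position d e) => [q|] //=.
  have [pq|] /= := leqP p q; last by rewrite ?andbF.
  apply/idP/idP=> [/andP[/andP[h1 ->] _]|/andP[-> h]]; first exact: h1.
  rewrite andbT; apply/andP; split; first exact: h.
  by apply: sub_all h => y /=; apply: leq_trans; apply: leqW.
rewrite /= in pos; rewrite pos; split.
  rewrite /step_ok /= -!andbA => /and5P[h1 h2 h3 h4 /and3P[h5 h6 /IH[k1 k2 k3 k4]]].
  split=> //; [by rewrite k1 negbK | | by rewrite h6 k4].
  case=> [_|i]; first by rewrite /edge_ok /= h1 h2 h3 h4 h5.
  rewrite ltnS => /k3; rewrite /edge_ok /= addbN.
  by rewrite -addNb.
case=> h1 h2 h3 /andP[h4 h5]; apply/andP; split.
  have := h3 0 isT; rewrite /edge_ok /step_ok /= => /and5P[-> -> -> -> ->].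
  by rewrite h4.
apply/IH; split=> //.
  by move: h1; case: (odd _); case: par {h3}.
by move=> i it; have := h3 i.+1 it; rewrite /edge_ok /= addNb addbN.
Qed.

Lemma super_pathE t : super_path tri d u a b t =
  uniq (unzip1 t) && walk (inl a) false 0 t.
Proof.
rewrite /super_path; case: (uniq _) => //=; apply/idP/idP.
  case/and4P=> h1 /eqP h2 /forallP h3 h4; apply/(walkP (inl a)); split=> //.
    by move=> i it; have := h3 (Ordinal it); rewrite /edge_ok addbF.
  by rewrite h4 /=; apply/allP.
case/(walkP (inl a)) => h1 h2 h3 /andP[h4 _]; rewrite h1 h2 eqxx h4 andbT /=.
by apply/forallP => i; have := h3 i (ltn_ord i); rewrite /edge_ok addbF.
Qed.

Lemma position_lt e q : position d e = Some q -> q < 2 * m.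
Proof.
case: e => [s|k|//] /=; last by case=> <-; rewrite -mul2n ltn_mul2l ltn_ord.
case: pickP => //= k /andP[km _] [<-]; have := ltn_ord k; lia.
Qed.

(** Every second edge crosses ab, at strictly increasing positions below 2m; the last summand
    accounts for a walk that begins with an odd edge. *)
Lemma walk_size v par p t : walk v par p t ->
  size t <= (2 * (2 * m - p)).+1 + ~~ par.
Proof.
elim: t v par p => //= -[e w] t IH v par p /andP[/and5P[_ _ h1 _ /andP[_ h2]] /IH] /=.
move: h1 h2; rewrite /next_pos; case E: (position d e) => [q|] /=.
  by have := position_lt E; case: par => /= *; lia.
by case: par => //= _ _; lia.
Qed.

Lemma walk_pos_ge v par p t e q : walk v par p t -> e \in unzip1 t -> position d e = Some q ->
  p <= q.
Proof.
elim: t v par p => //= -[e' w] t IH v par p /andP[/and5P[_ _ h1 _ /andP[_ h2]] h3] /=.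
rewrite inE => /orP[/eqP-> E|et E]; first by move: h2; rewrite /= E.
have := IH _ _ _ h3 et E; rewrite /next_pos; move: h2 => /=.
by case: (position d e') => [q'|] //; lia.
Qed.

Lemma ends_Arc (s : {set 'I_n}) v w : ends u (Arc m s) == [set v; w] ->
  exists x y, [/\ v = inl x, w = inl y & s = [set x; y]].
Proof.
move/eqP => /= e; have : v \in [set inl v0 | v0 in s] by rewrite e set21.
case/imsetP => x xs ev; have : w \in [set inl v0 | v0 in s] by rewrite e set22.
case/imsetP => y ys ew; exists x, y; split=> //.
apply/setP => z; rewrite !inE; apply/idP/idP => [zs|/orP[] /eqP-> //].
have : inl z \in [set v; w] by rewrite -e imset_f.
by rewrite ev ew !inE.
Qed.

Lemma ends_Sigma k v w : ends u (Sigma n k) == [set v; w] ->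
  v = inr k /\ w = inl (u k) \/ v = inl (u k) /\ w = inr k.
Proof.
by move=> /= /eqP/esym/eq_set2.
Qed.

Lemma ends_Tau i j v w : ends u (Tau n i j) == [set v; w] ->
  v = inr i /\ w = inr j \/ v = inr j /\ w = inr i.
Proof.
by move=> /= /eqP/esym/eq_set2.
Qed.

(** A tau-edge has odd index, so its neighbours in the walk cross ab, and the only crossing edge at
    theta_k is sigma_k. The exception is the starting vertex. *)
Lemma walk_Tau v par p t i j : walk v par p t -> Tau n i j \in unzip1 t ->
  forall k, k \in [:: i; j] -> (Sigma n k \in unzip1 t) || (v == inr k).
Proof.
elim: t v par p => //= -[e w] t IH v par p /andP[/and5P[/= h1 h2 h3 h4 /andP[h5 h6]] wt].
have after k : w = inr k -> ~~ par -> Sigma n k \in unzip1 t.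
  move=> ew npar; move: wt; rewrite ew npar /=; case: t {IH} => [|[e' w'] t] //=.
  rewrite /step_ok /= => /andP[/and5P[_ /= g2 g3 _ /andP[g5 _]] _]; case: e' g2 g3 g5 => [s|k'|i' j'] //.
    by move=> /ends_Arc[? [? []]].
  by move=> /ends_Sigma[[[->] _]|[]] //; rewrite inE eqxx.
rewrite inE => /orP[/eqP et|et] k kij.
  rewrite -et /= in h2 h5; rewrite inE orbC orbA; apply/orP.
  have npar : ~~ par := h5.
  move: (ends_Tau h2) => [[-> ew]|[-> ew]]; move: kij; rewrite !inE => /orP[] /eqP->; rewrite ?eqxx; auto;
  by right; apply: after.
rewrite inE; have /orP[->|/eqP ew] := IH _ _ _ wt et k kij; first by rewrite orbT.
case: e h1 h2 h3 h4 h5 {h6 wt} => [s|k'|i' j'] h1 h2 h3 h4 h5.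
- by move: (ends_Arc h2) => [? [? []]]; rewrite ew.
- by move: (ends_Sigma h2) => [[_]|[_]]; rewrite ew // => -[->]; rewrite eqxx.
- by rewrite (after _ ew h5) orbT.
Qed.

End Walks.

(** * Walks never repeat an edge *)

Section WalkUniq.
Variables (n : nat) (T : {set {set 'I_n}}) (a b : 'I_n).
Variables (m : nat) (tri d : nat -> {set 'I_n}) (u : nat -> 'I_n).
Hypothesis tT : triangulation T.
Hypothesis nab : a != b.
Hypothesis met : met_in_order T a b m tri d.
Hypothesis cen : centers m d u.
Notation step := (gedge n m * gvertex n m)%type.
Implicit Types (e : gedge n m) (v w : gvertex n m) (t : seq step) (x y z : 'I_n).
Notation walk := (walk tri d u b).

Lemma crossing_end e x q : inl x \in ends u e -> position d e = Some q ->
  exists i j, [/\ i < m, j < m, x \in tri i, x \in tri j & 2 * i <= q <= 2 * j].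
Proof.
case: e => [s|k|//].
  move=> /= /imsetP[y ys [exy]] /(position_ArcP (m := m)) [k [km es eq]]; subst y.
  rewrite es in ys; exists k, k.+1; split=> //; first exact: ltnW.
  - exact (d_in_tri met km ys).
  - exact (d_in_triS met km ys).
  - by rewrite eq; clear; lia.
rewrite /= !inE /= => /eqP[->] [<-]; exists k, k.
have h := center_tri met cen (ltn_ord k).
by split=> //; clear; lia.
Qed.

(** What is remembered at a polygon vertex when an odd edge is due: the walk has just started, or
    its last crossing, at position p - 1, used an edge through x and so lies in the range of the
    triangles at x. *)
Definition arrived v (p : nat) : Prop :=
  if v is inl x then (x = a /\ p = 0) \/
    exists i j, [/\ i < m, j < m, x \in tri i, x \in tri j & 2 * i < p <= (2 * j).+1]
  else True.

Lemma step_arrived v par p e w : step_ok tri d u v par p (e, w) -> par ->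
  arrived w (next_pos d e p).
Proof.
move=> /and5P[/= _ /eqP h2 h3 _ _] hp; case: w h2 => //= x h2.
have : inl x \in ends u e by rewrite h2 set22.
move: h3; rewrite hp /= /next_pos; case E: (position d e) => [q|] // _ xe.
have [i [j [im jm xi xj h]]] := crossing_end xe E.
by right; exists i, j; split=> //; move: h; clear; lia.
Qed.

Lemma in_tri_a j : j < m -> a \in tri j -> j = 0.
Proof.
move=> jm aj; apply/eqP; rewrite -leqn0 leqNgt; apply/negP => j0.
have m1 := met_size met; have := strip_first tT nab met m1.
rewrite (dE met m1) inE (met_first met) /= => /negP[].
by apply: (strip_convex tT nab met (i := 0) (k := j)); rewrite ?(met_first met).
Qed.

(** Were yz walked backward, all triangles at y would have index at least k, so that p > 2k already,
    while the next crossing at z has position at most 2k. The ends of the strip, y = a and z = b,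
    are treated apart. *)
Lemma side_walked y z p k t : k < m -> y != z -> y \in tri k -> z \in tri k ->
  (forall j, j.+1 < m -> d j != [set y; z]) ->
  arrived (inl y) p -> walk (inl z) true p t -> forward m tri k y z.
Proof.
move=> km nyz yk zk nd ay wz; have [//|[hz hy]] := side_forward tT nab met km nyz yk zk nd.
have pk : (p <= 2 * k)%N \/ (k = m.-1 /\ z = b).
  case: t wz => [|[f w] t] /=; first by rewrite andbT => /eqP[ez]; right; split=> //;
    apply/eqP; rewrite eqn_leq; apply/andP; split; [by move: km; clear; lia|];
    apply: (hz m.-1); [by move: km; clear; lia | rewrite ez; exact: met_last met].
  move=> /andP[/and5P[/= _ /eqP h2 h3 _ /andP[_ h4]] _]; left.
  have ze : inl z \in ends u f by rewrite h2 set21.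
  move: h3 h4; case E: (position d f) => [q|] // _ pq.
  have [i [j [im jm zi zj h]]] := crossing_end ze E.
  by move: (hz j jm zj) h pq; clear; lia.
case: ay => [[ya p0]|[i [j [im jm yi yj h]]]].
  subst y; have k0 : k = 0 by apply: in_tri_a.
  by split=> j jm; [move=> /(in_tri_a jm) -> | rewrite k0].
case: pk => [pk|[ek zb]]; first by move: (hy i im yi) h pk; clear; lia.
split=> j' jm' h'; first by rewrite ek; move: jm'; clear; lia.
rewrite ek leqNgt; apply/negP => lt; have m1 := met_size met.
have e2 := predn2_succ met.
have m2 := predn2_lt met.
have := strip_last tT nab met m2; rewrite (dE met m2) inE e2 (met_last met) andbT => /negP[].
apply: (strip_convex tT nab met (i := j') (k := m.-1)); try by move: lt m1; clear; lia.
  by rewrite -zb.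
exact: met_last met.
Qed.

(** An uncrossed side of [tri k] is walked forward, so p is at most 2k + 1 when it is taken. At a
    vertex theta_j the bound 2k suffices, because the walk returns to the polygon through a
    sigma-edge, whose position is even. *)
Lemma late_walk v par p t k y z : walk v par p t -> (~~ par -> arrived v p) ->
  k < m -> y != z -> y \in tri k -> z \in tri k ->
  (forall j, j.+1 < m -> d j != [set y; z]) ->
  (if v is inl _ then (2 * k).+1 else 2 * k) < p ->
  Arc m [set y; z] \notin unzip1 t.
Proof.
move=> wt av km nyz yk zk nd; elim: t v par p wt av => //= -[e w] t IH v par p.
case/andP=> /[dup] ok /and5P[/= h1 h2 h3 h4 /andP[h5 h6]] wt av hp.
rewrite inE negb_or; apply/andP; split; last first.
  apply: (IH _ _ _ wt) => [/negbNE|]; first exact: step_arrived ok.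
  rewrite /next_pos; case: e h1 h2 h3 h4 h5 h6 {ok} wt => [s|l|i j] h1 h2 h3 h4 h5 h6 wt.
  - have [x1 [x2 [ev -> _]]] := ends_Arc h2; rewrite ev in hp.
    by move: h6 hp; case: (position d _) => [q|] //; clear; lia.
  - rewrite /= in h6 *; case: (ends_Sigma h2) hp => -[-> ->] hp; move: h6 hp; rewrite -mul2n; clear; lia.
  - by case: (ends_Tau h2) hp => -[-> ->].
apply/eqP => ee; move: h1 h2 h3 h4 h5 h6 wt ok; rewrite -ee => h1 h2 h3 h4 h5 h6 wt ok.
have npar : par = false.
  case: par h3 {IH av h4 h5 wt ok} => //=; case E: (pick _) => [i|] //= _.
  by move: E; case: pickP => // i' /andP[im /eqP ed] _; case/negP: (nd i' im); rewrite ed.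
have [y' [z' [ev ew es]]] := ends_Arc h2.
have e0 : next_pos d (Arc m [set y; z]) p = p.
  rewrite /next_pos /=; case: pickP => //= i' /andP[im /eqP ed].
  by case/negP: (nd i' im); rewrite ed.
rewrite npar ew e0 in wt; rewrite ev npar in av hp.
have [yk' zk' nyz'] : [/\ y' \in tri k, z' \in tri k & y' != z'].
  have : [set y'; z'] = [set y; z] by rewrite es.
  by case/eq_set2 => -[-> ->]; split; rewrite // eq_sym.
have nd' j : j.+1 < m -> d j != [set y'; z'] by rewrite -es; apply: nd.
have [h7 h8] := side_walked km nyz' yk' zk' nd' (av isT) wt.
case: (av isT) => [[_ p0]|[i [j [im jm yi yj h9]]]]; first by rewrite p0 in hp.
by move: (h7 j jm yj) h9 hp; clear; lia.
Qed.

(** Crossing edges occur at increasing positions; an uncrossed side is walked forward, after which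
    the walk is too far along to meet it again; and a repeated tau-edge would require a sigma-edge
    already passed. *)
Lemma walk_uniq v par p t : walk v par p t -> (~~ par -> arrived v p) -> uniq (unzip1 t).
Proof.
elim: t v par p => //= -[e w] t IH v par p /andP[/[dup] ok /and5P[/= h1 h2 h3 h4 /andP[h5 h6]] wt] av.
have aw : ~~ ~~ par -> arrived w (next_pos d e p) by move=> /negbNE; apply: step_arrived ok.
rewrite (IH _ _ _ wt aw) andbT; apply/negP => et.
case E: (position d e) => [q|].
  by have := walk_pos_ge wt et E; rewrite /next_pos E ltnn.
have npar : par = false by move: h3; rewrite E; case: par {h4 h5 wt ok av aw}.
rewrite npar /= /next_pos E in wt av.
case: e h1 h2 h3 h4 h5 h6 E et ok {aw wt} (wt) => [s|k|i j] h1 h2 h3 h4 h5 h6 E et ok wt //.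
  have [y [z [ev ew es]]] := ends_Arc h2; subst s v w.
  move: h1 => /= /andP[]; rewrite is_arc2 => nyz /existsP[[k km] /subsetP sub].
  have yk := sub _ (set21 _ _); have zk := sub _ (set22 _ _); rewrite /= in yk zk.
  have nd := position_Arc_none tT nab met E.
  have [h7 h8] := side_walked km nyz yk zk nd (av isT) wt.
  case: t IH et wt => [|[f w2] t] //= _; rewrite inE => /orP[/eqP ef|et].
    by move=> /andP[/and5P[_ _]]; rewrite -ef E.
  case/andP=> /[dup] ok2 /and5P[/= g1 g2 g3 g4 /andP[g5 g6]] wt2.
  have a2 : ~~ false -> arrived w2 (next_pos d f p) by move=> _; apply: step_arrived ok2 _.
  suff hp : (if w2 is inl _ then (2 * k).+1 else 2 * k) < next_pos d f p.
    by have /negP[] := late_walk wt2 a2 km nyz yk zk nd hp.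
  move: g3; case F: (position d f) => [q|] // _.
  have zf : inl z \in ends u f by rewrite (eqP g2) set21.
  have [i [j [im jm zi zj h9]]] := crossing_end zf F.
  have k2 : k <= i := h8 i im zi.
  rewrite /next_pos F; case: f g1 g2 g4 g5 g6 F zf h9 {ok2 wt2 a2} => [s'|l|//] g1 g2 g4 g5 g6 F zf h9.
    have [k' [km' es' eq']] := position_ArcP F; have [x1 [x2 [_ -> _]]] := ends_Arc g2.
    by move: h9 k2; rewrite eq'; clear; lia.
  move: F h9 => [<-] h9; case: (ends_Sigma g2) => -[// _ ->]; move: h9 k2; clear; lia.
have [k ew kij] : exists2 k, w = inr k & k \in [:: i; j].
  by case: (ends_Tau h2) => -[_ ->]; [exists j | exists i]; rewrite ?inE ?eqxx ?orbT.
rewrite ew in wt; case: t IH et wt => [|[f w2] t] //= _ et.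
case/andP=> /and5P[/= g1 g2 g3 g4 /andP[g5 g6]] wt2.
case: f et g1 g2 g3 g4 g5 g6 wt2 => [s|k'|//] et g1 g2 g3 g4 g5 g6 wt2.
  by have [x1 [x2 [? _ _]]] := ends_Arc g2.
case: (ends_Sigma g2) => -[// [ek] ew2]; subst k' w2; move: et; rewrite inE /= => et.
have := walk_Tau wt2 et kij; rewrite orbF => sk.
by have := walk_pos_ge wt2 sk (erefl _); rewrite /next_pos /= ltnn.
Qed.

Lemma super_path_walk t : super_path tri d u a b t = walk (inl a) false 0 t.
Proof.
rewrite super_pathE; apply/andP/idP => [[]//|h]; split=> //.
by apply: (walk_uniq h) => _; left.
Qed.

End WalkUniq.

Import Order.TTheory GRing.Theory Num.Theory.
Local Open Scope ring_scope.

(** * Parity in the Grassmann algebra *)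

Section GrassmannParity.
Variables (K : rcfType) (I : finType).
Implicit Types (A B C : {set I}) (u v w a : grassmann K I).

Lemma gmulE u v A : (u * v) A = \sum_(B : {set I} | B \subset A)
  (-1) ^+ inversions B (A :\: B) * (u B * v (A :\: B)).
Proof. by rewrite ffunE. Qed.

Lemma gaddE u v A : (u + v) A = u A + v A. Proof. by rewrite ffunE. Qed.
Lemma goppE u A : (- u) A = - u A. Proof. by rewrite ffunE. Qed.
Lemma gsubE u v A : (u - v) A = u A - v A. Proof. by rewrite !ffunE. Qed.
Lemma gscaleE (k : K) u A : (k *: u) A = k * u A. Proof. by rewrite ffunE. Qed.
Lemma gzeroE A : (0 : grassmann K I) A = 0. Proof. by rewrite ffunE. Qed.
Lemma goneE A : (1 : grassmann K I) A = (A == set0)%:R. Proof. by rewrite ffunE. Qed.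

Lemma inversionsC B C : [disjoint B & C] ->
  (inversions B C + inversions C B = #|B| * #|C|)%N.
Proof.
move=> dBC; rewrite /inversions [X in (_ + X)%N]exchange_big -big_split /=.
rewrite -sum_nat_const; apply: eq_bigr => i iB.
rewrite -[RHS]sum1_card -big_split; apply: eq_bigr => j jC /=.
have: enum_rank i != enum_rank j.
  rewrite (inj_eq enum_rank_inj); apply: contraTneq dBC => eij.
  by apply/pred0Pn; exists i; rewrite /= iB eij.
by rewrite -val_eqE /=; case: ltngtP.
Qed.

Definition homog (b : bool) u :=
  [forall A : {set I}, (odd #|A| != b) ==> (u A == 0)].

Lemma homogP b u :
  reflect (forall A, odd #|A| != b -> u A = 0) (homog b u).
Proof.
apply: (iffP forallP) => h A; first by move=> hA; apply/eqP; apply: (implyP (h A)).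
by apply/implyP => /h ->.
Qed.

Lemma homog0 b : homog b 0.
Proof. by apply/homogP => A _; rewrite gzeroE. Qed.

Lemma homog1 : homog false 1.
Proof. by apply/homogP => A; rewrite goneE; case: (A =P set0) => [->|]; rewrite ?cards0. Qed.

Lemma homogD b u v : homog b u -> homog b v -> homog b (u + v).
Proof.
move=> /homogP hu /homogP hv; apply/homogP => A hA.
by rewrite gaddE hu ?hv ?addr0.
Qed.

Lemma homogN b u : homog b u -> homog b (- u).
Proof. by move=> /homogP hu; apply/homogP => A hA; rewrite goppE hu ?oppr0. Qed.

Lemma homogB b u v : homog b u -> homog b v -> homog b (u - v).
Proof. by move=> hu hv; apply/homogD/homogN. Qed.

Lemma homogZ b k u : homog b u -> homog b (k *: u).
Proof. by move=> /homogP hu; apply/homogP => A hA; rewrite gscaleE hu ?mulr0. Qed.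

Lemma homogM b c u v : homog b u -> homog c v -> homog (b (+) c) (u * v).
Proof.
move=> /homogP hu /homogP hv; apply/homogP => A hA; rewrite gmulE big1 // => B sBA.
have [ob|ob] := eqVneq (odd #|B|) b; last by rewrite hu ?mul0r ?mulr0.
rewrite hv ?mulr0 //; apply: contraNneq hA => <-.
by rewrite cardsD (setIidPr sBA) oddB ?subset_leq_card // ob addbC addbK.
Qed.

Lemma homog_gen i : homog true (gen K i).
Proof. by apply/homogP => A; rewrite ffunE; case: (A =P [set i]) => [->|]; rewrite ?cards1. Qed.

Lemma homog_supercomm b c u v : homog b u -> homog c v ->
  u * v = (-1) ^+ (b && c) * (v * u).
Proof.
move=> /homogP hu /homogP hv; apply/ffunP => A.
have -> : ((-1) ^+ (b && c) * (v * u)) A = (-1) ^+ (b && c) * (v * u) A.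
  by case: (b && c); rewrite ?expr0 ?mul1r // expr1 mulN1r goppE mulN1r.
rewrite !gmulE mulr_sumr [RHS](reindex_onto (fun B => A :\: B) (fun B => A :\: B)) /=;
  last by move=> B sBA; rewrite setDDr setDv set0U; apply/setIidPr.
apply: eq_big => [B|B sBA].
  by rewrite subsetDl setDDr setDv set0U setIC; apply/idP/eqP => [/setIidPl|/setIidPl].
have -> : A :\: (A :\: B) = B by rewrite setDDr setDv set0U; apply/setIidPr.
have [eb|/hu->] := eqVneq (odd #|B|) b; last by rewrite !(mul0r, mulr0).
have [ec|/hv->] := eqVneq (odd #|A :\: B|) c; last by rewrite !(mul0r, mulr0).
rewrite [v _ * _]mulrC mulrA; congr (_ * _).
have dB : [disjoint B & A :\: B] 
  by rewrite disjoint_sym disjoints_subset setDE subsetIr.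
rewrite -eb -ec -oddM -inversionsC // signr_odd -exprD -addnA addnn exprD.
by rewrite -muln2 exprM sqrr_sign mulr1.
Qed.

Lemma homog_comm b u v : homog false u -> homog b v -> u * v = v * u.
Proof. by move=> hu hv; rewrite (homog_supercomm hu hv) mul1r. Qed.

Lemma homog_split u : exists u0 u1, [/\ homog false u0, homog true u1 & u = u0 + u1].
Proof.
exists [ffun A : {set I} => if odd #|A| then 0 else u A].
exists [ffun A : {set I} => if odd #|A| then u A else 0]; split.
- by apply/homogP => A; rewrite ffunE; case: odd.
- by apply/homogP => A; rewrite ffunE; case: odd.
- by apply/ffunP => A; rewrite gaddE !ffunE; case: odd; rewrite ?addr0 ?add0r.
Qed.

Lemma homog_central u v : homog false u -> u * v = v * u.
Proof.
move=> hu; have [v0 [v1 [h0 h1 ->]]] := homog_split v.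
by rewrite mulrDl mulrDr (homog_comm hu h0) (homog_comm hu h1).
Qed.

Lemma homog_anticomm u v : homog true u -> homog true v -> u * v = - (v * u).
Proof. by move=> hu hv; rewrite (homog_supercomm hu hv) mulN1r. Qed.

Lemma homog_sqr u : homog true u -> u * u = 0.
Proof.
move=> hu; have /eqP := homog_anticomm hu hu; rewrite -addr_eq0 => /eqP h.
apply/ffunP => A; have := congr1 (fun f : grassmann K I => f A) h.
rewrite gaddE !gzeroE => /eqP; rewrite -mulr2n mulrn_eq0 /= => /eqP //.
Qed.

Lemma bodyD u v : body (u + v) = body u + body v. Proof. exact: gaddE. Qed.

Lemma bodyM u v : body (u * v) = body u * body v.
Proof.
rewrite /body gmulE (big_pred1 set0) => [|B]; last by rewrite subset0.
by rewrite set0D inversions0l mul1r.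
Qed.

Lemma body_scalar (k : K) : body (k%:A : grassmann K I) = k.
Proof. by rewrite /body gscaleE goneE eqxx mulr1. Qed.

Lemma body_odd u : homog true u -> body u = 0.
Proof. by move/homogP; apply; rewrite cards0. Qed.

Lemma homog_scalar (k : K) : homog false (k%:A : grassmann K I).
Proof. exact/homogZ/homog1. Qed.

Lemma gmul_proper_l a u A : (forall B, B \proper A -> u B = 0) ->
  (a * u) A = body a * u A.
Proof.
move=> h; rewrite gmulE (bigD1 set0) ?sub0set //= setD0 inversions0l mul1r.
rewrite big1 ?addr0 // => B /andP[sBA nB]; rewrite (h (A :\: B)) ?mulr0 //.
rewrite properEneq subsetDl andbT; apply: contraNneq nB => /setDidPl.
by rewrite -setI_eq0 (setIidPr sBA).
Qed.

Lemma gmul_proper_r a u A : (forall B, B \proper A -> u B = 0) ->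
  (u * a) A = u A * body a.
Proof.
move=> h; rewrite gmulE (bigD1 A) //= setDv inversions0r mul1r.
rewrite big1 ?addr0 // => B /andP[sBA nB]; rewrite (h B) ?mul0r ?mulr0 //.
by rewrite properEneq nB.
Qed.

(* Compare the coefficients of a monomial of least degree in u. *)
Lemma sylvester_eq0 a b u : body a + body b != 0 -> a * u + u * b = 0 -> u = 0.
Proof.
move=> nab h; apply/ffunP => A; rewrite gzeroE.
have [k] := ubnP #|A|; elim: k A => // k IH A; rewrite ltnS => leA.
have hp B : B \proper A -> u B = 0.
  by move=> pB; apply: IH; apply: leq_trans leA; apply: proper_card.
have := congr1 (fun f : grassmann K I => f A) h.
rewrite gaddE (gmul_proper_l _ hp) (gmul_proper_r _ hp) gzeroE [u A * _]mulrC -mulrDl.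
by move/eqP; rewrite mulf_eq0 (negbTE nab) => /eqP.
Qed.

Lemma body_lreg a u v : body a != 0 -> a * u = a * v -> u = v.
Proof.
move=> na h; apply/eqP; rewrite -subr_eq0; apply/eqP.
by apply: (@sylvester_eq0 a 0); rewrite ?mulr0 ?addr0 ?mulrBr ?h ?subrr // /body gzeroE addr0.
Qed.

Lemma body_rreg a u v : body a != 0 -> u * a = v * a -> u = v.
Proof.
move=> na h; apply/eqP; rewrite -subr_eq0; apply/eqP.
by apply: (@sylvester_eq0 0 a); rewrite ?mul0r ?add0r ?mulrBl ?h ?subrr // /body gzeroE add0r.
Qed.

(** s and t need not commute, hence the two-sided equation t(s - t) + (s - t)s = ss - tt = 0, with
    coefficients of positive body. *)
Lemma is_sqrt_uniq u s t : is_sqrt u s -> is_sqrt u t -> s = t.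
Proof.
move=> [ss s0] [tt t0]; apply/eqP; rewrite -subr_eq0; apply/eqP.
apply: (@sylvester_eq0 t s); first by rewrite gt_eqF ?addr_gt0.
by rewrite mulrBr mulrBl ss tt addrC subrKA subrr.
Qed.

(** Successive approximation: adding the error divided by the body of a raises by one the degree
    below which the error vanishes. *)
Lemma gdiv_ex a w : body a != 0 -> exists y, a * y = w.
Proof.
move=> na; suff [y hy] : exists y, forall A, (#|A| < #|I|.+1)%N -> (w - a * y) A = 0.
  exists y; apply/eqP; rewrite eq_sym -subr_eq0; apply/eqP/ffunP => A.
  by rewrite hy ?gzeroE // ltnS max_card.
elim: #|I|.+1 => [|k [y hy]]; first by exists 0.
exists (y + (body a)^-1 *: (w - a * y)) => A; rewrite ltnS => leA.
set dl := w - a * y in hy *.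
have hp B : B \proper A -> dl B = 0.
  by move=> /proper_card ltB; apply: hy; apply: leq_trans leA.
have -> : w - a * (y + (body a)^-1 *: dl) = dl - (body a)^-1 *: (a * dl).
  by rewrite mulrDr opprD addrA -scalerAr.
by rewrite gsubE gscaleE (gmul_proper_l _ hp) mulKf ?subrr.
Qed.

(** Newton's iteration by degree, starting from the root of the body; [c] is the inverse of twice
    that root. *)
Lemma is_sqrt_ex u : 0 < body u -> exists s, is_sqrt u s.
Proof.
move=> u0; have s0 : 0 < Num.sqrt (body u) by rewrite sqrtr_gt0.
suff [s [hs bs]] : exists s, (forall A, (#|A| < #|I|.+1)%N -> (u - s * s) A = 0) /\
    body s = Num.sqrt (body u).
  exists s; split; last by rewrite bs.
  apply/eqP; rewrite eq_sym -subr_eq0; apply/eqP/ffunP => A.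
  by rewrite hs ?gzeroE // ltnS max_card.
elim: #|I| => [|k [s [hs bs]]].
  exists (Num.sqrt (body u))%:A; split; last by rewrite body_scalar.
  move=> A; rewrite ltnS leqn0 cards_eq0 => /eqP ->.
  by rewrite gsubE -![_ set0]/(body _) bodyM body_scalar -expr2 sqr_sqrtr ?subrr // ltW.
set dl := u - s * s in hs *; set c := (Num.sqrt (body u) *+ 2)^-1.
have eu : u = dl + s * s by rewrite subrK.
clearbody dl; have d0 : body dl = 0 by rewrite /body hs ?cards0.
exists (s + c *: dl); split; last first.
  by rewrite bodyD bs /body gscaleE -/(body dl) d0 mulr0 addr0.
move=> A; rewrite ltnS => leA.
have hp B : B \proper A -> dl B = 0.
  by move=> /proper_card ltB; apply: hs; apply: leq_trans leA.
have -> : u - (s + c *: dl) * (s + c *: dl) =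
    dl - c *: (s * dl) - c *: (dl * s) - c *: (c *: (dl * dl)).
  rewrite {1}eu mulrDl !mulrDr -!scalerAl -!scalerAr !opprD !addrA.
  by rewrite addrK.
rewrite !(gsubE, gscaleE) !(gmul_proper_l _ hp) !(gmul_proper_r _ hp) d0 mul0r !mulr0 subr0 bs.
by rewrite /c; field; rewrite gt_eqF.
Qed.

(** With s0 and s1 the even and odd parts of s, the odd part of ss is s0 s1 + s1 s0. It vanishes,
    and s0 carries the positive body of s, so [sylvester_eq0] gives s1 = 0. *)
Lemma is_sqrt_homog u s : homog false u -> is_sqrt u s -> homog false s.
Proof.
move=> hu hs; have [s0 [s1 [h0 h1 es]]] := homog_split s.
have b0 : body s = body s0 by rewrite es bodyD (body_odd h1) addr0.
have e1 : s * s = s0 * s0 + (s0 * s1 + s0 * s1).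
  rewrite es mulrDl !mulrDr (homog_sqr h1) addr0 (homog_comm h0 h1) -addrA.
  by congr (_ + _).
have z : s0 * s1 + s1 * s0 = 0.
  rewrite -(homog_comm h0 h1); apply/ffunP => A; rewrite gzeroE.
  have /homogP ho : homog true (s0 * s1 + s0 * s1).
    by rewrite -[true]/(false (+) true); apply: homogD; apply: homogM.
  have [oA|oA] := boolP (odd #|A|); last by apply: ho; case: odd oA.
  have := congr1 (fun f : grassmann K I => f A) e1.
  rewrite (proj1 hs) (homogP _ _ hu A) ?oA // gaddE.
  by rewrite (homogP _ _ (homogM h0 h0) A) ?oA // add0r => <-.
suff e0 : s1 = 0 by rewrite es e0 addr0.
apply: sylvester_eq0 z; rewrite -b0.
by have := proj2 hs => ?; rewrite gt_eqF ?addr_gt0.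
Qed.

(** The even elements are made into a commutative ring of their own, so that [ring] applies to them
    and they can serve as coefficients for supercommuting variables. *)
Definition even_pred : {pred grassmann K I} := fun u => homog false u.

Lemma even_subring : subring_closed even_pred.
Proof.
split; first exact: homog1; move=> u v hu hv; first exact: homogB.
exact: (homogM hu hv).
Qed.

HB.instance Definition _ := GRing.isSubringClosed.Build _ even_pred
  even_subring.

Record evens := Evens { even_val : grassmann K I; _ : even_val \in even_pred }.
Lemma homog_evens (x : evens) : homog false (even_val x).
Proof. by case: x. Qed.

Lemma evens_ex u : homog false u -> exists x : evens, u = even_val x.
Proof. by move=> hu; exists (Evens hu). Qed.

HB.instance Definition _ := [isSub for even_val].
HB.instance Definition _ := [Choice of evens by <:].
HB.instance Definition _ := [SubChoice_isSubNzRing of evens by <:].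

Lemma evens_mulC : commutative (@GRing.mul evens).
Proof.
move=> x y; apply: val_inj; rewrite !rmorphM /=.
by apply: homog_central; apply: (valP x).
Qed.

HB.instance Definition _ := GRing.PzRing_hasCommutativeMul.Build evens evens_mulC.

HB.instance Definition _ := GRing.RMorphism.copy even_val (\val : evens -> grassmann K I).

Lemma even_valM (x y : evens) : even_val (x * y) = even_val x * even_val y.
Proof. by []. Qed.

Lemma even_valD (x y : evens) : even_val (x + y) = even_val x + even_val y.
Proof. by []. Qed.

Lemma even_valN (x : evens) : even_val (- x) = - even_val x.
Proof. by []. Qed.

Lemma even_val_inj : injective even_val.
Proof. exact: val_inj. Qed.

End GrassmannParity.

(** * Identities in supercommuting variables *)

Section Reflection.
Variables (K : rcfType) (I : finType).
Notation A := (grassmann K I).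
Variables (E : comNzRingType) (iota : {rmorphism E -> A}).
Hypothesis iota_even : forall c, homog false (iota c).
Implicit Types (xs : seq A).

(* exterior k represents E<xi_0, ..., xi_(k-1)>, an element (x, y) of
   exterior k.+1 standing for x + y * xi_0. The coefficient 0 is represented by
   None, to keep normal forms sparse. *)
Fixpoint exterior (k : nat) : Type :=
  if k is j.+1 then (exterior j * exterior j)%type else option E.

Fixpoint ext0 k : exterior k :=
  if k is j.+1 return exterior k then (ext0 j, ext0 j) else None.
Fixpoint extc k (c : E) : exterior k :=
  if k is j.+1 return exterior k then (extc j c, ext0 j) else Some c.
Fixpoint extv k (i : nat) : exterior k :=
  match k return exterior k with
  | 0 => None
  | j.+1 => match i with 0 => (ext0 j, extc j 1) | i'.+1 => (extv j i', ext0 j) end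
  end.
Fixpoint extadd k : exterior k -> exterior k -> exterior k :=
  match k with
  | 0 => fun x y => match x, y with
                    | None, _ => y
                    | Some _, None => x
                    | Some a, Some b => Some (a + b)
                    end
  | j.+1 => fun x y => (extadd x.1 y.1, extadd x.2 y.2)
  end.
Fixpoint extopp k : exterior k -> exterior k :=
  match k with
  | 0 => fun x => if x is Some a then Some (- a) else None
  | j.+1 => fun x => (extopp x.1, extopp x.2)
  end.
(* the automorphism changing the sign of each xi_i *)
Fixpoint extinv k : exterior k -> exterior k :=
  match k with
  | 0 => fun x => x
  | j.+1 => fun x => (extinv x.1, extopp (extinv x.2))
  end.
Fixpoint extmul k : exterior k -> exterior k -> exterior k :=
  match k with
  | 0 => fun x y => match x, y with Some a, Some b => Some (a * b) | _, _ => None end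
  | j.+1 => fun x y =>
     (extmul x.1 y.1, extadd (extmul x.1 y.2) (extmul x.2 (extinv y.1)))
  end.
Fixpoint exteq k : exterior k -> exterior k -> Prop :=
  match k with
  | 0 => fun x y => match x, y with
                    | None, None => True
                    | Some a, None => a = 0
                    | None, Some b => 0 = b
                    | Some a, Some b => a = b
                    end
  | j.+1 => fun x y => exteq x.1 y.1 /\ exteq x.2 y.2
  end.

Fixpoint exteval xs k : exterior k -> A :=
  match k with
  | 0 => fun x => if x is Some a then iota a else 0
  | j.+1 => fun x => exteval (behead xs) x.1 + exteval (behead xs) x.2 * head 0 xs
  end.

Lemma exteval_0 xs k : exteval xs (ext0 k) = 0.
Proof. by elim: k xs => [|k IH] xs //=; rewrite !IH mul0r addr0. Qed.

Lemma exteval_c xs k c : exteval xs (extc k c) = iota c.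
Proof.
elim: k xs c => [|k IH] xs c //=.
by rewrite !IH exteval_0 mul0r addr0.
Qed.

Lemma exteval_v xs i : exteval xs (extv (size xs) i) = nth 0 xs i.
Proof.
elim: xs i => [|x xs IH] [|i] //=; rewrite exteval_0.
  by rewrite add0r exteval_c rmorph1 mul1r.
by rewrite mul0r addr0 IH.
Qed.

Lemma exteval_add xs k (x y : exterior k) :
  exteval xs (extadd x y) = exteval xs x + exteval xs y.
Proof.
elim: k xs x y => [|k IH] xs x y /=.
  by case: x y => [a|] [b|] //=; rewrite ?rmorphD ?addr0 ?add0r.
by rewrite !IH mulrDl addrACA.
Qed.

Lemma exteval_opp xs k (x : exterior k) : exteval xs (extopp x) = - exteval xs x.
Proof.
elim: k xs x => [|k IH] xs x /=; first by case: x => [a|] //=; rewrite ?rmorphN ?oppr0.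
by rewrite !IH mulNr opprD.
Qed.

Lemma exteval_inv xs k (x : exterior k) t : homog true t ->
  all (homog true) xs -> t * exteval xs x = exteval xs (extinv x) * t.
Proof.
move=> ht; elim: k xs x => [|k IH] xs x hxs /=.
  case: x => [a|]; last by rewrite mulr0 mul0r.
  by rewrite [RHS]homog_central //; exact: iota_even.
have hb : all (homog true) (behead xs) by case: xs hxs => //= ? ? /andP[].
have hh : homog true (head 0 xs).
  by case: xs hxs {IH hb} => [_|? ? /andP[] //]; exact: homog0.
rewrite mulrDr IH // mulrDl mulrA IH // exteval_opp; congr (_ + _).
by rewrite mulNr mulNr -!mulrA (homog_anticomm ht hh) mulrN.
Qed.

Lemma exteval_mul xs k (x y : exterior k) : all (homog true) xs ->
  exteval xs (extmul x y) = exteval xs x * exteval xs y.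
Proof.
elim: k xs x y => [|k IH] xs x y hxs /=.
  by case: x y => [a|] [b|] //=; rewrite ?rmorphM ?mulr0 ?mul0r.
have hb : all (homog true) (behead xs) by case: xs hxs => //= ? ? /andP[].
have hh : homog true (head 0 xs).
  by case: xs hxs {IH hb} => [_|? ? /andP[] //]; exact: homog0.
have e1 := exteval_inv y.1 hh hb; have e2 := exteval_inv y.2 hh hb.
rewrite exteval_add !IH // !mulrDl !mulrDr -!mulrA e1 [head 0 xs * (_ * _)]mulrA e2.
by rewrite -[exteval _ (extinv y.2) * _ * _]mulrA homog_sqr // !mulr0 addr0 addrA.
Qed.

Lemma exteval_eq xs k (x y : exterior k) : exteq x y -> exteval xs x = exteval xs y.
Proof.
elim: k xs x y => [|k IH] xs x y /=; last by case=> h1 h2; rewrite (IH _ _ _ h1) (IH _ _ _ h2).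
by case: x y => [a|] [b|] //= => [->|->|<-] //; rewrite rmorph0.
Qed.

Inductive sexpr : Type :=
| SC of E | SV of nat | SAdd of sexpr & sexpr | SMul of sexpr & sexpr | SOpp of sexpr.

Fixpoint seval xs (e : sexpr) : A :=
  match e with
  | SC c => iota c
  | SV i => nth 0 xs i
  | SAdd a b => seval xs a + seval xs b
  | SMul a b => seval xs a * seval xs b
  | SOpp a => - seval xs a
  end.

Fixpoint snorm k (e : sexpr) : exterior k :=
  match e with
  | SC c => extc k c
  | SV i => extv k i
  | SAdd a b => extadd (snorm k a) (snorm k b)
  | SMul a b => extmul (snorm k a) (snorm k b)
  | SOpp a => extopp (snorm k a)
  end.

Lemma seval_norm xs e : all (homog true) xs ->
  seval xs e = exteval xs (snorm (size xs) e).
Proof.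
move=> h; elim: e => [c|i|a IHa b IHb|a IHa b IHb|a IHa] /=.
- by rewrite exteval_c.
- by rewrite exteval_v.
- by rewrite exteval_add IHa IHb.
- by rewrite exteval_mul // IHa IHb.
- by rewrite exteval_opp IHa.
Qed.

Lemma seval_eq xs e1 e2 : all (homog true) xs ->
  exteq (snorm (size xs) e1) (snorm (size xs) e2) -> seval xs e1 = seval xs e2.
Proof. by move=> h e; rewrite !seval_norm //; apply: exteval_eq. Qed.

End Reflection.

Ltac sindex t xs :=
  match xs with
  | cons ?y ?r => match constr:(Set) with
     | _ => let _ := constr:(erefl : t = y) in constr:(0%N)
     | _ => let i := sindex t r in constr:(i.+1)
     end
  end.

Ltac sreify f xs t :=
  match t with
  | GRing.add ?a ?b =>
    let a' := sreify f xs a in let b' := sreify f xs b in constr:(SAdd a' b')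
  | GRing.mul ?a ?b =>
    let a' := sreify f xs a in let b' := sreify f xs b in constr:(SMul a' b')
  | GRing.opp ?a => let a' := sreify f xs a in constr:(SOpp a')
  | ?g ?c => let _ := match constr:(Set) with _ => constr_eq f g end in constr:(SC c)
  | _ => let i := sindex t xs in
    match type of f with ?E -> _ => constr:(@SV E i) | forall _ : ?E, _ => constr:(@SV E i) end
  end.

(* sring h [:: x_1; ...; x_k] proves identities between elements of the
   Grassmann algebra that hold in supercommuting variables, where the x_i are
   odd and h states that the elements iota c are even. *)
Ltac sring h xs :=
  match type of h with
  | forall c, is_true (homog false (@?f' c)) =>
  let E := match type of f' with forall _ : ?E, _ => E end in
  match goal with
  | |- ?l = ?r =>
    let f := match f' with fun c => ?g c => g end in
    let l' := sreify f xs l in let r' := sreify f xs r in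
    refine (seval_eq (e1 := l') (e2 := r') h (xs := xs) _ _);
    [ rewrite /=; repeat (apply/andP; split); assumption || done
    | cbv [snorm size ext0 extc extv extadd extopp extinv extmul exteq fst snd];
      repeat (refine (conj _ _)); (exact Logic.I || ring) ]
  end end.

(** * Spinors *)

Section Spinors.
Variables (K : rcfType) (I : finType) (n : nat).
Notation A := (grassmann K I).
Variables (E : comNzRingType) (iota : {rmorphism E -> A}).
Hypothesis iota_even : forall c, homog false (iota c).
Variables (p q : 'I_n -> E) (xi : 'I_n -> A).
Hypothesis xi_odd : forall i, homog true (xi i).

Definition pairing (i j : 'I_n) : A :=
  iota (p i * q j - q i * p j) - xi i * xi j.

Definition osp_vol (i j k : 'I_n) : A :=
  xi i * pairing j k - xi j * pairing i k + xi k * pairing i j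
  + xi i * xi j * xi k.

Lemma pairing_even i j : homog false (pairing i j).
Proof.
have h := homogM (xi_odd i) (xi_odd j); exact: (homogB (iota_even _) h).
Qed.

Lemma osp_vol_odd i j k : homog true (osp_vol i j k).
Proof.
have hM x y z := homogM (xi_odd x) (pairing_even y z).
have h3 := homogM (homogM (xi_odd i) (xi_odd j)) (xi_odd k).
exact: (homogD (homogD (homogB (hM i j k) (hM j i k)) (hM k i j)) h3).
Qed.

Lemma pairingC i j : pairing i j = - pairing j i.
Proof.
rewrite /pairing; have hi := xi_odd i; have hj := xi_odd j.
move: (xi i) (xi j) hi hj => x y hx hy; sring iota_even [:: x; y].
Qed.

Lemma osp_vol_swap i j k : osp_vol i j k = - osp_vol j i k.
Proof.
rewrite /osp_vol /pairing; have hi := xi_odd i; have hj := xi_odd j; have hk := xi_odd k.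
move: (xi i) (xi j) (xi k) hi hj hk => x y z hx hy hz; sring iota_even [:: x; y; z].
Qed.

Lemma osp_vol_cycle i j k : osp_vol i j k = osp_vol j k i.
Proof.
rewrite /osp_vol /pairing; have hi := xi_odd i; have hj := xi_odd j; have hk := xi_odd k.
move: (xi i) (xi j) (xi k) hi hj hk => x y z hx hy hz; sring iota_even [:: x; y; z].
Qed.

Lemma super_plucker i j k l :
  pairing i k * (pairing i k * pairing j l - pairing i j * pairing k l
                 - pairing i l * pairing j k) = osp_vol i j k * osp_vol i k l.
Proof.
rewrite /osp_vol /pairing.
have hi := xi_odd i; have hj := xi_odd j; have hk := xi_odd k; have hl := xi_odd l.
move: (xi i) (xi j) (xi k) (xi l) hi hj hk hl => x y z t hx hy hz ht.
sring iota_even [:: x; y; z; t].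
Qed.

Lemma osp_vol_plucker i j k l :
  pairing i k * osp_vol i j l = pairing i j * osp_vol i k l + pairing i l * osp_vol i j k.
Proof.
rewrite /osp_vol /pairing.
have hi := xi_odd i; have hj := xi_odd j; have hk := xi_odd k; have hl := xi_odd l.
move: (xi i) (xi j) (xi k) (xi l) hi hj hk hl => x y z t hx hy hz ht.
sring iota_even [:: x; y; z; t].
Qed.

Lemma osp_vol_plucker_last i j k l :
  pairing i k * osp_vol j k l = pairing j k * osp_vol i k l - pairing k l * osp_vol i j k.
Proof.
have := osp_vol_plucker k j i l.
rewrite (osp_vol_swap k j l) (osp_vol_swap k i l) (osp_vol_cycle k j i) (osp_vol_swap j i k).
by rewrite (pairingC k i) (pairingC k j) !mulrNN mulrN.
Qed.

End Spinors.

(** * The algebra of a super flip *)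

Section FlipAlgebra.
Variables (K : rcfType) (I : finType).
Notation A := (grassmann K I).

(** The part of u of the wrong parity is annihilated by c, which is regular because its body is
    nonzero. *)
Lemma homog_unmul b (c u : A) : homog false c -> body c != 0 ->
  homog b (c * u) -> homog b u.
Proof.
move=> hc nc hu; have [u0 [u1 [h0 h1 eu]]] := homog_split u.
suff: (if b then u0 else u1) = 0 by rewrite eu; case: b {hu} => ->; rewrite ?addr0 ?add0r.
apply: (body_lreg nc); rewrite mulr0; apply/ffunP => S; rewrite gzeroE.
have H0 := homogP _ _ (homogM hc h0) S; have H1 := homogP _ _ (homogM hc h1) S.
have Hu := homogP _ _ hu S; move: Hu; rewrite eu mulrDr gaddE.
case: b {hu eu}; move: H0 H1; case: (odd #|S|) => /= H0 H1.
- by rewrite H0.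
- by rewrite H1 // addr0; apply.
- by rewrite H0 // add0r; apply.
- by rewrite H1.
Qed.

Variables (E : comNzRingType) (iota : {rmorphism E -> A}).
Hypothesis iota_even : forall c, homog false (iota c).

Lemma iota_regl c (u v : A) : body (iota c) != 0 -> iota c * u = iota c * v -> u = v.
Proof. exact: body_lreg. Qed.

(* The difference of the two roots is a multiple of t after multiplication by
   their sum, which is regular. *)
Lemma sqrt_absorb (t : A) (x y : E) : homog true t -> body (iota x) + body (iota y) != 0 ->
  t * iota (x * x) = t * iota (y * y) -> t * iota x = t * iota y.
Proof.
move=> ht nb h; apply: (@iota_regl (x + y)); first by rewrite rmorphD bodyD.
apply/eqP; rewrite -subr_eq0 -mulrBr; apply/eqP.
transitivity (t * iota (x * x) - t * iota (y * y)); last by rewrite h subrr.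
sring iota_even [:: t].
Qed.

Lemma sqrt_prod (x y : E) r : 0 < body (iota x) -> 0 < body (iota y) ->
  is_sqrt (iota (x * x) * iota (y * y)) r -> r = iota (x * y).
Proof.
move=> hx hy hr; apply: is_sqrt_uniq hr _; split; last by rewrite rmorphM bodyM mulr_gt0.
by rewrite -!rmorphM mulrACA.
Qed.

Lemma sqrt_prod3 (x y z : E) : 0 < body (iota x) -> 0 < body (iota y) ->
  0 < body (iota z) ->
  is_sqrt (iota (x * x) * iota (y * y) * iota (z * z)) (iota (x * y * z)).
Proof.
move=> hx hy hz; split; last by rewrite !rmorphM !bodyM !mulr_gt0.
by rewrite -!rmorphM; congr (iota _); ring.
Qed.

Lemma sqrt_prod4 (x y z t : E) : 0 < body (iota x) -> 0 < body (iota y) ->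
  0 < body (iota z) -> 0 < body (iota t) ->
  is_sqrt (iota (x * x) * iota (y * y) * iota (z * z) * iota (t * t)) (iota (x * y * z * t)).
Proof.
move=> hx hy hz ht; split; last by rewrite !rmorphM !bodyM !mulr_gt0.
by rewrite -!rmorphM; congr (iota _); ring.
Qed.

(* ra, ..., re are square roots of the lambda-lengths of PS, SR, RQ, QP and PR,
   F is the lambda-length of QS, and N1, N2 are the volumes of PQR and PRS, up to
   signs. *)
Variables (ra rb rc rd re F : E) (sg th N1 N2 f : A).
Hypothesis nre : body (iota re) != 0.
Hypothesis hsg : homog true sg.
Hypothesis hth : homog true th.
Hypothesis hN1 : sg * iota (rd * rc * re) = N1.
Hypothesis hN2 : th * iota (re * rb * ra) = N2.
Hypothesis plucker : iota (re * re) * (iota (re * re) * iota F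
  - iota (ra * ra * (rc * rc)) - iota (rb * rb * (rd * rd))) = N1 * N2.

Lemma flip_alg_ef : iota (re * re) * iota F =
  iota (ra * ra * (rc * rc) + rb * rb * (rd * rd)) + iota (ra * rb * rc * rd) * sg * th.
Proof.
have nee : body (iota (re * re)) != 0 by rewrite rmorphM bodyM mulf_neq0.
apply: (iota_regl nee).
transitivity (iota (re * re) * iota (ra * ra * (rc * rc) + rb * rb * (rd * rd)) + N1 * N2).
  by rewrite -plucker; sring iota_even (Nil A).
by rewrite -hN1 -hN2; sring iota_even [:: sg; th].
Qed.

Lemma flip_alg_lambda :
  iota (re * re) * f = iota (ra * ra * (rc * rc)) + iota (rb * rb * (rd * rd))
     + iota (ra * rb * rc * rd) * sg * th ->
  f = iota F.
Proof.
have nee : body (iota (re * re)) != 0 by rewrite rmorphM bodyM mulf_neq0.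
by move=> hf; apply: (iota_regl nee); rewrite flip_alg_ef hf rmorphD.
Qed.

Variables (rF rz : E).
Hypothesis hF : F = rF * rF.
Hypothesis hz : iota (rz * rz) = iota (ra * ra * (rc * rc) + rb * rb * (rd * rd)).
Hypothesis npos : body (iota (re * rF)) + body (iota rz) != 0.
Hypothesis nrz : body (iota rz) != 0.

(** These are the roots of ef and of ac + bd: their squares differ by a multiple of sg th, which th
    annihilates. *)
Lemma flip_alg_absorb_th : th * iota (re * rF) = th * iota rz.
Proof.
apply: sqrt_absorb => //.
have -> : iota (re * rF * (re * rF)) = iota (re * re) * iota F.
  by rewrite hF -rmorphM; congr (iota _); ring.
rewrite flip_alg_ef hz; sring iota_even [:: sg; th].
Qed.

Lemma flip_alg_absorb_sg : sg * iota (re * rF) = sg * iota rz.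
Proof.
apply: sqrt_absorb => //.
have -> : iota (re * rF * (re * rF)) = iota (re * re) * iota F.
  by rewrite hF -rmorphM; congr (iota _); ring.
rewrite flip_alg_ef hz; sring iota_even [:: sg; th].
Qed.

(** After multiplication by e and by the root of ac + bd, the root of ef stands next to sg and th,
    where it may be replaced by that of ac + bd; what remains is the linear relation between
    volumes. *)
Lemma flip_alg_theta (N3 th' : A) :
  iota (re * re) * N3 = iota (rd * rd) * N2 + iota (ra * ra) * N1 ->
  th' * iota rz = th * iota (rb * rd) + sg * iota (ra * rc) ->
  th' * iota (rd * rF * ra) = N3.
Proof.
move=> hN3 hth'.
have nee : body (iota (re * re * rz)) != 0 by rewrite !rmorphM !bodyM !mulf_neq0.
apply: (iota_regl nee).
transitivity (iota (re * rd * ra) * ((th * iota (re * rF)) * iota (rb * rd) +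
                                     (sg * iota (re * rF)) * iota (ra * rc))).
  transitivity (th' * iota rz * iota (re * re * (rd * rF * ra))).
    rewrite mulrA (homog_central _ (iota_even _)) -!mulrA -!rmorphM.
    by congr (_ * iota _); ring.
  by rewrite hth'; sring iota_even [:: sg; th].
rewrite flip_alg_absorb_th flip_alg_absorb_sg.
transitivity (iota rz * (iota (re * re) * N3)); last first.
  by rewrite mulrA -rmorphM; congr (iota _ * _); ring.
by rewrite hN3 -hN1 -hN2; sring iota_even [:: sg; th].
Qed.

Lemma flip_alg_sigma (N4 sg' : A) :
  iota (re * re) * N4 = iota (rb * rb) * N1 - iota (rc * rc) * N2 ->
  sg' * iota rz = sg * iota (rb * rd) - th * iota (ra * rc) ->
  sg' * iota (rc * rb * rF) = N4.
Proof.
move=> hN4 hsg'.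
have nee : body (iota (re * re * rz)) != 0 by rewrite !rmorphM !bodyM !mulf_neq0.
apply: (iota_regl nee).
transitivity (iota (re * rc * rb) * ((sg * iota (re * rF)) * iota (rb * rd) -
                                     (th * iota (re * rF)) * iota (ra * rc))).
  transitivity (sg' * iota rz * iota (re * re * (rc * rb * rF))).
    rewrite mulrA (homog_central _ (iota_even _)) -!mulrA -!rmorphM.
    by congr (_ * iota _); ring.
  by rewrite hsg'; sring iota_even [:: sg; th].
rewrite flip_alg_absorb_th flip_alg_absorb_sg.
transitivity (iota rz * (iota (re * re) * N4)); last first.
  by rewrite mulrA -rmorphM; congr (iota _ * _); ring.
by rewrite hN4 -hN1 -hN2; sring iota_even [:: sg; th].
Qed.

End FlipAlgebra.

(** * The inverse of a super flip *)

Section FlipInverse.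
Variables (K : rcfType) (I : finType).
Notation A := (grassmann K I).
Variables (E : comNzRingType) (iota : {rmorphism E -> A}).
Hypothesis iota_even : forall c, homog false (iota c).
Variables (ac bd rac rbd rz : E) (sg th sg' th' : A).
Hypothesis nrz : body (iota rz) != 0.
Hypothesis hsg : homog true sg.
Hypothesis hth : homog true th.
Hypothesis hsg1 : homog true sg'.
Hypothesis hth1 : homog true th'.
Hypothesis hac : rac * rac = ac.
Hypothesis hbd : rbd * rbd = bd.
Hypothesis hz : rz * rz = ac + bd.
Hypothesis hsg' : sg' * iota rz = sg * iota rbd - th * iota rac.
Hypothesis hth' : th' * iota rz = th * iota rbd + sg * iota rac.

(** In the inverse flip the diagonal is QS read from Q, th' plays the part of theta, and the roots
    of ac and bd trade places. Thus PQR recovers sg, whereas [flip_inv_sigma] gives PRS the value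
    -th. *)
Lemma flip_inv_theta : sg * iota rz = th' * iota rac + sg' * iota rbd.
Proof.
apply: (@body_rreg _ _ (iota rz)) => //.
transitivity (sg * iota (ac + bd)); first by rewrite -mulrA -rmorphM hz.
transitivity (th' * iota rz * iota rac + sg' * iota rz * iota rbd).
  by rewrite hsg' hth' -hac -hbd; sring iota_even [:: sg; th].
by sring iota_even [:: sg'; th'].
Qed.

Lemma flip_inv_sigma : - th * iota rz = sg' * iota rac - th' * iota rbd.
Proof.
apply: (@body_rreg _ _ (iota rz)) => //.
transitivity (- th * iota (ac + bd)); first by rewrite -mulrA -rmorphM hz.
transitivity (sg' * iota rz * iota rac - th' * iota rz * iota rbd).
  by rewrite hsg' hth' -hac -hbd; sring iota_even [:: sg; th].
by sring iota_even [:: sg'; th'].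
Qed.

Lemma flip_inv_prod : sg' * th' = sg * th.
Proof.
apply: (@body_rreg _ _ (iota (rz * rz))); first by rewrite rmorphM bodyM mulf_neq0.
transitivity ((sg' * iota rz) * (th' * iota rz)); first by sring iota_even [:: sg'; th'].
by rewrite hsg' hth' hz -hac -hbd; sring iota_even [:: sg; th].
Qed.

End FlipInverse.

(** * Signs in a flipped quadrilateral *)

Section FlipSigns.
Variables (K : rcfType) (I : finType).
Notation A := (grassmann K I).
Variables (E : comNzRingType) (iota : {rmorphism E -> A}).
Hypothesis iota_even : forall c, homog false (iota c).

(** bQ, bR, bS tell whether Q, R, S are smaller than P, and g1, g2 are the gauge signs of PQR and
    PRS; [hg] is the relation that [compat_tail] imposes when the diagonal PR has tail P. *)
Variables (bQ bR bS g1 g2 : bool).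
Hypothesis hg : g1 (+) g2 = bQ (+) bS.
(* l_XY is the pairing of the spinors at X and Y, v_XYZ the volume of a triple *)
Variables (lPQ lQR lRS lPS lPR vPQR vPRS vPQS vQRS : A).
Variables (a b c d e f : E).
Hypothesis lPQE : lPQ = (-1) ^+ bQ * iota d.
Hypothesis lQRE : lQR = (-1) ^+ (bQ (+) bR) * iota c.
Hypothesis lRSE : lRS = (-1) ^+ (bR (+) bS) * iota b.
Hypothesis lPSE : lPS = (-1) ^+ bS * iota a.
Hypothesis lPRE : lPR = (-1) ^+ bR * iota e.
Hypothesis oPQR : homog true vPQR.
Hypothesis oPRS : homog true vPRS.
Hypothesis oPQS : homog true vPQS.
Hypothesis oQRS : homog true vQRS.

Lemma flip_sign_lambda :
  lPR * (lPR * iota f - lPQ * lRS - lPS * lQR) = vPQR * vPRS ->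
  iota e * (iota e * ((-1) ^+ (bQ (+) bS) * iota f) - iota (a * c) - iota (b * d)) =
  ((-1) ^+ g1 * vPQR) * ((-1) ^+ g2 * vPRS).
Proof.
have -> : ((-1) ^+ g1 * vPQR) * ((-1) ^+ g2 * vPRS) = (-1) ^+ (g1 (+) g2) * (vPQR * vPRS).
  by case: g1 g2 => [] [] /=; rewrite ?(expr0, expr1, mul1r, mulN1r);
    sring iota_even [:: vPQR; vPRS].
move=> <-; rewrite hg lPRE lPQE lQRE lRSE lPSE.
by case: bQ bR bS => [] [] [] /=; rewrite ?(expr0, expr1, mul1r, mulN1r);
  sring iota_even (Nil A).
Qed.

Lemma flip_sign_theta :
  lPR * vPQS = lPQ * vPRS + lPS * vPQR ->
  iota e * ((-1) ^+ (bR (+) bQ (+) g2) * vPQS) =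
  iota d * ((-1) ^+ g2 * vPRS) + iota a * ((-1) ^+ g1 * vPQR).
Proof.
move=> h; transitivity ((-1) ^+ (bQ (+) g2) * (lPR * vPQS)).
  by rewrite lPRE; case: bQ bR g2 => [] [] [] /=; rewrite ?(expr0, expr1, mul1r, mulN1r);
    sring iota_even [:: vPQS].
rewrite h lPQE lPSE; have -> : g1 = bQ (+) bS (+) g2 by rewrite -hg addbK.
by case: bQ bS g2 => [] [] [] /=; rewrite ?(expr0, expr1, mul1r, mulN1r);
    sring iota_even [:: vPRS; vPQR].
Qed.

Lemma flip_sign_sigma :
  lPR * vQRS = lQR * vPRS - lRS * vPQR ->
  iota e * ((-1) ^+ (~~ (bS (+) g1)) * vQRS) =
  iota b * ((-1) ^+ g1 * vPQR) - iota c * ((-1) ^+ g2 * vPRS).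
Proof.
move=> h; transitivity ((-1) ^+ (~~ (bR (+) bS (+) g1)) * (lPR * vQRS)).
  by rewrite lPRE; case: bS bR g1 => [] [] [] /=; rewrite ?(expr0, expr1, mul1r, mulN1r);
    sring iota_even [:: vQRS].
rewrite h lQRE lRSE; have -> : g2 = bQ (+) bS (+) g1 by rewrite -hg addbC addKb.
by case: bQ bR bS g1 => [] [] [] [] /=; rewrite ?(expr0, expr1, mul1r, mulN1r);
    sring iota_even [:: vPRS; vPQR].
Qed.

End FlipSigns.

(** * States reachable by flips *)

Section GoodStates.
Variables (n : nat) (K : rcfType) (I : finType).
Notation A := (grassmann K I).
Implicit Types (s : state n K I) (P Q R S b c : 'I_n) (u : A).

Definition pos_even u := homog false u && (0 < body u).

Lemma pos_evenM u v : pos_even u -> pos_even v -> pos_even (u * v).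
Proof.
case/andP=> h1 h2 /andP[h3 h4]; apply/andP; split; first exact: (homogM h1 h3).
by rewrite bodyM mulr_gt0.
Qed.

Lemma pos_evenD u v : pos_even u -> pos_even v -> pos_even (u + v).
Proof.
case/andP=> h1 h2 /andP[h3 h4]; apply/andP; split; first exact: (homogD h1 h3).
by rewrite bodyD addr_gt0.
Qed.

Lemma pos_even_body u : pos_even u -> body u != 0.
Proof. by case/andP=> _ h; rewrite gt_eqF. Qed.

Lemma pos_even_sqrt u r : pos_even u -> is_sqrt u r -> pos_even r.
Proof.
case/andP=> h1 h2 hr; apply/andP; split; first exact: is_sqrt_homog hr.
by case: hr.
Qed.

Lemma pos_even_sqrt_ex u : pos_even u -> exists2 r, is_sqrt u r & pos_even r.
Proof.
move=> hu; have [_ hb] := andP hu; have [r hr] := is_sqrt_ex hb.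
by exists r => //; apply: pos_even_sqrt hr.
Qed.

Record good s : Prop := Good {
  good_triangulation : triangulation (arcs s);
  good_tail : forall e, e \in arcs s -> tail s e \in e;
  good_lam : forall e, e \in arcs s -> pos_even (lam s e);
  good_mu : forall D, homog true (mu s D)
}.

Lemma arc_headE (t : {set 'I_n} -> 'I_n) p q : p != q ->
  t [set p; q] = p -> arc_head t [set p; q] = q.
Proof.
move=> npq tp; rewrite /arc_head tp; case: pickP => [x|/(_ q)].
  by rewrite !inE => /andP[/negbTE->] /eqP.
by rewrite !inE eqxx orbT andbT eq_sym npq.
Qed.

Lemma arc_head_in (t : {set 'I_n} -> 'I_n) (e : {set 'I_n}) : t e \in e -> arc_head t e \in e.
Proof. by move=> h; rewrite /arc_head; case: pickP => //= x; rewrite !inE => /andP[]. Qed.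

(** f, theta' and sigma' are known only through products with even elements of nonzero body, which
    [homog_unmul] removes. The body of f is positive because the term containing mu-invariants has
    body 0. *)
Lemma flip_good s s' : good s -> flip s s' -> good s'.
Proof.
move=> [tT tt tl tm] [P [Q [R [S [f [th' [sg' [rac [rbd [rabcd [rz]]]]]]]]]]] /=.
move=> [/and5P[aPR aPS aSR aRQ aQP] /and3P[/eqP tP c1 c2] [q1 q2 q3 q4] [e1 e2 e3] ->].
have c : cyc4 P Q R S by rewrite /cyc4 c1 c2.
have qT : quad (arcs s) P Q R S.
  by split; rewrite set2C.
have hPR := tl _ aPR; have hPS := tl _ aPS; have hSR := tl _ aSR; have hRQ := tl _ aRQ.
have hQP := tl _ aQP.
have hac := pos_evenM hPS hRQ; have hbd := pos_evenM hSR hQP.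
have habcd := pos_evenM (pos_evenM (pos_evenM hPS hSR) hRQ) hQP.
have hz := pos_evenD hac hbd.
have rac_e := pos_even_sqrt hac q1; have rbd_e := pos_even_sqrt hbd q2.
have r4_e := pos_even_sqrt habcd q3; have rz_e := pos_even_sqrt hz q4.
have [hm1 hm2] := (tm [set P; R; S], tm [set P; Q; R]).
have eveM (u v : A) (b1 : bool) : pos_even u -> homog b1 v -> homog b1 (v * u).
  move=> /andP[hu _] hv; rewrite -homog_central //; exact: (homogM hu hv).
have unm (u v : A) (b1 : bool) : pos_even u -> homog b1 (v * u) -> homog b1 v.
  move=> hu; rewrite -homog_central; last by case/andP: hu.
  by apply: homog_unmul; [case/andP: hu | exact: pos_even_body].
split=> /=.
- exact: flip_triangulation.
- move=> e; rewrite !inE; have [->|ne] := eqVneq e [set Q; S].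
    by move=> _; rewrite set21.
  rewrite /=; have [-> _|_ /andP[_ /tt //]] := eqVneq e [set S; R].
  exact/arc_head_in/tt.
- move=> e; rewrite !inE; have [_ _|ne /= /andP[_ /tl]] := eqVneq e [set Q; S]; last by [].
  have hst : homog true (rabcd * mu s [set P; Q; R]).
    by case/andP: r4_e => h _; exact: (homogM h hm2).
  have hst2 : homog false (rabcd * mu s [set P; Q; R] * mu s [set P; R; S]).
    exact: (homogM hst hm1).
  have hb0 : body (rabcd * mu s [set P; Q; R] * mu s [set P; R; S]) = 0.
    by rewrite bodyM (body_odd hm1) mulr0.
  apply/andP; split.
    apply: (@homog_unmul _ _ _ (lam s [set P; R])).
    - by case/andP: hPR.
    - exact: pos_even_body.
    - by rewrite e1; apply: homogD => //; case/andP: hz.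
  have := congr1 (@body _ _) e1; rewrite bodyM bodyD hb0 addr0.
  case/andP: hPR => _ p1; case/andP: hz => _ p2 => e4.
  by rewrite -(pmulr_rgt0 _ p1) e4.
- move=> D /=; case: eqVneq => _.
    by apply: (unm _ _ _ rz_e); rewrite e2; apply: homogD; apply: eveM.
  case: eqVneq => _ //.
  by apply: (unm _ _ _ rz_e); rewrite e3; apply: homogB; apply: eveM.
Qed.

Lemma flip_ex s P Q R S : good s -> cyc4 P Q R S -> quad (arcs s) P Q R S ->
  [set P; R] \in arcs s -> tail s [set P; R] = P ->
  exists2 s', flip s s' & arcs s' = flip_arcs (arcs s) P Q R S.
Proof.
move=> [tT tt tl tm] c [aPQ aQR aRS aSP] aPR tP.
have aPS : [set P; S] \in arcs s by rewrite set2C.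
have aSR : [set S; R] \in arcs s by rewrite set2C.
have aRQ : [set R; Q] \in arcs s by rewrite set2C.
have aQP : [set Q; P] \in arcs s by rewrite set2C.
have hPR := tl _ aPR; have hPS := tl _ aPS; have hSR := tl _ aSR; have hRQ := tl _ aRQ.
have hQP := tl _ aQP.
have hac := pos_evenM hPS hRQ; have hbd := pos_evenM hSR hQP.
have habcd := pos_evenM (pos_evenM (pos_evenM hPS hSR) hRQ) hQP.
have hz := pos_evenD hac hbd.
have [rac q1 _] := pos_even_sqrt_ex hac; have [rbd q2 _] := pos_even_sqrt_ex hbd.
have [rabcd q3 _] := pos_even_sqrt_ex habcd; have [rz q4 rz_e] := pos_even_sqrt_ex hz.
have rdiv w : exists y, y * rz = w.
  have [y hy] := gdiv_ex w (pos_even_body rz_e); exists y.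
  by rewrite -homog_central //; case/andP: rz_e.
have [f hf] := gdiv_ex (lam s [set P; S] * lam s [set R; Q] + lam s [set S; R] * lam s [set Q; P]
  + rabcd * mu s [set P; Q; R] * mu s [set P; R; S]) (pos_even_body hPR).
have [th' hth'] := rdiv (mu s [set P; R; S] * rbd + mu s [set P; Q; R] * rac).
have [sg' hsg'] := rdiv (mu s [set P; Q; R] * rbd - mu s [set P; R; S] * rac).
eexists; first exists P, Q, R, S, f, th', sg', rac, rbd, rabcd, rz => /=.
  split; last reflexivity.
  - by rewrite aPR aPS aSR aRQ.
  - by rewrite tP eqxx; exact: c.
  - by split.
  - by split.
by [].
Qed.

Lemma flip_towards s b c : good s -> c != b -> [set c; b] \notin arcs s ->
  exists s' r, [/\ flip s s', c != r, [set c; r] \notin arcs s, [set c; r] \in arcs s'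
   & forall x, [set c; x] \in arcs s -> [set c; x] \in arcs s'].
Proof.
move=> gs ncb nE; have [tT tt tl tm] := gs.
have [p [r [q [c4 qT pqT]]]] := flip_towards_ex tT ncb nE.
have [n1 n2 n3 n4 /andP[n5 n6]] := cyc4_neq c4.
have /triangulationP[_ nT _] := tT.
have crT : [set c; r] \notin arcs s.
  apply/negP => h; have [c1 c2] := andP c4.
  have [d1 d2 d3 d4] := cyc4_ccw c4.
  by apply: (nT p q c r) => //; rewrite ccw_rot ccw_rot.
have keep x : [set c; x] \in arcs s -> [set c; x] != [set p; q].
  by move=> _; apply: side_neq; rewrite eq_sym.
(* [flip] requires the diagonal to start at its vertex P, so the orientation decides which of p and
   q plays that part. *)
have [tp|tp] : tail s [set p; q] = p \/ tail s [set p; q] = q.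
  by have := tt _ pqT; rewrite !inE => /orP[] /eqP; auto.
- have [s' fs es'] := flip_ex gs c4 qT pqT tp.
  exists s', r; split=> //; first by rewrite eq_sym.
    by rewrite es' /flip_arcs set2C !inE eqxx.
  by move=> x cx; rewrite es' !inE cx andbT keep ?orbT.
- have c4' : cyc4 q c p r by rewrite -cyc4_rot -cyc4_rot.
  have qT' : quad (arcs s) q c p r by case: qT.
  have qpT : [set q; p] \in arcs s by rewrite set2C.
  have tp' : tail s [set q; p] = q by rewrite set2C.
  have [s' fs es'] := flip_ex gs c4' qT' qpT tp'.
  exists s', r; split=> //; first by rewrite eq_sym.
    by rewrite es' !inE eqxx.
  by move=> x cx; rewrite es' !inE cx andbT (set2C q) keep ?orbT.
Qed.

Lemma flips_good s s' : good s -> flips s s' -> good s'.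
Proof. by move=> gs; elim=> // s1 s2 _ g1 /(flip_good g1). Qed.

Lemma flips_trans s s1 s2 : flips s s1 -> flips s1 s2 -> flips s s2.
Proof. by move=> h; elim=> // s3 s4 _ h3 h4; apply: flips_step h3 h4. Qed.

(** Each flip adds a neighbour to c and removes none, although the new neighbour need not be the
    vertex b aimed at. *)
Lemma fan_reachable s c : good s ->
  exists2 s', flips s s' & forall b, c != b -> [set c; b] \in arcs s'.
Proof.
have [k] := ubnP #|[set b | (c != b) && ([set c; b] \notin arcs s)]|.
elim: k s => // k IH s; rewrite ltnS => lek gs.
have [h|] := boolP [forall b, (c != b) ==> ([set c; b] \in arcs s)].
  by exists s; [exact: flips_refl | move=> b; apply/implyP/(forallP h)].
case/forallPn => b; rewrite negb_imply => /andP[ncb nE].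
have [s1 [r [fs ncr nr rE keep]]] := flip_towards gs ncb nE.
have [|s' fs' hs'] := IH s1 _ (flip_good gs fs).
  apply: leq_trans lek; apply: proper_card; apply/properP; split.
    apply/subsetP => x; rewrite !inE => /andP[-> /=]; apply: contra; exact: keep.
  by exists r; rewrite !inE ncr ?nr // rE.
exists s' => //; apply: flips_trans fs'.
by apply: flips_step fs; apply: flips_refl.
Qed.

End GoodStates.

(** * States realized by spinors *)

Section Compatible.
Variables (n : nat) (K : rcfType) (I : finType).
Notation A := (grassmann K I).
Notation E := (evens K I).
Implicit Types (s : state n K I) (P Q R S X Y Z W : 'I_n) (u : A).

Lemma pos_even_square u : pos_even u ->
  exists2 x : E, u = even_val (x * x) & 0 < body (even_val x).
Proof.
move=> hu; have [r [rr r0] /andP[hr _]] := pos_even_sqrt_ex hu.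
by have [x ex] := evens_ex hr; exists x; rewrite ?even_valM -ex ?rr.
Qed.

Variables (p q : 'I_n -> E) (xi : 'I_n -> A).
Hypothesis xi_odd : forall i, homog true (xi i).
Notation pr := (pairing (@even_val K I) p q xi).
Notation vol := (osp_vol (@even_val K I) p q xi).

(* The lambda-lengths are the pairings of the spinors, up to a sign, and the
   mu-invariants are their volumes, normalized by the sides, up to the gauge
   sign g; the orientations record how g changes across the arcs. *)
Record compat s (g : {set 'I_n} -> bool) : Prop := Compat {
  compat_lam : forall X Y, [set X; Y] \in arcs s ->
    lam s [set X; Y] = (-1) ^+ (Y < X)%N * pr X Y;
  compat_mu : forall X Y Z r, ccw X Y Z -> [set X; Y] \in arcs s ->
    [set Y; Z] \in arcs s -> [set X; Z] \in arcs s ->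
    is_sqrt (lam s [set X; Y] * lam s [set Y; Z] * lam s [set X; Z]) r ->
    mu s [set X; Y; Z] * r = (-1) ^+ g [set X; Y; Z] * vol X Y Z;
  compat_tail : forall X Y Z W, cyc4 X Y Z W -> quad (arcs s) X Y Z W ->
    [set X; Z] \in arcs s -> let t := tail s [set X; Z] in
    g [set X; Y; Z] (+) (Y < t)%N = g [set X; Z; W] (+) (W < t)%N
}.

Lemma set3_rot X Y Z : [set X; Y; Z] = [set Y; Z; X].
Proof. by apply/setP => x; rewrite !inE; case: (x == X); case: (x == Y); case: (x == Z). Qed.

Lemma set3_ccw X Y Z P Q R : [set X; Y; Z] = [set P; Q; R] -> ccw X Y Z -> ccw P Q R ->
  [\/ [/\ X = P, Y = Q & Z = R], [/\ X = Q, Y = R & Z = P] | [/\ X = R, Y = P & Z = Q]].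
Proof.
move=> e c1 c2; have [n1 n2 n3] := ccw_neq c1.
have hX : X \in [set P; Q; R] by rewrite -e !inE eqxx.
have hY : Y \in [set P; Q; R] by rewrite -e !inE eqxx orbT.
have hZ : Z \in [set P; Q; R] by rewrite -e !inE eqxx orbT.
have bad := ccw_asym c2; have r1 := ccw_rot P Q R; have r2 := ccw_rot Q R P.
move: hX hY hZ c1 n1 n2 n3; rewrite !inE.
do 3![case/orP => [/orP[]|] /eqP ->]; rewrite ?eqxx // => c1 _ _ _;
  try (by constructor); move: c1 c2; rewrite /ccw; clear; lia.
Qed.

Lemma ltn_cyc (a b c : nat) : a != b -> b != c -> a != c ->
  [|| (a < b < c), (b < c < a) | (c < a < b)]%N -> (c < b)%N = (b < a)%N (+) (c < a)%N.
Proof.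
case: (ltnP c b); case: (ltnP b a); case: (ltnP c a) => //= *; exfalso; lia.
Qed.

(** This additive law underlies the sign computations: in a quadrilateral, comparisons between
    vertices reduce to comparisons with P. *)
Lemma ccw_ltn P X Y : ccw P X Y -> (Y < X)%N = (X < P)%N (+) (Y < P)%N.
Proof. by move=> c; have [? ? ?] := ccw_neq c; apply: ltn_cyc. Qed.

Lemma ltn_neqN X Y : X != Y -> (X < Y)%N = ~~ (Y < X)%N.
Proof. by rewrite -leqNgt ltn_neqAle => ->. Qed.

Lemma sign_pairing X Y : X != Y ->
  (-1) ^+ (Y < X)%N * pr X Y = (-1) ^+ (X < Y)%N * pr Y X.
Proof.
move=> nXY; rewrite (ltn_neqN nXY) signrN mulNr (pairingC (@homog_evens K I) _ _ xi_odd Y X).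
by rewrite mulrN opprK.
Qed.

Lemma compat_pairing s g X Y : compat s g -> [set X; Y] \in arcs s ->
  pr X Y = (-1) ^+ (Y < X)%N * lam s [set X; Y].
Proof. by move=> cs h; rewrite (compat_lam cs h) signrMK. Qed.

(** Each lambda-length is written as a square in [evens]; uniqueness of square roots turns the
    radicals rac, rbd and rabcd into products of these roots, and the relations between pairings and
    volumes apply up to the signs settled above. *)
Lemma flip_spinors (lPR lPS lSR lRQ lQP th sg f th' sg' rac rbd rabcd rz : A) P Q R S (g1 g2 : bool) :
  cyc4 P Q R S -> g1 (+) g2 = (Q < P)%N (+) (S < P)%N ->
  pos_even lPR -> pos_even lPS -> pos_even lSR -> pos_even lRQ -> pos_even lQP -> pos_even f ->
  homog true th -> homog true sg ->
  pr P Q = (-1) ^+ (Q < P)%N * lQP -> pr Q R = (-1) ^+ (R < Q)%N * lRQ ->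
  pr R S = (-1) ^+ (S < R)%N * lSR -> pr P S = (-1) ^+ (S < P)%N * lPS ->
  pr P R = (-1) ^+ (R < P)%N * lPR ->
  (forall r, is_sqrt (lQP * lRQ * lPR) r -> sg * r = (-1) ^+ g1 * vol P Q R) ->
  (forall r, is_sqrt (lPR * lSR * lPS) r -> th * r = (-1) ^+ g2 * vol P R S) ->
  is_sqrt (lPS * lRQ) rac -> is_sqrt (lSR * lQP) rbd ->
  is_sqrt (lPS * lSR * lRQ * lQP) rabcd -> is_sqrt (lPS * lRQ + lSR * lQP) rz ->
  lPR * f = lPS * lRQ + lSR * lQP + rabcd * sg * th ->
  th' * rz = th * rbd + sg * rac -> sg' * rz = sg * rbd - th * rac ->
  [/\ f = (-1) ^+ (S < Q)%N * pr Q S,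
     forall r, is_sqrt (lQP * f * lPS) r ->
       th' * r = (-1) ^+ ((R < P)%N (+) (Q < P)%N (+) g2) * vol P Q S
   & forall r, is_sqrt (lRQ * lSR * f) r ->
       sg' * r = (-1) ^+ (~~ ((S < P)%N (+) g1)) * vol Q R S].
Proof.
move=> c hg pPR pPS pSR pRQ pQP pf oth osg sPQ sQR sRS sPS sPR hsg hth q1 q2 q3 q4 e1 e2 e3.
have iev := @homog_evens K I.
have hz := pos_evenD (pos_evenM pPS pRQ) (pos_evenM pSR pQP).
have /andP[h1 h2] := pos_even_sqrt hz q4.
have [z ez] := evens_ex h1; move: {h1} h2; rewrite ez => z0.
have [ra Ea ra0] := pos_even_square pPS; have [rb Eb rb0] := pos_even_square pSR.
have [rc Ec rc0] := pos_even_square pRQ; have [rd Ed rd0] := pos_even_square pQP.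
have [re Ee re0] := pos_even_square pPR; have [rF EF rF0] := pos_even_square pf.
have [f0 Ef0] := evens_ex (pairing_even iev p q xi_odd Q S).
have [d1 d2 d3 d4] := cyc4_ccw c.
have [nPQ nPR nPS nQR /andP[nQS nRS]] := cyc4_neq c.
rewrite (ccw_ltn d1) in sQR; rewrite (ccw_ltn d3) in sRS; rewrite (ccw_ltn d2).
have hF : even_val ((-1) ^+ ((Q < P)%N (+) (S < P)%N) * f0)
    = (-1) ^+ ((Q < P)%N (+) (S < P)%N) * pr Q S.
  by rewrite Ef0 even_valM rmorph_sign.
subst lPS lSR lRQ lQP lPR rz.
have Hrac := sqrt_prod ra0 rc0 q1; have Hrbd := sqrt_prod rb0 rd0 q2.
have Hr4 : rabcd = even_val (ra * rb * rc * rd).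
  exact: is_sqrt_uniq q3 (sqrt_prod4 ra0 rb0 rc0 rd0).
have N1 := hsg _ (sqrt_prod3 rd0 rc0 re0).
have N2 := hth _ (sqrt_prod3 re0 rb0 ra0).
subst rac rbd rabcd.
have PL : even_val (re * re) * (even_val (re * re) *
    even_val ((-1) ^+ ((Q < P)%N (+) (S < P)%N) * f0) - even_val (ra * ra * (rc * rc))
    - even_val (rb * rb * (rd * rd))) = ((-1) ^+ g1 * vol P Q R) * ((-1) ^+ g2 * vol P R S).
  rewrite hF Ef0; apply: (flip_sign_lambda iev hg sPQ sQR sRS sPS sPR).
  - exact: osp_vol_odd.
  - exact: osp_vol_odd.
  - by have := super_plucker iev p q xi_odd P Q R S; rewrite Ef0.
have gt_ne (x : E) : 0 < body (even_val x) -> body (even_val x) != 0.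
  by move=> h; rewrite gt_eqF.
have f_eq : f = even_val ((-1) ^+ ((Q < P)%N (+) (S < P)%N) * f0).
  apply: (flip_alg_lambda iev (gt_ne _ re0) osg oth N1 N2 PL).
  by rewrite e1 !even_valM.
have hFF : (-1) ^+ ((Q < P)%N (+) (S < P)%N) * f0 = rF * rF.
  by apply: even_val_inj; rewrite -f_eq.
have Hz : even_val (z * z) = even_val (ra * ra * (rc * rc) + rb * rb * (rd * rd)).
  by rewrite even_valM; case: q4 => -> _.
have npos : body (even_val (re * rF)) + body (even_val z) != 0.
  by rewrite gt_eqF // addr_gt0 // even_valM bodyM mulr_gt0.
split.
- by rewrite f_eq hF.
- move=> r; rewrite EF => hr.
  rewrite -(is_sqrt_uniq (sqrt_prod3 rd0 rF0 ra0) hr).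
  apply: (flip_alg_theta iev (gt_ne _ re0) osg oth N1 N2 PL hFF Hz npos (gt_ne _ z0) _ e2).
  apply: (flip_sign_theta iev hg sPQ sPS sPR); try exact: osp_vol_odd.
  exact: osp_vol_plucker.
- move=> r; rewrite EF => hr.
  rewrite -(is_sqrt_uniq (sqrt_prod3 rc0 rb0 rF0) hr).
  apply: (flip_alg_sigma iev (gt_ne _ re0) osg oth N1 N2 PL hFF Hz npos (gt_ne _ z0) _ e3).
  apply: (flip_sign_sigma iev hg sQR sRS sPR); try exact: osp_vol_odd.
  exact: osp_vol_plucker_last.
Qed.

End Compatible.

(** * Realization by spinors after a flip *)

Section FlipCompatible.
Variables (n : nat) (K : rcfType) (I : finType).
Notation A := (grassmann K I).
Notation E := (evens K I).
Implicit Types (s : state n K I) (P Q R S X Y Z W : 'I_n) (u : A) (T : {set {set 'I_n}}).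
Variables (p q : 'I_n -> E) (xi : 'I_n -> A).
Hypothesis xi_odd : forall i, homog true (xi i).
Notation pr := (pairing (@even_val K I) p q xi).
Notation vol := (osp_vol (@even_val K I) p q xi).
Notation compat := (compat p q xi).

Lemma flip_arcs_old T P Q R S X Y : [set X; Y] != [set Q; S] ->
  [set X; Y] \in flip_arcs T P Q R S -> [set X; Y] \in T.
Proof. by move=> /negbTE nXY; rewrite !inE nXY /= => /andP[]. Qed.

Lemma new_diag_in T P Q R S : [set Q; S] \in flip_arcs T P Q R S.
Proof. by rewrite !inE eqxx. Qed.

Lemma new_triangle T P Q R S X Y Z : cyc4 P Q R S -> quad T P Q R S ->
  noncrossing (flip_arcs T P Q R S) -> [set X; Y] = [set Q; S] ->
  [set Y; Z] \in flip_arcs T P Q R S -> [set X; Z] \in flip_arcs T P Q R S ->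
  ccw X Y Z -> [/\ X = Q, Y = S & Z = P] \/ [/\ X = S, Y = Q & Z = R].
Proof.
move=> c qT nT e YZ XZ cXYZ; have [d1 d2 d3 d4] := cyc4_ccw c.
have [b1 b2 b3 b4] := quad_flip c qT.
case: (eq_set2 e) => -[? ?]; subst; [left|right]; split=> //.
  by apply: (apex_uniq nT (x := Q) (z := S)); rewrite // ?(set2C Q) // ccw_rot ccw_rot.
apply: (apex_uniq nT (x := S) (z := Q)); rewrite // ?(set2C S) //.
by rewrite ccw_rot.
Qed.

(** By [new_triangle], the only triangles with a side QS are the two that the flip creates. *)
Lemma old_triangle T P Q R S X Y Z : cyc4 P Q R S -> quad T P Q R S ->
  noncrossing (flip_arcs T P Q R S) -> ccw X Y Z ->
  [set X; Y] \in flip_arcs T P Q R S -> [set Y; Z] \in flip_arcs T P Q R S ->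
  [set X; Z] \in flip_arcs T P Q R S ->
  [set X; Y; Z] != [set Q; S; P] -> [set X; Y; Z] != [set Q; R; S] ->
  [/\ [set X; Y] != [set Q; S], [set Y; Z] != [set Q; S] & [set X; Z] != [set Q; S]].
Proof.
move=> c qT nT cX XY YZ XZ n1 n2.
have key x y z : ccw x y z -> [set y; z] \in flip_arcs T P Q R S ->
    [set x; z] \in flip_arcs T P Q R S -> [set x; y; z] = [set X; Y; Z] ->
    [set x; y] != [set Q; S].
  move=> cx yz xz e; apply/eqP => exy.
  have [] := new_triangle c qT nT exy yz xz cx => -[? ? ?]; subst x y z.
    by rewrite e eqxx in n1.
  by move: n2; rewrite -e (set3_rot S Q R) eqxx.
split; first exact: key XZ _.
- apply: (key Y Z X); first by rewrite -ccw_rot.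
  + by rewrite set2C.
  + by rewrite set2C.
  + by rewrite -set3_rot.
- rewrite set2C; apply: (key Z X Y) => //; first by rewrite ccw_rot.
  + by rewrite set2C.
  + by rewrite set3_rot.
Qed.

(** The values on the two new triangles are dictated by the signs that come out of
    [flip_spinors]. *)
Definition flip_sign g P Q R S (D : {set 'I_n}) : bool :=
  if D == [set Q; S; P] then (R < P)%N (+) (Q < P)%N (+) g [set P; R; S]
  else if D == [set Q; R; S] then ~~ ((S < P)%N (+) g [set P; Q; R]) else g D.

(** The condition [compat_mu] for one ordering of the vertices, isolated so that it can be proved
    from one starting vertex and transported by rotation. *)
Definition mu_spec (lm m : {set 'I_n} -> A) (g : {set 'I_n} -> bool) X Y Z :=
  forall r, is_sqrt (lm [set X; Y] * lm [set Y; Z] * lm [set X; Z]) r ->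
    m [set X; Y; Z] * r = (-1) ^+ g [set X; Y; Z] * vol X Y Z.

Lemma mu_spec_rot lm m g X Y Z : pos_even (lm [set X; Y]) -> pos_even (lm [set Y; Z]) ->
  pos_even (lm [set X; Z]) -> mu_spec lm m g X Y Z -> mu_spec lm m g Y Z X.
Proof.
move=> /andP[h1 _] /andP[h2 _] /andP[h3 _] h r hr.
rewrite -(set3_rot X Y Z) -(osp_vol_cycle (@homog_evens K I) _ _ xi_odd X Y Z); apply: h.
rewrite -mulrA homog_central //.
by rewrite [[set X; Z]]set2C [[set X; Y]]set2C.
Qed.

Definition tail_spec (t : {set 'I_n} -> 'I_n) (g : {set 'I_n} -> bool) X Y Z W :=
  g [set X; Y; Z] (+) (Y < t [set X; Z])%N = g [set X; Z; W] (+) (W < t [set X; Z])%N.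

Lemma tail_spec_sym t g X Y Z W : tail_spec t g Z W X Y -> tail_spec t g X Y Z W.
Proof.
have e : t [set Z; X] = t [set X; Z] by rewrite set2C.
by rewrite /tail_spec e (set3_rot Z W X) (set3_rot W X Z) (set3_rot Z X Y) => ->.
Qed.

Lemma flip_sign_old g P Q R S (D : {set 'I_n}) : D != [set Q; S; P] -> D != [set Q; R; S] ->
  flip_sign g P Q R S D = g D.
Proof. by rewrite /flip_sign => /negbTE-> /negbTE->. Qed.

Lemma flip_sign_QSP g P Q R S : flip_sign g P Q R S [set Q; S; P] =
  (R < P)%N (+) (Q < P)%N (+) g [set P; R; S].
Proof. by rewrite /flip_sign eqxx. Qed.

Lemma flip_sign_QRS g P Q R S : cyc4 P Q R S ->
  flip_sign g P Q R S [set Q; R; S] = ~~ ((S < P)%N (+) g [set P; Q; R]).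
Proof.
move=> c; have [d1 d2 d3 d4] := cyc4_ccw c.
have [nPQ nPR nPS nQR /andP[nQS nRS]] := cyc4_neq c.
rewrite /flip_sign eqxx; case: eqP => // e.
have cQSP : ccw Q S P by rewrite -ccw_rot.
have [] := set3_ccw e d4 cQSP => -[? ? ?]; subst; by rewrite ?eqxx in nRS nQR nPQ nPR nPS nQS.
Qed.

(* A quadrilateral of the new triangulation whose diagonal is a side XZ of
   PQRS, with V and V' the old and the new apex on XZ inside PQRS. *)
Lemma flip_tail_side T (t t' : {set 'I_n} -> 'I_n) g P Q R S X Y Z W V V' :
  cyc4 P Q R S -> quad T P Q R S -> noncrossing (flip_arcs T P Q R S) ->
  (forall X Y Z W, cyc4 X Y Z W -> quad T X Y Z W -> [set X; Z] \in T -> tail_spec t g X Y Z W) ->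
  cyc4 X Y Z W -> quad (flip_arcs T P Q R S) X Y Z W -> [set X; Z] \in flip_arcs T P Q R S ->
  [set X; Z] != [set Q; S] ->
  ccw X Z V -> [set X; V] \in T -> [set Z; V] \in T ->
  ccw X Z V' -> [set X; V'] \in flip_arcs T P Q R S -> [set Z; V'] \in flip_arcs T P Q R S ->
  [set X; Y; Z] != [set Q; S; P] -> [set X; Y; Z] != [set Q; R; S] ->
  g [set X; Z; V] (+) (V < t [set X; Z])%N (+) (Y < t [set X; Z])%N =
  flip_sign g P Q R S [set X; Z; V'] (+) (V' < t' [set X; Z])%N (+) (Y < t' [set X; Z])%N ->
  tail_spec t' (flip_sign g P Q R S) X Y Z W.
Proof.
move=> c qT nT hg cX qX XZ nXZ cV XV ZV cV' XV' ZV' n1 n2 e.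
have [b1 b2 b3 b4] := qX; have [d1 d2 d3 d4] := cyc4_ccw cX.
have eW : W = V' by apply: (apex_uniq nT _ _ XV' ZV'); rewrite // set2C.
have [o1 o2 o3] := old_triangle c qT nT d1 b1 b2 XZ n1 n2.
have := hg X Y Z V _ _ (flip_arcs_old nXZ XZ).
rewrite /tail_spec => h; rewrite (flip_sign_old _ n1 n2) eW.
have {h} -> : g [set X; Y; Z] = g [set X; Z; V] (+) (V < t [set X; Z])%N (+) (Y < t [set X; Z])%N.
  rewrite -h ?addbK //.
    by rewrite /cyc4 cV /=; case/andP: cX.
  by split; [exact: flip_arcs_old b1 | exact: flip_arcs_old b2 | | rewrite set2C].
by rewrite e addbK.
Qed.

Lemma set3_ccwN X Y Z P Q R : ccw X Y Z -> ccw P Q R ->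
  [&& (X != P) || (Z != R), (X != Q) || (Z != P) & (X != R) || (Z != Q)] ->
  [set X; Y; Z] != [set P; Q; R].
Proof.
move=> c1 c2 h; apply/eqP => e.
by have [] := set3_ccw e c1 c2 => -[? ? ?]; subst; rewrite !eqxx /= ?andbF in h.
Qed.

Lemma flip_compat s s' g : good s -> compat s g -> flip s s' -> exists g', compat s' g'.
Proof.
move=> gs cs fs; have gs' := flip_good gs fs; move: fs.
move=> [P [Q [R [S [f [th' [sg' [rac [rbd [rabcd [rz]]]]]]]]]]] /=.
move=> [/and5P[aPR aPS aSR aRQ aQP] /and3P[/eqP tP c1 c2] [q1 q2 q3 q4] [e1 e2 e3] es'].
have c : cyc4 P Q R S by rewrite /cyc4 c1 c2.
have qT : quad (arcs s) P Q R S by split; rewrite set2C.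
have [/triangulationP[arT nT _] tt tl tm] := gs; have [cl cm ct] := cs.
have [d1 d2 d3 d4] := cyc4_ccw c.
have [nPQ nPR nPS nQR /andP[nQS nRS]] := cyc4_neq c.
have [aPQ aQR aRS aSP] := qT.
have arcs' : arcs s' = flip_arcs (arcs s) P Q R S by rewrite es'.
have lam'E e : lam s' e = if e == [set Q; S] then f else lam s e by rewrite es'.
have tail'E e : tail s' e = if e == [set Q; S] then Q else if e == [set S; R]
  then arc_head (tail s) [set S; R] else tail s e by rewrite es'.
have mu'E D : mu s' D = if D == [set Q; S; P] then th' else if D == [set Q; R; S]
  then sg' else mu s D by rewrite es'.
have hf : pos_even f.
  by have := good_lam gs' (e := [set Q; S]); rewrite lam'E eqxx; apply; rewrite arcs' new_diag_in.
(* As PR has tail P, [compat_tail] is exactly the relation between gauges that the sign lemmas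
   expect. *)
have hg : g [set P; Q; R] (+) g [set P; R; S] = (Q < P)%N (+) (S < P)%N.
  have := ct P Q R S c qT aPR; rewrite tP /=.
  by case: (g [set P; Q; R]); case: (g [set P; R; S]); case: (Q < P)%N; case: (S < P)%N.
have prE X Y : [set X; Y] \in arcs s -> pr X Y = (-1) ^+ (Y < X)%N * lam s [set X; Y].
  exact: compat_pairing cs.
have sPQ : pr P Q = (-1) ^+ (Q < P)%N * lam s [set Q; P] by rewrite (set2C Q P) prE.
have sQR : pr Q R = (-1) ^+ (R < Q)%N * lam s [set R; Q] by rewrite (set2C R Q) prE.
have sRS : pr R S = (-1) ^+ (S < R)%N * lam s [set S; R] by rewrite (set2C S R) prE.
have msg r : is_sqrt (lam s [set Q; P] * lam s [set R; Q] * lam s [set P; R]) r ->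
    mu s [set P; Q; R] * r = (-1) ^+ g [set P; Q; R] * vol P Q R.
  by rewrite (set2C Q P) (set2C R Q); apply: cm.
have mth r : is_sqrt (lam s [set P; R] * lam s [set S; R] * lam s [set P; S]) r ->
    mu s [set P; R; S] * r = (-1) ^+ g [set P; R; S] * vol P R S.
  by rewrite (set2C S R); apply: cm.
have [lamQS muQSP muQRS] := flip_spinors xi_odd c hg (tl _ aPR) (tl _ aPS) (tl _ aSR)
  (tl _ aRQ) (tl _ aQP) hf (tm _) (tm _) sPQ sQR sRS (prE _ _ aPS) (prE _ _ aPR) msg mth
  q1 q2 q3 q4 e1 e2 e3.
move=> {q1 q2 q3 q4 e1 e2 e3 msg mth sPQ sQR sRS}.
exists (flip_sign g P Q R S).
have nT' : noncrossing (flip_arcs (arcs s) P Q R S) by apply: flip_noncrossing.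
have [b1 b2 b3 b4] := quad_flip c qT.
have dQS := new_diag_in (arcs s) P Q R S.
have tl' e : e \in arcs s' -> pos_even (lam s' e) by case: gs' => _ _ h _; apply: h.
split; rewrite ?arcs'.
- move=> X Y; rewrite lam'E; have [e|ne] := eqVneq [set X; Y] [set Q; S].
    move=> _; rewrite lamQS; case: (eq_set2 e) => -[-> ->] //.
    by rewrite sign_pairing.
  by move=> h; apply: cl; apply: flip_arcs_old h.
- move=> X Y Z r cX XY YZ XZ.
  suff: mu_spec (lam s') (mu s') (flip_sign g P Q R S) X Y Z by apply.
  have rot x y z : ccw x y z -> [set x; y] \in flip_arcs (arcs s) P Q R S ->
      [set y; z] \in flip_arcs (arcs s) P Q R S -> [set x; z] \in flip_arcs (arcs s) P Q R S ->
      mu_spec (lam s') (mu s') (flip_sign g P Q R S) x y z ->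
      mu_spec (lam s') (mu s') (flip_sign g P Q R S) y z x.
    by move=> _ h1 h2 h3; apply: mu_spec_rot; apply: tl'; rewrite arcs'.
  have nQSP : [set Q; R; S] != [set Q; S; P].
    apply/eqP => e; have cQSP : ccw Q S P by rewrite -ccw_rot.
    have [] := set3_ccw e d4 cQSP => -[? ? ?]; subst;
    by rewrite ?eqxx in nRS nQR nPQ nPR nPS nQS.
  have nPQS : [set P; Q] != [set Q; S].
    by apply/eqP => /eq_set2 [[e _]|[e _]]; subst; rewrite ?eqxx in nPQ nPS.
  have nPSS : [set S; P] != [set Q; S].
    by apply/eqP => /eq_set2 [[e _]|[_ e]]; subst; rewrite ?eqxx in nQS nPQ.
  have nQRS : [set Q; R] != [set Q; S].
    by apply/eqP => /eq_set2 [[_ e]|[_ e]]; subst; rewrite ?eqxx in nRS nQR.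
  have nRSS : [set R; S] != [set Q; S].
    by apply/eqP => /eq_set2 [[e _]|[e _]]; subst; rewrite ?eqxx in nQR nRS.
  have spQSP : mu_spec (lam s') (mu s') (flip_sign g P Q R S) Q S P.
    move=> t; rewrite !lam'E mu'E !eqxx (set2C Q P) (negbTE nPQS) (negbTE nPSS).
    rewrite flip_sign_QSP -(osp_vol_cycle (@homog_evens K I) _ _ xi_odd P Q S) => ht.
    apply: muQSP; rewrite -mulrA homog_central; last by case/andP: (tl _ aQP).
    by rewrite (set2C P S) (set2C Q P).
  have spQRS : mu_spec (lam s') (mu s') (flip_sign g P Q R S) Q R S.
    move=> t; rewrite !lam'E mu'E eqxx (negbTE nQSP) (negbTE nQRS) (negbTE nRSS) eqxx.
    rewrite flip_sign_QRS // => ht; apply: muQRS.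
    by rewrite (set2C R Q) (set2C S R).
  have cQSP : ccw Q S P by rewrite -ccw_rot.
  have QPn : [set Q; P] \in flip_arcs (arcs s) P Q R S by rewrite set2C.
  have SQn : [set S; Q] \in flip_arcs (arcs s) P Q R S by rewrite set2C.
  have PSn : [set P; S] \in flip_arcs (arcs s) P Q R S by rewrite set2C.
  have RQn : [set R; Q] \in flip_arcs (arcs s) P Q R S by rewrite set2C.
  have SRn : [set S; R] \in flip_arcs (arcs s) P Q R S by rewrite set2C.
  have spSPQ := rot _ _ _ cQSP dQS b4 QPn spQSP.
  have spRSQ := rot _ _ _ d4 b2 b3 dQS spQRS.
  have cSPQ : ccw S P Q by rewrite -ccw_rot.
  have cRSQ : ccw R S Q by rewrite -ccw_rot.
  have [e|n1] := eqVneq [set X; Y; Z] [set Q; S; P].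
    have [] := set3_ccw e cX cQSP => -[? ? ?]; subst X Y Z => //.
    exact: (rot _ _ _ cSPQ b4 b1 SQn).
  have [e|n2] := eqVneq [set X; Y; Z] [set Q; R; S].
    have [] := set3_ccw e cX d4 => -[? ? ?]; subst X Y Z => //.
    exact: (rot _ _ _ cRSQ b3 SQn RQn).
  have [o1 o2 o3] := old_triangle c qT nT' cX XY YZ XZ n1 n2.
  move=> t; rewrite !lam'E mu'E (negbTE n1) (negbTE n2) (negbTE o1) (negbTE o2) (negbTE o3).
  rewrite flip_sign_old //; apply: cm => //.
  + exact: flip_arcs_old o1 XY.
  + exact: flip_arcs_old o2 YZ.
  + exact: flip_arcs_old o3 XZ.
- rewrite -/(flip_arcs _ _ _ _ _) => X Y Z W cX qX XZ.
  rewrite -/(tail_spec (tail s') (flip_sign g P Q R S) X Y Z W).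
  have ct' X0 Y0 Z0 W0 : cyc4 X0 Y0 Z0 W0 -> quad (arcs s) X0 Y0 Z0 W0 ->
      [set X0; Z0] \in arcs s -> tail_spec (tail s) g X0 Y0 Z0 W0 by exact: ct.
  have side := flip_tail_side c qT nT' ct'.
  have RQ := ccw_ltn d1; have SQ := ccw_ltn d2; have SR := ccw_ltn d3.
  have QR := ltn_neqN nQR; have QS := ltn_neqN nQS; have RS := ltn_neqN nRS.
  have PQ := ltn_neqN nPQ; have PR := ltn_neqN nPR; have PS := ltn_neqN nPS.
  have hg2 : g [set P; R; S] = g [set P; Q; R] (+) (Q < P)%N (+) (S < P)%N.
    by rewrite -addbA -hg addKb.
  (* The diagonal XZ is a side of PQRS: its apex inside the quadrilateral changes from P or R to Q
     or S. *)
  have half X1 Y1 Z1 W1 : cyc4 X1 Y1 Z1 W1 -> quad (flip_arcs (arcs s) P Q R S) X1 Y1 Z1 W1 ->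
      [set X1; Z1] \in flip_arcs (arcs s) P Q R S ->
      [\/ X1 = P /\ Z1 = Q, X1 = Q /\ Z1 = R, X1 = R /\ Z1 = S | X1 = S /\ Z1 = P] ->
      tail_spec (tail s') (flip_sign g P Q R S) X1 Y1 Z1 W1.
    move=> c1' q1 x1 h; have [f1 _ _ _] := cyc4_ccw c1'.
    have cQSP : ccw Q S P by rewrite -ccw_rot.
    have cRSP : ccw R S P by rewrite -ccw_rot.
    have cSPR : ccw S P R by rewrite -ccw_rot.
    have cSPQ : ccw S P Q by rewrite -ccw_rot.
    have cRSQ : ccw R S Q by rewrite -ccw_rot.
    have cQRP : ccw Q R P by rewrite -ccw_rot.
    have aRP : [set R; P] \in arcs s by rewrite set2C.
    have QPn : [set Q; P] \in flip_arcs (arcs s) P Q R S by rewrite set2C.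
    have SQn : [set S; Q] \in flip_arcs (arcs s) P Q R S by rewrite set2C.
    have PSn : [set P; S] \in flip_arcs (arcs s) P Q R S by rewrite set2C.
    have RQn : [set R; Q] \in flip_arcs (arcs s) P Q R S by rewrite set2C.
    pose nE := (nPQ, nPR, nPS, nQR, nQS, nRS, eq_sym Q P, eq_sym R P, eq_sym S P,
      eq_sym R Q, eq_sym S Q, eq_sym S R, orbT).
    have arcN (x y z t : 'I_n) : (x != z) || (y != t) -> (x != t) || (y != z) ->
        ([set x; y] == [set z; t]) = false.
      move=> h1 h2; apply/eqP => /eq_set2[[? ?]|[? ?]]; subst.
        by rewrite !eqxx in h1.
      by rewrite !eqxx in h2.
    case: h => -[? ?]; subst X1 Z1.
    - apply: (side _ _ _ _ _ R S) => //; rewrite ?arcN ?nE //.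
      + by apply: set3_ccwN => //; rewrite !nE.
      + by apply: set3_ccwN => //; rewrite !nE.
      rewrite tail'E !arcN ?nE // (set3_rot P Q S) flip_sign_QSP hg2.
      case/set2P: (tt _ aPQ) => ->; rewrite ?RQ ?SQ; case: (g _);
      by case: (Q < P)%N; case: (R < P)%N; case: (S < P)%N; case: (Y1 < _)%N.
    - apply: (side _ _ _ _ _ P S) => //; rewrite ?arcN ?nE //.
      + by apply: set3_ccwN => //; rewrite !nE.
      + by apply: set3_ccwN => //; rewrite !nE.
      rewrite tail'E !arcN ?nE // flip_sign_QRS // -(set3_rot P Q R).
      case/set2P: (tt _ aQR) => ->; rewrite ?SR ?SQ ?PQ ?PR; case: (g _);
      by case: (Q < P)%N; case: (R < P)%N; case: (S < P)%N; case: (Y1 < _)%N.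
    - apply: (side _ _ _ _ _ P Q) => //; rewrite ?arcN ?nE //.
      + by apply: set3_ccwN => //; rewrite !nE.
      + by apply: set3_ccwN => //; rewrite !nE.
      (* RS is the side that the flip reverses, so the outer apex gets compared with both R and S;
         these comparisons are reduced to comparisons with P. *)
      have [f2 f3] : ccw P R Y1 /\ ccw P Y1 S.
        by move: f1 d3; rewrite /ccw; clear; lia.
      have YR := ccw_ltn f2; have SY := ccw_ltn f3.
      have YS : (Y1 < S)%N = ~~ (S < Y1)%N by apply: ltn_neqN; case/ccw_neq: f3.
      rewrite tail'E arcN ?nE // -(set3_rot P R S) -(set3_rot Q R S) flip_sign_QRS // hg2.
      rewrite (set2C R S) eqxx.
      have tails : tail s [set S; R] = S /\ arc_head (tail s) [set S; R] = R \/
          tail s [set S; R] = R /\ arc_head (tail s) [set S; R] = S.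
        case/set2P: (tt _ aSR) => e; rewrite e; [left|right]; split=> //.
          by apply: arc_headE; rewrite ?nE.
        by rewrite set2C; apply: arc_headE; rewrite ?nE // set2C.
      case: tails => -[-> ->]; rewrite ?QR ?QS ?PR ?PS YS ?SY ?YR ?RQ ?SQ; case: (g _);
      by case: (Q < P)%N; case: (R < P)%N; case: (S < P)%N; case: (Y1 < P)%N.
    - apply: (side _ _ _ _ _ R Q) => //; rewrite ?arcN ?nE //.
      + by apply: set3_ccwN => //; rewrite !nE.
      + by apply: set3_ccwN => //; rewrite !nE.
      rewrite tail'E !arcN ?nE // (set3_rot S P R) -(set3_rot Q S P) flip_sign_QSP hg2.
      case/set2P: (tt _ aSP) => ->; rewrite ?RS ?QS ?SR ?SQ; case: (g _);
      by case: (Q < P)%N; case: (R < P)%N; case: (S < P)%N; case: (Y1 < _)%N.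
  (* The new diagonal itself, with tail Q and apexes R and P. *)
  have diag Y1 W1 : cyc4 Q Y1 S W1 -> quad (flip_arcs (arcs s) P Q R S) Q Y1 S W1 ->
      tail_spec (tail s') (flip_sign g P Q R S) Q Y1 S W1.
    move=> c1' q1; have [f1 _ f3 _] := cyc4_ccw c1'; have [k1 k2 k3 k4] := q1.
    have QW : [set Q; W1] \in flip_arcs (arcs s) P Q R S by rewrite set2C.
    have SY : [set S; Y1] \in flip_arcs (arcs s) P Q R S by rewrite set2C.
    have f1' : ccw S Q Y1 by rewrite ccw_rot.
    case: (new_triangle c qT nT' (erefl _) k3 QW f3) => [[_ _ ->]|[e _ _]]; last first.
      by move: nQS; rewrite e eqxx.
    case: (new_triangle c qT nT' (set2C S Q) k1 SY f1') => [[e _ _]|[_ _ ->]].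
      by move: nQS; rewrite e eqxx.
    rewrite /tail_spec tail'E eqxx flip_sign_QRS // flip_sign_QSP hg2 RQ PQ.
    by case: (g _); case: (Q < P)%N; case: (R < P)%N; case: (S < P)%N.
  have [e|nXZ] := eqVneq [set X; Z] [set Q; S].
    case: (eq_set2 e) => -[? ?]; subst X Z; first exact: diag.
    apply: tail_spec_sym; apply: diag; first by rewrite -cyc4_rot -cyc4_rot.
    by case: qX.
  have [f1 _ f3 _] := cyc4_ccw cX; have [k1 k2 k3 k4] := qX.
  have cQSP : ccw Q S P by rewrite -ccw_rot.
  have XW : [set X; W] \in flip_arcs (arcs s) P Q R S by rewrite set2C.
  pose is_side (x z : 'I_n) := [|| (x == P) && (z == Q), (x == Q) && (z == R),
    (x == R) && (z == S) | (x == S) && (z == P)].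
  have is_sideP x z : is_side x z ->
      [\/ x = P /\ z = Q, x = Q /\ z = R, x = R /\ z = S | x = S /\ z = P].
    by case/or4P => /andP[/eqP-> /eqP->]; [constructor 1|constructor 2|constructor 3|constructor 4].
  have [/is_sideP h|ns1] := boolP (is_side X Z); first exact: half.
  have [/is_sideP h|ns2] := boolP (is_side Z X).
    apply: tail_spec_sym; apply: half => //; first by rewrite -cyc4_rot -cyc4_rot.
    by rewrite set2C.
  have isold x y z : ccw x y z -> [set x; z] = [set X; Z] \/ [set x; y] = [set X; Z] ->
      [set x; y; z] != [set Q; S; P] /\ [set x; y; z] != [set Q; R; S].
    move=> cxyz exz; split; apply/eqP => e.
      have [] := set3_ccw e cxyz cQSP => -[? ? ?]; subst x y z;
      case: exz => /eq_set2[] [? ?]; subst X Z;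
      by rewrite /is_side ?set21 ?eqxx ?orbT ?(set2C S Q) ?eqxx in ns1 ns2 nXZ.
    have [] := set3_ccw e cxyz d4 => -[? ? ?]; subst x y z;
    case: exz => /eq_set2[] [? ?]; subst X Z;
    by rewrite /is_side ?set21 ?eqxx ?orbT ?(set2C S Q) ?eqxx in ns1 ns2 nXZ.
  have [n1 n2] := isold _ _ _ f1 (or_introl (erefl _)).
  have [n3 n4] := isold _ _ _ f3 (or_intror (erefl _)).
  have [o1 o2 o3] := old_triangle c qT nT' f1 k1 k2 XZ n1 n2.
  have [o4 o5 o6] := old_triangle c qT nT' f3 XZ k3 XW n3 n4.
  have tXZ : tail s' [set X; Z] = tail s [set X; Z].
    rewrite tail'E (negbTE nXZ); case: eqP => // /eq_set2[] [? ?]; subst X Z.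
      by rewrite /is_side !eqxx !orbT in ns2.
    by rewrite /is_side !eqxx !orbT in ns1.
  (* Away from the quadrilateral neither the gauge nor the tail has changed. *)
  suff: tail_spec (tail s) g X Y Z W by rewrite /tail_spec !flip_sign_old // tXZ.
  apply: ct' => //; last exact: flip_arcs_old nXZ XZ.
  split; [exact: flip_arcs_old o1 k1|exact: flip_arcs_old o2 k2|exact: flip_arcs_old o5 k3|].
  by rewrite set2C; apply: flip_arcs_old o6 XW.
Qed.

End FlipCompatible.

(** * Change of gauge at a triangle *)

Section Gauge.
Variables (n : nat) (K : rcfType) (I : finType).
Notation A := (grassmann K I).
Notation E := (evens K I).
Implicit Types (s : state n K I) (P Q R S X Y Z W : 'I_n) (u : A) (T : {set {set 'I_n}}).
Variables (p q : 'I_n -> E) (xi : 'I_n -> A).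
Hypothesis xi_odd : forall i, homog true (xi i).
Notation pr := (pairing (@even_val K I) p q xi).
Notation vol := (osp_vol (@even_val K I) p q xi).
Notation compat := (compat p q xi).

Lemma third_of_set3 T P R S X Z : X != Z -> [set X; Z] \subset [set P; R; S] ->
  [set P; R] \in T -> [set R; S] \in T -> [set P; S] \in T -> P != R -> R != S -> P != S ->
  exists V, [/\ [set X; Z; V] = [set P; R; S], X != V, Z != V, [set X; V] \in T &
    [set Z; V] \in T].
Proof.
move=> nXZ sub PR RS PS nPR nRS nPS.
have RP : [set R; P] \in T by rewrite set2C.
have SR : [set S; R] \in T by rewrite set2C.
have SP : [set S; P] \in T by rewrite set2C.
have nRP : R != P by rewrite eq_sym.
have nSR : S != R by rewrite eq_sym.
have nSP : S != P by rewrite eq_sym.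
have perm x y z : [set x; y; z] = [set P; R; S] \/ [set y; x; z] = [set P; R; S] ->
    [set x; y; z] = [set P; R; S].
  by case=> // <-; rewrite (set2C x y).
have /subsetP sub' := sub; have := sub' X (set21 _ _); have := sub' Z (set22 _ _).
rewrite !inE => /orP[/orP[]|] /eqP eZ /orP[/orP[]|] /eqP eX; subst X Z;
  rewrite ?eqxx // in nXZ *.
- by exists S; split=> //; rewrite (set2C R P).
- by exists R; split=> //; rewrite (set3_rot S P R).
- by exists S.
- by exists P; split=> //; rewrite (set2C S R) -(set3_rot P R S).
- by exists R; split=> //; rewrite (set2C P S) (set3_rot S P R).
- by exists P; split=> //; rewrite -(set3_rot P R S).
Qed.

(** The usual equivalence of spin structures: negate one mu-invariant and reverse the three sides of
    its triangle. Reversing XZ changes the parity of the two comparisons of its apexes with the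
    tail, and exactly one of the two triangles on XZ has its gauge toggled. *)
Lemma gauge_compat s1 s2 g P R S : good s2 -> ccw P R S -> 
  [set P; R] \in arcs s2 -> [set R; S] \in arcs s2 -> [set P; S] \in arcs s2 ->
  arcs s1 = arcs s2 ->
  (forall X Y, [set X; Y] \in arcs s2 -> lam s1 [set X; Y] = lam s2 [set X; Y]) ->
  (forall X Y Z, [set X; Y] \in arcs s2 -> [set Y; Z] \in arcs s2 ->
     [set X; Z] \in arcs s2 ->
     mu s1 [set X; Y; Z] = (-1) ^+ ([set X; Y; Z] == [set P; R; S]) * mu s2 [set X; Y; Z]) ->
  (forall X Y, [set X; Y] \in arcs s2 -> tail s1 [set X; Y] =
     if [set X; Y] \subset [set P; R; S] then arc_head (tail s2) [set X; Y]
     else tail s2 [set X; Y]) ->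
  compat s1 g -> compat s2 (fun D => (D == [set P; R; S]) (+) g D).
Proof.
move=> gs2 cPRS aPR aRS aPS ea el em et [cl cm ct].
have [/triangulationP[arT nT _] tt _ _] := gs2.
have [nPR nRS nPS] := ccw_neq cPRS.
split.
- by move=> X Y h; rewrite -el // cl // ea.
- move=> X Y Z r cX XY YZ XZ hr; have := cm X Y Z r cX.
  rewrite ea !el // => /(_ XY YZ XZ hr); rewrite em //.
  by rewrite signr_addb -!mulrA => <-; rewrite signrMK.
move=> X Y Z W cX qX XZ; have [XY YZ ZW WX] := qX; rewrite /=.
have := ct X Y Z W cX; rewrite ea => /(_ qX XZ) /=.
have [d1 d2 d3 d4] := cyc4_ccw cX.
have [nXY nXZ nXW nYZ /andP[nYW nZW]] := cyc4_neq cX.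
rewrite et //; have [sub|nsub] := boolP ([set X; Z] \subset [set P; R; S]); last first.
  have nsub1 : ([set X; Y; Z] == [set P; R; S]) = false.
    apply: contraNF nsub => /eqP <-; apply/subsetP => x; rewrite !inE.
    by case/orP => ->; rewrite ?orbT.
  have nsub2 : ([set X; Z; W] == [set P; R; S]) = false.
    by apply: contraNF nsub => /eqP <-; apply/subsetP => x; rewrite !inE => ->.
  by rewrite nsub1 nsub2.
have e1 : ([set X; Y; Z] == [set P; R; S]) = ~~ ([set X; Z; W] == [set P; R; S]).
  have [V [eV nXV nZV XV ZV]] := third_of_set3 nXZ sub aPR aRS aPS nPR nRS nPS.
  have [h|h] : ccw X Z V \/ ccw Z X V by apply/orP/ccw_total.
    have -> : W = V by apply: (apex_uniq nT _ _ XV ZV) => //; rewrite set2C.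
    rewrite eV eqxx /=; apply/eqP => e; have : Y \in [set X; Z; V] by rewrite eV -e !inE eqxx orbT.
    rewrite !inE eq_sym (negbTE nXY) (negbTE nYZ) /= => /eqP eYV.
    by move: d1 h; rewrite eYV /ccw; clear; lia.
  have eY : Y = V.
    by apply: (apex_uniq nT _ XY ZV XV) => //; rewrite ?(set2C Z) // ccw_rot.
  have -> : [set X; Y; Z] = [set P; R; S].
    by rewrite -eV eY; apply/setP => x; rewrite !inE; case: (x == X); case: (x == V); case: (x == Z).
  rewrite eqxx; symmetry; apply/eqP => e; have : W \in [set X; Z; V] by rewrite eV -e !inE eqxx !orbT.
  rewrite !inE eq_sym (negbTE nXW) eq_sym (negbTE nZW) /= => /eqP eWV.
  by move: nYW; rewrite eWV eY eqxx.
have h1 := ccw_ltn d1; have h2 := ccw_ltn d3; have h3 := ltn_neqN nYZ.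
have tails : tail s2 [set X; Z] = X /\ arc_head (tail s2) [set X; Z] = Z \/
          tail s2 [set X; Z] = Z /\ arc_head (tail s2) [set X; Z] = X.
  case/set2P: (tt _ XZ) => e; rewrite e; [left|right]; split=> //.
    exact: arc_headE.
  by rewrite set2C; apply: arc_headE; rewrite 1?eq_sym // set2C.
have h4 : (W < Z)%N = (Z < X)%N (+) (W < X)%N := h2.
have h5 : (Z < Y)%N = (Y < X)%N (+) (Z < X)%N := h1.
case: tails => -[-> ->]; rewrite e1 h3 h4 h5; case: (_ == _); case: (g _); case: (g _);
by case: (Y < X)%N; case: (Z < X)%N; case: (W < X)%N.
Qed.

End Gauge.

(** * Realization by spinors before a flip *)

Section FlipBack.
Variables (n : nat) (K : rcfType) (I : finType).
Notation A := (grassmann K I).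
Notation E := (evens K I).
Implicit Types (s : state n K I) (P Q R S X Y Z W : 'I_n) (u : A) (T : {set {set 'I_n}}).
Variables (p q : 'I_n -> E) (xi : 'I_n -> A).
Hypothesis xi_odd : forall i, homog true (xi i).
Notation compat := (compat p q xi).

(* Flipping back gives the original state up to the sign of the mu-invariant of
   PRS and the orientations of its sides. *)
Lemma flip_compat_back s s' g : good s -> flip s s' -> compat s' g ->
  exists g', compat s g'.
Proof.
move=> gs fs cs'; have gs' := flip_good gs fs; move: fs.
move=> [P [Q [R [S [f [th' [sg' [rac [rbd [rabcd [rz]]]]]]]]]]] /=.
move=> [/and5P[aPR aPS aSR aRQ aQP] /and3P[/eqP tP c1 c2] [q1 q2 q3 q4] [e1 e2 e3] es'].
have c : cyc4 P Q R S by rewrite /cyc4 c1 c2.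
have qT : quad (arcs s) P Q R S by split; rewrite set2C.
have [/triangulationP[arT nT _] tt tl tm] := gs.
have [d1 d2 d3 d4] := cyc4_ccw c.
have [nPQ nPR nPS nQR /andP[nQS nRS]] := cyc4_neq c.
have arcs' : arcs s' = flip_arcs (arcs s) P Q R S by rewrite es'.
have [b1 b2 b3 b4] := quad_flip c qT.
have dQS := new_diag_in (arcs s) P Q R S.
have lam'E e : lam s' e = if e == [set Q; S] then f else lam s e by rewrite es'.
have tail'E e : tail s' e = if e == [set Q; S] then Q else if e == [set S; R]
  then arc_head (tail s) [set S; R] else tail s e by rewrite es'.
have mu'E D : mu s' D = if D == [set Q; S; P] then th' else if D == [set Q; R; S]
  then sg' else mu s D by rewrite es'.
have QSs : [set Q; S] \notin arcs s.
  by apply/negP => h; apply: (nT P R S Q) => //; rewrite set2C.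
have hPR := tl _ aPR; have hPS := tl _ aPS; have hSR := tl _ aSR; have hRQ := tl _ aRQ.
have hQP := tl _ aQP.
have comm_pe u v : pos_even u -> u * v = v * u by case/andP=> h _; exact: homog_central.
have hz := pos_evenD (pos_evenM hPS hRQ) (pos_evenM hSR hQP).
have pz := pos_even_sqrt hz q4.
have pac := pos_even_sqrt (pos_evenM hPS hRQ) q1.
have pbd := pos_even_sqrt (pos_evenM hSR hQP) q2.
have iev := @homog_evens K I.
have cQSP : ccw Q S P by rewrite -ccw_rot.
have nQRSD : [set Q; R; S] != [set Q; S; P].
  by apply: set3_ccwN; rewrite // nQS (eq_sym S P) nPS (eq_sym Q P) nPQ !orbT.
have [i1 i2 i3] : [/\ sg' * th' = mu s [set P; Q; R] * mu s [set P; R; S],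
    mu s [set P; Q; R] * rz = th' * rac + sg' * rbd
  & - mu s [set P; R; S] * rz = sg' * rac - th' * rbd].
  have oth' : homog true th'.
    by have := good_mu gs' [set Q; S; P]; rewrite mu'E eqxx.
  have osg' : homog true sg'.
    by have := good_mu gs' [set Q; R; S]; rewrite mu'E eqxx ifN.
  have [z ez] := evens_ex (proj1 (andP pz)); have [x1 ex1] := evens_ex (proj1 (andP pac)).
  have [x2 ex2] := evens_ex (proj1 (andP pbd)).
  have nz : body (even_val z) != 0 by rewrite -ez; exact: pos_even_body.
  have [y1 ey1] := evens_ex (proj1 (andP (pos_evenM hPS hRQ))).
  have [y2 ey2] := evens_ex (proj1 (andP (pos_evenM hSR hQP))).
  have k1 : x1 * x1 = y1.
    by apply: even_val_inj; rewrite even_valM -ex1 (proj1 q1) ey1.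
  have k2 : x2 * x2 = y2.
    by apply: even_val_inj; rewrite even_valM -ex2 (proj1 q2) ey2.
  have k3 : z * z = y1 + y2.
    by apply: even_val_inj; rewrite even_valM even_valD -ez (proj1 q4) ey1 ey2.
  rewrite ez ex1 ex2 in e2 e3 *; split.
  - exact: (flip_inv_prod iev nz (tm _) (tm _) osg' oth' k1 k2 k3 e3 e2).
  - exact: (flip_inv_theta iev nz (tm _) (tm _) osg' oth' k1 k2 k3 e3 e2).
  - exact: (flip_inv_sigma iev nz (tm _) (tm _) osg' oth' k1 k2 k3 e3 e2).
have nPQS : [set Q; P] != [set Q; S].
  by apply/eqP => /eq_set2 [[_ e]|[e _]]; subst; rewrite ?eqxx in nPS nQS.
have nPSS : [set P; S] != [set Q; S].
  by apply/eqP => /eq_set2 [[e _]|[e _]]; subst; rewrite ?eqxx in nPS nPQ.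
have nQRS : [set R; Q] != [set Q; S].
  by apply/eqP => /eq_set2 [[e _]|[e _]]; subst; rewrite ?eqxx in nRS nQR.
have nRSS : [set S; R] != [set Q; S].
  by apply/eqP => /eq_set2 [[e _]|[_ e]]; subst; rewrite ?eqxx in nQS nQR.
(* The inverse flip, with Q, R, S, P in the roles of P, Q, R, S; the new mu-invariants are those
   found by [flip_inv_theta] and [flip_inv_sigma]. *)
pose s2 := State
        ([set R; P] |: arcs s' :\ [set Q; S])
        [eta tail s' with [set R; P] |-> R,
                         [set P; S] |-> arc_head (tail s') [set P; S]]
        [eta lam s' with [set R; P] |-> lam s [set P; R]]
        [eta mu s' with [set R; P; Q] |-> mu s [set P; Q; R],
                        [set R; S; P] |-> - mu s [set P; R; S]].
have fs2 : flip s' s2.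
  exists Q, R, S, P, (lam s [set P; R]), (mu s [set P; Q; R]), (- mu s [set P; R; S]).
  exists rbd, rac, rabcd, rz => /=.
  rewrite !lam'E !mu'E !eqxx (negbTE nPQS) (negbTE nPSS) (negbTE nQRS) (negbTE nRSS).
  rewrite (negbTE nQRSD) arcs'; split.
  - by rewrite dQS (set2C S R) (set2C R Q) (set2C P S) (set2C Q P) b1 b2 b3 b4.
  - by rewrite tail'E !eqxx cQSP (ccw_rot S Q R).
  - split.
    + by rewrite (comm_pe (lam s [set Q; P])).
    + by [].
    + have -> : lam s [set Q; P] * lam s [set P; S] * lam s [set S; R] * lam s [set R; Q] =
        lam s [set P; S] * lam s [set S; R] * lam s [set R; Q] * lam s [set Q; P].
        by rewrite -(comm_pe (lam s [set Q; P])) // !mulrA.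
      by [].
    + by rewrite (comm_pe (lam s [set Q; P])) // addrC.
  - split=> //.
    rewrite -(comm_pe (lam s [set P; R])) // e1 -!mulrA i1; congr (_ + _).
    by rewrite addrC (comm_pe (lam s [set Q; P])).
  - by rewrite /s2 arcs'.
have [g2 cs2] := flip_compat xi_odd gs' cs' fs2.
have a2 : arcs s2 = arcs s.
  apply/setP => e; rewrite /s2 /= arcs' !inE; have [->|ne] := eqVneq e [set R; P].
    by rewrite (set2C R P) aPR.
  have [->|ne2] := eqVneq e [set Q; S]; first by rewrite (negbTE QSs).
  by rewrite (set2C P R) ne.
have aRS : [set R; S] \in arcs s by rewrite set2C.
have notQS X Y : [set X; Y] \in arcs s -> ([set X; Y] == [set Q; S]) = false.
  by move=> h; apply: contraNF QSs => /eqP <-.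
(* Compared with s, the state [s2] has the opposite mu-invariant at PRS and the three sides of PRS
   reversed: SR by the first flip, PS by the second, and PR because it now starts at R. *)
eexists; apply: (gauge_compat gs c1 aPR aRS aPS a2 _ _ _ cs2).
- move=> X Y h; rewrite /s2 /= lam'E notQS //.
  by case: eqP => // ->; rewrite set2C.
- move=> X Y Z XY YZ XZ; rewrite /s2 /= mu'E.
  have noQS : ~ (Q \in [set X; Y; Z] /\ S \in [set X; Y; Z]).
    rewrite !inE => -[/orP[/orP[]|] /eqP eQ /orP[/orP[]|] /eqP eS]; case/negP: QSs;
    rewrite eQ eS // 1?set2C //; by move: nQS; rewrite eQ eS eqxx.
  rewrite (set3_rot R P Q) -(set3_rot P R S).
  have nPQR : [set P; Q; R] != [set P; R; S].
    by apply: set3_ccwN; rewrite // ?nPQ ?nPR ?nPS ?nRS ?nQR ?nQS ?orbT.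
  have [->|nPQR'] := eqVneq [set X; Y; Z] [set P; Q; R]; first by rewrite (negbTE nPQR) mul1r.
  have [->|nPRS'] := eqVneq [set X; Y; Z] [set P; R; S]; first by rewrite mulN1r.
  rewrite mul1r; case: eqP => [e|_].
    by case: noQS; rewrite e !inE !eqxx ?orbT.
  case: eqP => [e|_] //.
  by case: noQS; rewrite e !inE !eqxx ?orbT.
- move=> X Y XY; rewrite /s2 /= tail'E notQS //.
  have -> : arc_head (tail s') [set P; S] = arc_head (tail s) [set P; S].
    rewrite /arc_head tail'E (negbTE nPSS); case: eqP => // /eq_set2[[e _]|[e _]].
      by move: nPS; rewrite e eqxx.
    by move: nPR; rewrite e eqxx.
  have [->|nRP] := eqVneq [set X; Y] [set R; P].
    rewrite ifT; last by apply/subsetP => x; rewrite !inE => /orP[] ->; rewrite ?orbT.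
    by rewrite (set2C R P) arc_headE.
  have [->|nPS'] := eqVneq [set X; Y] [set P; S].
    by rewrite ifT //; apply/subsetP => x; rewrite !inE => /orP[] ->; rewrite ?orbT.
  have [->|nSR'] := eqVneq [set X; Y] [set S; R].
    by rewrite ifT //; apply/subsetP => x; rewrite !inE => /orP[] ->; rewrite ?orbT.
  rewrite ifF //; apply/negP => /subsetP sub.
  have := sub X (set21 _ _); have := sub Y (set22 _ _).
  have := arT _ XY; rewrite is_arc2 => nXY.
  rewrite !inE => /orP[/orP[]|] /eqP eY /orP[/orP[]|] /eqP eX; subst X Y;
    by rewrite ?eqxx // 1?set2C ?eqxx // in nXY nRP nPS' nSR'.
Qed.

End FlipBack.

(** * Spinors realizing a fan *)

Section Fan.
Variables (N : nat) (K : rcfType) (I : finType).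
Notation A := (grassmann K I).
Notation E := (evens K I).
Implicit Types (P Q R S X Y Z W : 'I_N.+1) (u : A).
Variable s : state N.+1 K I.
Hypothesis gs : good s.
Hypothesis fan : forall X, ord0 != X -> [set ord0; X] \in arcs s.

Let V k : 'I_N.+1 := inord k.

(** Otherwise XY would cross the arc that joins 0 to X + 1. *)
Lemma fan_arc X Y : [set X; Y] \in arcs s -> (0 < X < Y)%N -> (Y = X.+1 :> nat).
Proof.
have [/triangulationP[_ nT _] _ _ _] := gs.
move=> XY /andP[X0 ltXY]; apply/eqP; rewrite eqn_leq ltXY andbT leqNgt; apply/negP => h.
have hV : X.+1 = V X.+1 :> nat by rewrite inordK // (leq_trans h) // ltnW.
apply: (nT ord0 (V X.+1) Y X) => //; first by apply: fan; rewrite -val_eqE /= -hV.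
- by rewrite set2C.
- by rewrite /ccw -hV /=; lia.
- by rewrite /ccw -hV /=; lia.
Qed.

Lemma fan_triangle X Y Z : [set X; Z] \in arcs s -> (X < Y < Z)%N -> X = ord0.
Proof.
have [/triangulationP[_ nT _] _ _ _] := gs.
move=> XZ /andP[h1 h2]; apply/eqP; rewrite -val_eqE /=; apply/negPn/negP => nX.
apply: (nT ord0 Y Z X); rewrite 1?(set2C Z) //; first by apply: fan; rewrite -val_eqE /=; lia.
- by rewrite /ccw /=; lia.
- by rewrite /ccw /=; lia.
Qed.

Lemma fan_succ k : (0 < k)%N -> (k < N)%N -> [set V k; V k.+1] \in arcs s.
Proof.
have [/triangulationP[_ nT sT] _ _ _] := gs.
move=> k0 kN; have h1 : V k = k :> nat by rewrite inordK // ltnW.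
have h2 : V k.+1 = k.+1 :> nat by rewrite inordK.
apply: sT => [|r t _]; first by rewrite -val_eqE /= h1 h2; lia.
by rewrite /ccw h1 h2; lia.
Qed.

(** The gauge of the triangle 0, k, k + 1, propagated by [compat_tail] from one triangle to the next
    across their common diagonal. The farther apex exceeds both ends of this diagonal, so only the
    comparison of the nearer apex with the tail remains. *)
Fixpoint fan_sign (k : nat) : bool :=
  if k is j.+1 then fan_sign j (+) (j < tail s [set ord0; V j.+1])%N else false.

(** The action of OSp(1|2) suggests the normalization (1, 0 | 0) at vertex 0 and p_1 = xi_1 = 0.
    Then L_0k = q_k and the volume of 0, k, k + 1 is q_k xi_(k+1) - q_(k+1) xi_k, so the
    mu-invariant determines xi_(k+1) and the outer side then determines p_(k+1), both by division by
    q_k. *)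
Lemma fan_spinors_ex (q : nat -> E) :
  (forall k, (0 < k <= N)%N -> even_val (q k) = lam s [set ord0; V k]) ->
  forall m, exists (p : nat -> E) (xi : nat -> A),
  [/\ forall k, homog true (xi k), [/\ p 0 = 1, p 1 = 0, xi 0 = 0 & xi 1 = 0] &
   forall k, (0 < k < m)%N -> (k < N)%N ->
     even_val (p k * q k.+1 - q k * p k.+1) - xi k * xi k.+1 = lam s [set V k; V k.+1] /\
     forall r, is_sqrt (lam s [set ord0; V k] * lam s [set V k; V k.+1] *
                        lam s [set ord0; V k.+1]) r ->
     mu s [set ord0; V k; V k.+1] * r =
       (-1) ^+ fan_sign k * (even_val (q k) * xi k.+1 - even_val (q k.+1) * xi k)].
Proof.
have [tT tt tl tm] := gs.
move=> hq; elim=> [|m [p [xi [oxi [p0 p1 x0 x1] IH]]]].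
  exists (fun k => if k is 0 then 1 else 0), (fun _ => 0); split=> //; first by move=> ?; exact: homog0.
  by move=> k; rewrite ltn0 andbF.
have [m0|m_gt0] := posnP m.
  by exists p, xi; split=> // k; rewrite m0; case: k.
have [leNm|ltmN] := leqP N m.
  exists p, xi; split=> // k /andP[k0 lekm] ltkN; apply: IH => //.
  by rewrite k0 (leq_trans ltkN).
have hV k : (0 < k)%N -> (k <= N)%N -> ord0 != V k.
  by move=> h1 h2; rewrite -val_eqE /= inordK // eq_sym -lt0n.
have pem := tl _ (fan (hV _ m_gt0 (ltnW ltmN))); have pem1 := tl _ (fan (hV m.+1 isT ltmN)).
have pemm := tl _ (fan_succ m_gt0 ltmN).
have [r hr pr] := pos_even_sqrt_ex (pos_evenM (pos_evenM pem pemm) pem1).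
have eqm : even_val (q m) = lam s [set ord0; V m] by rewrite hq // m_gt0 ltnW.
have qm : pos_even (even_val (q m)) by rewrite eqm.
have [y hy] := gdiv_ex ((-1) ^+ fan_sign m * (mu s [set ord0; V m; V m.+1] * r) +
   even_val (q m.+1) * xi m) (pos_even_body qm).
have oy : homog true y.
  apply: (homog_unmul (homog_evens (q m)) (pos_even_body qm)); rewrite hy.
  apply: homogD; last exact: (homogM (homog_evens _) (oxi m)).
  have h : homog true (mu s [set ord0; V m; V m.+1] * r).
    by case/andP: pr => h _; exact: (homogM (tm _) h).
  by case: fan_sign; rewrite ?expr0 ?mul1r // expr1 mulN1r; apply: homogN.
have [z hz] := gdiv_ex (even_val (p m * q m.+1) - xi m * y - lam s [set V m; V m.+1])
  (pos_even_body qm).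
have ez : homog false z.
  apply: (homog_unmul (homog_evens (q m)) (pos_even_body qm)); rewrite hz.
  apply: homogB; last by case/andP: pemm.
  by apply: homogB; [exact: homog_evens | exact: (homogM (oxi m) oy)].
have [z' ez'] := evens_ex ez.
exists (fun k => if k == m.+1 then z' else p k), (fun k => if k == m.+1 then y else xi k).
split.
- by move=> k; case: eqP.
- by case: m m_gt0 {IH ltmN hV pem pem1 pemm hr eqm qm hy hz}.
move=> k /andP[k0]; rewrite ltnS leq_eqVlt => /orP[/eqP-> _|ltkm ltkN]; last first.
  have -> : (k == m.+1) = false by apply/eqP; lia.
  have -> : (k.+1 == m.+1) = false by apply/eqP; lia.
  by apply: IH; rewrite // k0.
rewrite eqxx; have -> : (m == m.+1) = false by apply/eqP; lia.
split.
  rewrite even_valD even_valN [even_val (q m * z')]even_valM -ez' hz.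
  by rewrite !opprB addrCA (addrCA (even_val _)) subrr addr0 addrK.
move=> r' hr'; rewrite (is_sqrt_uniq hr' hr) hy addrK.
by rewrite signrMK.
Qed.

(* The sum of the elements of {0, k, k + 1} determines k. *)
Definition fan_gauge (D : {set 'I_N.+1}) : bool := fan_sign (\sum_(i in D) i)./2.

Lemma fan_gaugeE X Y Z : ord0 = X -> (0 < Y)%N -> (Z = Y.+1 :> nat) ->
  fan_gauge [set X; Y; Z] = fan_sign Y.
Proof.
move=> <- Y0 eZ; have nY : ord0 != Y by rewrite -val_eqE /= eq_sym -lt0n.
have nZ : ord0 != Z by rewrite -val_eqE /= eZ.
have nYZ : Y != Z by rewrite -val_eqE /= eZ; lia.
rewrite /fan_gauge -setUA big_setU1 /=; last by rewrite !inE negb_or nY.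
rewrite big_setU1 /=; last by rewrite !inE.
rewrite big_set1 eZ add0n addnS addnn; congr fan_sign.
by rewrite /= uphalf_double.
Qed.

Lemma fan_compat : exists (p q : 'I_N.+1 -> E) (xi : 'I_N.+1 -> A) g,
  (forall X, homog true (xi X)) /\ compat p q xi s g.
Proof.
have [tT tt tl tm] := gs.
pose q k : E := if k is 0 then 0 else insubd 0 (lam s [set ord0; V k]).
have hV k : (0 < k)%N -> (k <= N)%N -> ord0 != V k.
  by move=> h1 h2; rewrite -val_eqE /= inordK // eq_sym -lt0n.
have hq k : (0 < k <= N)%N -> even_val (q k) = lam s [set ord0; V k].
  case: k => // k /andP[_ kN]; rewrite /q.
  have /andP[h _] := tl _ (fan (hV k.+1 isT kN)).
  exact: (insubdK _ h).
have [p [xi [oxi [p0 p1 x0 x1] hp]]] := fan_spinors_ex hq N.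
exists (fun X => p X), (fun X => q X), (fun X => xi X), fan_gauge; split=> //.
have Vval X : V X = X by rewrite /V inord_val.
have pr0 X : ord0 != X -> pairing (@even_val K I) (fun X => p X) (fun X => q X) (fun X => xi X) ord0 X
    = even_val (q X).
  by move=> nX; rewrite /pairing /= p0 x0 mul0r subr0 mul1r mul0r subr0.
have Xpos X : ord0 != X -> (0 < X)%N by rewrite -val_eqE /= eq_sym lt0n.
have Xpos' X : (0 < X)%N -> ord0 != X by rewrite -val_eqE /= eq_sym lt0n.
have lam0 X : ord0 != X -> even_val (q X) = lam s [set ord0; X].
  by move=> nX; rewrite hq ?Vval // Xpos // -ltnS ltn_ord.
have lamS X Y : (0 < X)%N -> Y = X.+1 :> nat ->
    pairing (@even_val K I) (fun X => p X) (fun X => q X) (fun X => xi X) X Y = lam s [set X; Y].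
  move=> X0 eY; have ltXN : (X < N)%N by rewrite -ltnS -eY ltn_ord.
  have hX : (0 < X < N)%N by rewrite X0.
  have [h _] := hp X hX ltXN.
  by move: h; rewrite -eY !Vval /pairing => ->.
have lamlt X Y : [set X; Y] \in arcs s -> (X < Y)%N ->
    lam s [set X; Y] = pairing (@even_val K I) (fun X => p X) (fun X => q X) (fun X => xi X) X Y.
  move=> XY lt; have [X0|X0] := posnP X.
    have -> : X = ord0 by apply: val_inj.
    by rewrite pr0 -?lam0 //; apply: Xpos'; rewrite (leq_ltn_trans _ lt).
  by rewrite lamS //; apply: fan_arc; rewrite // X0.
split.
- move=> X Y XY; have [/triangulationP[aT _ _] _ _ _] := gs.
  have := aT _ XY; rewrite is_arc2 => nXY.
  have [lt|gt|e] := ltngtP X Y; first by rewrite mul1r lamlt.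
    rewrite -[in RHS]/(_ ^+ true) expr1 mulN1r set2C lamlt // 1?set2C //.
    by rewrite (pairingC (@homog_evens K I) _ _ (fun X => oxi X)).
  by move: nXY; rewrite -val_eqE /= e eqxx.
- move=> X Y Z r cX XY YZ XZ.
  pose sp := mu_spec (fun X => p X) (fun X => q X) (fun X => xi X) (lam s) (mu s) fan_gauge.
  suff: sp X Y Z by apply.
  (* A counterclockwise triple is a rotation of an increasing one, and a triangle of the fan listed
     increasingly starts at 0. *)
  have base (x y z : 'I_N.+1) : (x < y < z)%N -> [set x; y] \in arcs s -> [set y; z] \in arcs s ->
      [set x; z] \in arcs s -> sp x y z.
    move=> lt xy yz xz; have ex := fan_triangle xz lt; subst x.
    have /andP[y0 ltyz] := lt; have ez : z = y.+1 :> nat by apply: fan_arc; rewrite ?y0.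
    have ltyN : (y < N)%N by rewrite -ltnS -ez ltn_ord.
    have hy : (0 < y < N)%N by rewrite y0.
    have [_ h] := hp y hy ltyN.
    move=> t ht; rewrite fan_gaugeE // /osp_vol pr0; last by apply: Xpos'; rewrite ez.
    rewrite pr0; last exact: Xpos'.
    rewrite x0 !mul0r add0r addr0; move: h; rewrite -ez !Vval => ->; last exact: ht.
    rewrite addrC (homog_central _ (homog_evens (q y))) (homog_central _ (homog_evens (q z))).
    by [].
  have rot (x y z : 'I_N.+1) : [set x; y] \in arcs s -> [set y; z] \in arcs s ->
      [set x; z] \in arcs s -> sp x y z -> sp y z x.
    by move=> h1 h2 h3; apply: mu_spec_rot => //; apply: tl.
  have YX : [set Y; X] \in arcs s by rewrite set2C.
  have ZX : [set Z; X] \in arcs s by rewrite set2C.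
  have ZY : [set Z; Y] \in arcs s by rewrite set2C.
  case/or3P: cX => h; first exact: base.
    by apply: (rot _ _ _ ZX XY ZY); apply: (rot _ _ _ YZ ZX YX); apply: base.
  by apply: (rot _ _ _ ZX XY ZY); apply: base.
- move=> X Y Z W cX qX XZ /=.
  have half (y z w : 'I_N.+1) : cyc4 ord0 y z w -> quad (arcs s) ord0 y z w ->
      tail_spec (tail s) fan_gauge ord0 y z w.
    case/cyc4P=> -[/andP[h1 h2] h3] //; move=> [b1 b2 b3 b4].
    have ez : z = y.+1 :> nat by apply: fan_arc; rewrite ?h1.
    have ew : w = z.+1 :> nat by apply: fan_arc => //; rewrite (leq_trans h1) // ltnW.
    rewrite /tail_spec !fan_gaugeE //; last by rewrite ez.
    have nz : ord0 != z by apply: Xpos'; rewrite ez.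
    have -> : fan_sign z = fan_sign y (+) (y < tail s [set ord0; z])%N.
      by have eV := Vval z; rewrite ez in eV; rewrite ez /= eV.
    have -> : (w < tail s [set ord0; z])%N = false.
      case/set2P: (tt _ (fan nz)) => ->; first by rewrite ltn0.
      by apply/negbTE; rewrite -leqNgt ew.
    by rewrite addbF.
  have [b1 b2 b3 b4] := qX; have [d1 d2 d3 d4] := cyc4_ccw cX.
  have [n1 n2 n3 n4 /andP[n5 n6]] := cyc4_neq cX.
  (* Every triangle of the fan contains 0, so a diagonal XZ avoiding 0 would have 0 as both of its
     apexes. *)
  have in0 (x y z : 'I_N.+1) : ccw x y z -> [set x; y] \in arcs s -> [set y; z] \in arcs s ->
      [set x; z] \in arcs s -> [|| x == ord0, y == ord0 | z == ord0].
    move=> /or3P[] lt h1 h2 h3.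
    - by rewrite (fan_triangle h3 lt) eqxx.
    - by rewrite (@fan_triangle y z x) ?eqxx ?orbT // set2C.
    - by rewrite (@fan_triangle z x y) ?eqxx ?orbT // set2C.
  have XW : [set X; W] \in arcs s by rewrite set2C.
  have i1 := in0 _ _ _ d1 b1 b2 XZ; have i2 := in0 _ _ _ d3 XZ b3 XW.
  have [eX|nX] := eqVneq X ord0; first by subst X; apply: half.
  have [eZ|nZ] := eqVneq Z ord0.
    subst Z; apply: tail_spec_sym; apply: half; first by rewrite -cyc4_rot -cyc4_rot.
    by case: qX.
  move: i1 i2; rewrite (negbTE nX) (negbTE nZ) /= orbF => /eqP eY /eqP eW.
  by move: n5; rewrite eY eW eqxx.
Qed.

End Fan.

(** * Lambda-lengths as pairings of spinors *)

Section LambdaLengths.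
Variables (N : nat) (K : rcfType) (I : finType).
Notation A := (grassmann K I).
Notation E := (evens K I).
Implicit Types (s : state N.+1 K I).

Lemma flips_compat_back p q (xi : 'I_N.+1 -> A) s s' g : (forall X, homog true (xi X)) ->
  good s -> flips s s' -> compat p q xi s' g -> exists g', compat p q xi s g'.
Proof.
move=> oxi gs fs; elim: fs g => [g c|s1 s2 f1 IH f2 g c]; first by exists g.
by have [g' /IH] := flip_compat_back oxi (flips_good gs f1) f2 c.
Qed.

Lemma flips_compat p q (xi : 'I_N.+1 -> A) s s' g : (forall X, homog true (xi X)) ->
  good s -> flips s s' -> compat p q xi s g -> exists g', compat p q xi s' g'.
Proof.
move=> oxi gs fs c; elim: fs => [|s1 s2 f1 [g1 c1] f2]; first by exists g.
exact: flip_compat (flips_good gs f1) c1 f2.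
Qed.

Lemma good_compat s : good s -> exists (p q : 'I_N.+1 -> E) (xi : 'I_N.+1 -> A) g,
  (forall X, homog true (xi X)) /\ compat p q xi s g.
Proof.
move=> gs; have [s' fs fan] := fan_reachable ord0 gs.
have [p [q [xi [g [oxi c]]]]] := fan_compat (flips_good gs fs) fan.
have [g' c'] := flips_compat_back oxi gs fs c.
by exists p, q, xi, g'.
Qed.

(** Flips change the gauge but not the spinors, so every state reachable from s gives the same
    pairing, whence the independence of the flips. Existence uses the fan at a. *)
Lemma is_lambda_lengthP p q (xi : 'I_N.+1 -> A) s g a b v : (forall X, homog true (xi X)) ->
  good s -> compat p q xi s g -> a != b ->
  is_lambda_length s a b v <-> v = (-1) ^+ (b < a)%N * pairing (@even_val K I) p q xi a b.
Proof.
move=> oxi gs c nab; split=> [[s' [fs ab ->]]|->].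
  have [g' [cl _ _]] := flips_compat oxi gs fs c; exact: cl.
have [s' fs fan] := fan_reachable a gs; have [g' [cl _ _]] := flips_compat oxi gs fs c.
by exists s'; split=> //; rewrite ?cl // fan.
Qed.

Lemma initial_good (n : nat) (T : {set {set 'I_n}}) tail (x : {set 'I_n} -> K) :
  triangulation T -> (forall e, e \in T -> 0 < x e) -> (forall e, e \in T -> tail e \in e) ->
  good (initial T tail x).
Proof.
move=> tT x0 tt; split=> //= [e eT|D].
  by rewrite /pos_even homog_scalar body_scalar x0.
by rewrite /theta; case: insubP => [i _ _|_]; [exact: homog_gen | exact: homog0].
Qed.

End LambdaLengths.

(** * Weighted sums over walks *)

Section OddProducts.
Variables (K : rcfType) (I : finType) (J : Type) (F : J -> grassmann K I).
Hypothesis F_odd : forall j, homog true (F j).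

Lemma homog_prod (s : seq J) : homog (odd (size s)) (\prod_(k <- s) F k).
Proof.
elim: s => [|k s IH]; first by rewrite big_nil homog1.
by rewrite big_cons; exact: (homogM (F_odd k) IH).
Qed.

Lemma signM_homog c (v w : grassmann K I) : v * ((-1) ^+ c * w) = (-1) ^+ c * (v * w).
Proof. by rewrite -signr_odd; case: (odd c); rewrite ?expr0 ?mul1r // expr1 !mulN1r mulrN. Qed.
End OddProducts.

(** * Products in the positive ordering *)

Section PositiveOrder.
Variables (n m : nat) (tri d : nat -> {set 'I_n}) (tail : {set 'I_n} -> 'I_n).
Implicit Types (i j k : 'I_m) (s : seq 'I_m).

Notation right k := (right_of tail (d k) (tri k)).
Notation ge := (fun i j : 'I_m => pos_ge tri d tail i j).

Lemma pos_ge_total : total ge.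
Proof.
move=> i j; rewrite /pos_ge; have [lt|lt|e] := ltngtP i j; by rewrite ?orbN // ?orNb.
Qed.

Lemma pos_ge_anti : antisymmetric ge.
Proof.
move=> i j; rewrite /pos_ge; have [lt|lt|e _] := ltngtP i j; last by apply: val_inj.
  by rewrite /=; case: (right _).
by rewrite /=; case: (right _).
Qed.

Lemma pos_ge_trans : transitive ge.
Proof.
move=> j i k; have [->//|nij] := eqVneq i j; have [->//|njk] := eqVneq j k.
have [->|nik] := eqVneq i k; first by rewrite /pos_ge eqxx.
move: nij njk nik; rewrite -!val_eqE /= /pos_ge.
have [ij|ij|//] := ltngtP (i : nat) j; have [jk|jk|//] := ltngtP (j : nat) k;
have [ik|ik|//] := ltngtP (i : nat) k => //= _ _ _;
  try (by move=> *; exfalso; move: ij jk ik; clear; lia);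
  by case: (right i); case: (right j); case: (right k).
Qed.

(** b alternates along the sequence; started as in [sorted_prod], it tells whether the number of
    remaining factors is even, which is when moving the current one to the end costs a sign. The
    factor moves there when its triangle is not to the right of its diagonal. *)
Fixpoint pair_sign (b : bool) s : bool :=
  if s is k :: s' then (b && ~~ right k) (+) pair_sign (~~ b) s' else false.

Variables (K : rcfType) (I : finType) (F : 'I_m -> grassmann K I).
Hypothesis F_odd : forall j, homog true (F j).

(* Moving the first of an even number of factors to the end changes the sign,
   while moving the first of an odd number of factors does not. *)
Lemma sorted_prod s : pairwise (fun i j : 'I_m => i < j)%N s ->
  \prod_(k <- sort ge s) F k = (-1) ^+ pair_sign (~~ odd (size s)) s * \prod_(k <- s) F k.
Proof.
elim: s => [|i s IH] /=; first by rewrite !big_nil mulr1.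
case/andP=> lt /IH {}IH.
have hp : homog (odd (size s)) (\prod_(k <- sort ge s) F k).
  by rewrite -(size_sort ge); exact: homog_prod.
(* By definition of the positive ordering, the factor of least index is above all the others or
   below all of them. *)
have hsort : sort ge (i :: s) = if right i then i :: sort ge s else rcons (sort ge s) i.
  have /perm_sortP := perm_refl (i :: s) => H.
  have -> : sort ge (i :: s) = sort ge (if right i then i :: sort ge s else rcons (sort ge s) i).
    apply/(perm_sortP pos_ge_total pos_ge_trans pos_ge_anti).
    have ps : perm_eq s (sort ge s) by rewrite perm_sym perm_sort.
    by case: ifP => _; rewrite ?(perm_sym _ (rcons _ _)) ?perm_rcons ?perm_cons // perm_sym.
  apply: (sorted_sort pos_ge_trans); rewrite (sorted_pairwise pos_ge_trans).
  have sp : pairwise ge (sort ge s).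
    by rewrite -(sorted_pairwise pos_ge_trans) sort_sorted //; exact: pos_ge_total.
  case: ifP => ri; rewrite ?pairwise_rcons ?pairwise_cons sp andbT all_sort; apply: sub_all lt => j ij.
    by rewrite /pos_ge ij ri orbT.
  by rewrite /pos_ge [(j < i)%N]ltnNge (ltnW ij) /= ri orbT.
rewrite hsort big_cons; case: ifP => ri.
  by rewrite big_cons IH signM_homog negbK; case: (odd _).
rewrite big_rcons /=.
have -> : (\prod_(k <- sort ge s) F k) * F i = (-1) ^+ (odd (size s)) * (F i * \prod_(k <- sort ge s) F k).
  by rewrite (homog_supercomm hp (F_odd i)) andbT.
rewrite IH signM_homog mulrA -signr_addb; congr (_ ^+ _ * _).
by rewrite negbK; case: (odd _).
Qed.

End PositiveOrder.

(** * Sums over sequences of bounded length *)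

Section AllSeqs.
Variable X : finType.

(** Listed by recursion on the bound, so that a sum over sequences splits by the first term. *)
Fixpoint allseqs (N : nat) : seq (seq X) :=
  if N is N'.+1 then [::] :: [seq s :: t | s <- enum X, t <- allseqs N'] else [:: [::]].

Lemma mem_allseqs N t : (t \in allseqs N) = (size t <= N)%N.
Proof.
elim: N t => [|N IH] [|s t] //=; rewrite inE /= ltnS -IH.
apply/allpairsP/idP => [[[s' t'] /= [_ h [_ ->]]] //|h].
by exists (s, t); rewrite /= mem_enum.
Qed.

Lemma uniq_allseqs N : uniq (allseqs N).
Proof.
elim: N => //= N IH; apply/andP; split; first by apply/allpairsP => -[[? ?] [_ _]].
apply: allpairs_uniq; rewrite ?enum_uniq // => -[? ?] [? ?] _ _ /= [-> ->] //.
Qed.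

Variable R : nmodType.
Implicit Types (P : pred (seq X)) (F : seq X -> R).

Lemma sum_bseq N P F : \sum_(t : N.-bseq X | P t) F t = \sum_(t <- allseqs N | P t) F t.
Proof.
rewrite -(big_map (fun t : N.-bseq X => bseqval t) P F); apply: perm_big; apply: uniq_perm.
- by rewrite map_inj_uniq ?index_enum_uniq //; exact: val_inj.
- exact: uniq_allseqs.
move=> t; rewrite mem_allseqs; apply/mapP/idP => [[t' _ ->]|h]; first exact: size_bseq.
by exists (Bseq h); rewrite ?mem_index_enum.
Qed.

Lemma sum_allseqs_stable N N' P F : (forall t, P t -> size t <= N)%N ->
  (forall t, P t -> size t <= N')%N ->
  \sum_(t <- allseqs N | P t) F t = \sum_(t <- allseqs N' | P t) F t.
Proof.
move=> h h'; rewrite -[LHS]big_filter -[RHS]big_filter; apply: perm_big; apply: uniq_perm.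
- exact/filter_uniq/uniq_allseqs.
- exact/filter_uniq/uniq_allseqs.
move=> t; rewrite !mem_filter !mem_allseqs; case Pt: (P t) => //=.
by rewrite h // h'.
Qed.

Lemma sum_allseqsS N P F : \sum_(t <- allseqs N.+1 | P t) F t =
  (if P [::] then F [::] else 0) + \sum_(s : X) \sum_(t <- allseqs N | P (s :: t)) F (s :: t).
Proof.
rewrite -[allseqs N.+1]/([:: [::]] ++ [seq s :: t | s <- enum X, t <- allseqs N]).
rewrite big_cat; congr (_ + _); first by rewrite big_mkcond big_seq1.
rewrite big_mkcond big_allpairs_dep big_enum.
by apply: eq_bigr => s _; rewrite [RHS]big_mkcond.
Qed.

End AllSeqs.

(** * Weights of walks *)

Section WalkSums.
Variables (n m : nat) (tri d : nat -> {set 'I_n}) (u : nat -> 'I_n) (a b : 'I_n).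
Variables (K : rcfType) (T : {set {set 'I_n}}) (tail : {set 'I_n} -> 'I_n) (x : {set 'I_n} -> K).
Notation A := (super_alg K T).
Notation step := (gedge n m * gvertex n m)%type.
Implicit Types (e : gedge n m) (v w : gvertex n m) (t : seq step).
Notation walk := (walk tri d u b).
Notation right k := (right_of tail (d k) (tri k)).
Notation th := (theta K T).

Lemma theta_odd D : homog true (th D).
Proof. by rewrite /theta; case: insubP => [i _ _|_]; [exact: homog_gen | exact: homog0]. Qed.

Definition is_inl v := if v is inl _ then true else false.

(* The factor of a step along a sigma-edge; the sign turns the product in the
   order of the path into the product in the positive ordering. *)
Definition step_theta (s : step) : A :=
  if s.1 is Sigma k then (-1) ^+ (~~ is_inl s.2 && ~~ right k) * th (tri k) else 1.

Fixpoint walk_weight (par : bool) t : A :=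
  if t is s :: t' then (scalar_weight tri u x par s.1 *: step_theta s) * walk_weight (~~ par) t'
  else 1.

Lemma scalar_weight_odd i j e : odd i = odd j ->
  scalar_weight tri u x i e = scalar_weight tri u x j e.
Proof. by case: e => //= s ->. Qed.

Lemma walk_weightE (par : bool) t : walk_weight par t =
  (\prod_(i < size t) scalar_weight tri u x (i + par) (nth (Arc m set0) (unzip1 t) i)) *:
  \prod_(s <- t) step_theta s.
Proof.
elim: t par => [|s t IH] par /=; first by rewrite big_ord0 big_nil scale1r.
rewrite IH big_ord_recl big_cons -scalerAl -scalerAr scalerA /= add0n.
congr ((_ * _) *: _); apply: eq_bigr => i _; rewrite /bump leq0n /=.
by apply: scalar_weight_odd; rewrite !oddD /=; case: (odd i); case: par.
Qed.

(** Each sigma-edge switches between the polygon and the vertices theta_k, and the walk ends on the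
    polygon, so the start determines the parity of their number. The sigma-edges entering some
    theta_k are those followed by an odd number of others, where [pair_sign] may collect a sign. *)
Lemma walk_thetas v par p t : walk v par p t ->
  let s := pmap (@sigma_index n m) (unzip1 t) in
  [/\ \prod_(s <- t) step_theta s =
      (-1) ^+ pair_sign tri d tail (is_inl v) s * \prod_(k <- s) th (tri k),
     odd (size s) = ~~ is_inl v, all (fun k : 'I_m => p <= k.*2)%N s &
     pairwise (fun i j : 'I_m => i < j)%N s].
Proof.
elim: t v par p => [|[e w] t IH] v par p /=.
  by move=> /andP[/eqP-> _]; rewrite !big_nil mulr1.
case/andP=> /and5P[/= h1 h2 h3 h4 /andP[h5 h6]] /IH /=.
set s := pmap _ _ => -[g1 g2 g3 g4]; rewrite big_cons g1.
have mono (p' : nat) : (p <= p')%N -> all (fun k : 'I_m => p' <= k.*2)%N s ->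
    all (fun k : 'I_m => p <= k.*2)%N s.
  by move=> pp; apply: sub_all => k; apply: leq_trans.
case: e h1 h2 h3 h4 h5 h6 g3 => [e|k|i j] h1 h2 h3 h4 h5 h6 g3.
- have [y [z [ev ew _]]] := ends_Arc h2; rewrite ev ew in g1 g2 *.
  rewrite /step_theta /= mul1r; split=> //; apply: mono g3.
  by move: h6; rewrite /next_pos; case: (position _ _) => [q|] //; apply: leqW.
- rewrite /next_pos /= in g3 h6.
  have lt : all (fun j : 'I_m => k < j)%N s by apply: sub_all g3 => j; clear; lia.
  have all1 : all (fun j : 'I_m => p <= j.*2)%N s by apply: mono g3; apply: leqW.
  rewrite /step_theta /= big_cons h6 lt all1 g4.
  case: (ends_Sigma h2) => -[ev ew]; rewrite ev ew /= in g2 *; rewrite g2; split=> //.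
    by rewrite expr0 mul1r signM_homog.
  by rewrite -mulrA signM_homog mulrA -signr_addb.
- by case: (ends_Tau h2) => -[ev ew]; rewrite ev ew /= in g2 *; rewrite /step_theta /= mul1r; split.
Qed.

Lemma path_weightE t : walk (inl a) false 0 t ->
  path_weight tri d u T tail x t = walk_weight false t.
Proof.
move=> wt; have [h1 h2 h3 h4] := walk_thetas wt.
rewrite walk_weightE h1 /path_weight.
rewrite (sorted_prod tri d tail (fun j : 'I_m => theta_odd (tri j)) h4) h2.
congr (_ *: _); apply: eq_bigr => i _.
by apply: scalar_weight_odd; rewrite addn0.
Qed.

(* No walk is longer than this bound. *)
Definition walk_sum v (par : bool) (p : nat) : A :=
  \sum_(t <- allseqs [the finType of step] (4 * m).+2 | walk v par p t) walk_weight par t.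

Lemma walk_sumE v par p : walk_sum v par p = ((v == inl b) && par)%:R +
  \sum_(s : step | step_ok tri d u v par p s)
    (scalar_weight tri u x par s.1 *: step_theta s) * walk_sum s.2 (~~ par) (next_pos d s.1 p).
Proof.
have bound v' par' p' t : walk v' par' p' t -> (size t <= (4 * m).+2)%N.
  move=> /walk_size; case: par'; clear; lia.
rewrite /walk_sum (sum_allseqs_stable (N' := (4 * m).+3) _ (bound v par p)); last first.
  by move=> t /bound /leqW.
rewrite sum_allseqsS /=; congr (_ + _); first by case: (_ && _).
rewrite [RHS]big_mkcond; apply: eq_bigr => s _; case: (step_ok _ _ _ _ _ _ _) => /=; last first.
  by rewrite big_pred0.
by rewrite big_distrr.
Qed.

End WalkSums.

(** * Recurrences by the first step *)

Section WalkRecurrences.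
Variables (n m : nat) (tri d : nat -> {set 'I_n}) (u : nat -> 'I_n) (a b : 'I_n).
Variables (K : rcfType) (T : {set {set 'I_n}}) (tail : {set 'I_n} -> 'I_n) (x : {set 'I_n} -> K).
Notation A := (super_alg K T).
Notation step := (gedge n m * gvertex n m)%type.
Implicit Types (e : gedge n m) (v w : 'I_n) (t : seq step).
Notation walk := (walk tri d u b).
Notation right k := (right_of tail (d k) (tri k)).
Notation th := (theta K T).
Notation WS := (walk_sum (m:=m) tri d u b T tail x).

(** Both sums run over the same sequences once the bounds on the length are seen to be harmless:
    distinctness of the edges justifies the first bound, the positions justify the second. *)
Lemma super_path_sumE : triangulation T -> a != b -> met_in_order T a b m tri d ->
  centers m d u ->
  super_path_sum m T tri d u a b tail x = WS (inl a) false 0.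
Proof.
move=> tT nab met cen; rewrite /super_path_sum sum_bseq.
have hP := super_path_walk tT nab met cen.
have h1 t : super_path tri d u a b t -> (size t <= #|{: gedge n m}|)%N.
  by move=> /and5P[ut _ _ _ _]; rewrite -(size_map fst) -(card_uniqP ut) max_card.
have h2 t : super_path tri d u a b t -> (size t <= (4 * m).+2)%N.
  by rewrite hP => /walk_size; clear; lia.
rewrite (sum_allseqs_stable _ h1 h2) /walk_sum; apply: eq_big => t; first exact: hP.
by rewrite hP => /path_weightE.
Qed.

Definition sigma_weight (k : nat) : K :=
  Num.sqrt (x (tri k :\ u k) / \prod_(w in tri k :\ u k) x [set u k; w]).

Definition adjacent v w := (v != w) && [exists k : 'I_m, [set v; w] \subset tri k].
Notation arcpos v w := (position d (Arc m [set v; w])).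

Lemma step_ok_Arc v w (par : bool) p :
  step_ok tri d u (inl v) par p (Arc m [set v; w], inl w) =
  [&& adjacent v w, par ==> (arcpos v w != None) & if arcpos v w is Some q then (p <= q)%N else true].
Proof.
by rewrite /step_ok /= is_arc2 /= -/(arcpos v w) imsetU1 imset_set1 eqxx /adjacent.
Qed.

Lemma sum_arcs v (par : bool) p (F : step -> A) :
  \sum_(s : step | step_ok tri d u (inl v) par p s && ~~ is_sigma s.1) F s =
  \sum_(w | [&& adjacent v w, par ==> (arcpos v w != None) &
     if arcpos v w is Some q then (p <= q)%N else true]) F (Arc m [set v; w], inl w).
Proof.
rewrite (reindex_onto (fun w : 'I_n => (Arc m [set v; w], inl w) : step)
   (fun s => if s.2 is inl w then w else v)).
  by apply: eq_bigl => w; rewrite step_ok_Arc [is_sigma _]/= eqxx !andbT.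
move=> [[s|k|i j] w] /andP[/and5P[/= _ h _ _ _] h'] //.
  by have [y [z [ev -> ->]]] := ends_Arc (u := u) h; case: ev => ->.
by case: (@ends_Tau n m u i j (inl v) w h) => -[].
Qed.

Lemma walk_sum_odd v p : WS (inl v) false p =
  \sum_(w | adjacent v w && (if arcpos v w is Some q then (p <= q)%N else true))
    x [set v; w] *: WS (inl w) true (next_pos d (Arc m [set v; w]) p).
Proof.
rewrite walk_sumE andbF add0r.
rewrite (eq_bigl (fun s => step_ok tri d u (inl v) false p s && ~~ is_sigma s.1)).
  rewrite (sum_arcs v false p) /=; apply: eq_bigr => w _.
  by rewrite /step_theta /= -scalerAl mul1r.
by move=> s; case ok: (step_ok _ _ _ _ _ _ _) => //=; move: ok => /and5P[_ _ _ /implyP]; case: is_sigma => // /(_ isT).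
Qed.

Lemma walk_sum_even v p : WS (inl v) true p = (v == b)%:R +
  \sum_(w | adjacent v w && (if arcpos v w is Some q then (p <= q)%N else false))
    (x [set v; w])^-1 *: WS (inl w) false (next_pos d (Arc m [set v; w]) p) +
  \sum_(k : 'I_m | (u k == v) && (p <= k.*2)%N)
    (sigma_weight k *: ((-1) ^+ (~~ right k) * th (tri k))) * WS (inr k) false k.*2.+1.
Proof.
rewrite walk_sumE andbT -addrA; congr (_ + _).
rewrite (bigID (fun s : step => is_sigma s.1)) [RHS]addrC; congr (_ + _); last first.
  rewrite (sum_arcs v true p); apply: eq_big => [w|w _].
    by case: (arcpos v w).
  by rewrite /step_theta /= -scalerAl mul1r.
have [k0 _|no] := pickP 'I_m; last first.
  rewrite [RHS]big_pred0; last by move=> k; have := no k.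
  by rewrite big_pred0 // => -[[s|k|i j] w]; rewrite ?andbF //; have := no k.
rewrite (reindex_onto (fun k : 'I_m => (Sigma n k, inr k) : step)
   (fun s => if s.1 is Sigma k then k else k0)).
  apply: eq_bigl => k; rewrite /step_ok /= eqxx !andbT [[set inr k; _]]setUC.
  congr (_ && _); apply/eqP/eqP => [/eq_set2[[[->]]|[]]|->] //.
move=> [[s|k|i j] w] /andP[ok //= _].
by move: ok => /and5P[_ h _ _ _]; case: (@ends_Sigma n m u k (inl v) w h) => -[// _ ->].
Qed.

Lemma walk_sum_theta (k : 'I_m) p : WS (inr k) false p = \sum_(j | j != k) WS (inr j) true p.
Proof.
rewrite walk_sumE add0r.
pose st (j : 'I_m) : step := (if (k < j)%N then Tau n k j else Tau n j k, inr j).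
rewrite (reindex_onto st (fun s : step => if s.2 is inr j then j else k)).
  apply: eq_big => [j|j _].
    have -> : (j != k) = (k < j)%N || (j < k)%N by rewrite -neq_ltn eq_sym.
    rewrite /step_ok /st [_.2]/= eqxx andbT.
    case: ltnP => kj /=; first by rewrite kj eqxx.
    by rewrite set2C eqxx !andbT.
  by rewrite /st; case: ifP => _; rewrite /step_theta /= scale1r mul1r.
move=> [[s|l|i j] w] /and5P[h1 h2 _ h4 _] //.
  by have [? [? []]] := @ends_Arc n m u s (inr k) w h2.
rewrite /st; case: (@ends_Tau n m u i j (inr k) w h2) => -[[ei] ->]; subst.
  by rewrite (h1 : (i < j)%N).
by rewrite ltnNge (ltnW (h1 : (i < j)%N)).
Qed.

Lemma walk_sum_theta_even (j : 'I_m) p : WS (inr j) true p =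
  if (p <= j.*2)%N then (sigma_weight j *: th (tri j)) * WS (inl (u j)) false j.*2.+1 else 0.
Proof.
rewrite walk_sumE add0r.
have ok s : step_ok tri d u (inr j) true p s = (s == (Sigma n j, inl (u j))) && (p <= j.*2)%N.
  case: s => e w; apply/idP/andP => [/and5P[/= h1 h2 h3 h4 /andP[h5 h6]]|[/eqP[-> ->]] h].
    case: e h1 h2 h3 h4 h5 h6 => [s|l|i' j'] h1 h2 h3 h4 h5 h6 //.
      by have [? [? []]] := @ends_Arc n m u s (inr j) w h2.
    by case: (ends_Sigma h2) h6 => -[// [->] ->] /=; rewrite eqxx.
  by rewrite /step_ok /= eqxx.
rewrite (eq_bigl _ _ ok); case: ifP => pj; last by rewrite big_pred0 // => s; rewrite andbF.
rewrite (big_pred1 (Sigma n j, inl (u j))); last by move=> s; rewrite andbT.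
by rewrite /step_theta /= expr0 mul1r.
Qed.

(** With position 2k used up, theta_j can be left only if j > k: the tau-edges lead forward. *)
Lemma walk_sum_theta_next (k : 'I_m) : WS (inr k) false k.*2.+1 =
  \sum_(j : 'I_m | (k < j)%N) (sigma_weight j *: th (tri j)) * WS (inl (u j)) false j.*2.+1.
Proof.
rewrite walk_sum_theta (eq_bigr _ (fun j _ => walk_sum_theta_even j k.*2.+1)) -big_mkcondr.
by apply: eq_bigl => j; rewrite ltn_double andbC -val_eqE; case: ltngtP.
Qed.

End WalkRecurrences.

(** * Solution of the recurrences *)

Section WalkSumSolution.
Variables (n m : nat) (tri d : nat -> {set 'I_n}) (u : nat -> 'I_n) (a b : 'I_n).
Variables (K : rcfType) (T : {set {set 'I_n}}) (tail : {set 'I_n} -> 'I_n) (x : {set 'I_n} -> K).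
Hypothesis tT : triangulation T.
Hypothesis nab : a != b.
Hypothesis met : met_in_order T a b m tri d.
Hypothesis cen : centers m d u.
Hypothesis x_gt0 : forall e, e \in T -> 0 < x e.
Notation A := (super_alg K T).
Implicit Types (v w y z o : 'I_n).
Notation right k := (right_of tail (d k) (tri k)).
Notation th := (theta K T).
Notation WS := (walk_sum (m:=m) tri d u b T tail x).
Notation odd_sum p v := (WS (inl v) false p).
Notation even_sum p v := (WS (inl v) true p).
Notation arcpos v w := (position d (Arc m [set v; w])).
Notation sw := (sigma_weight tri u x).

Lemma b_notin_tri j : (j.+1 < m)%N -> b \notin tri j.
Proof.
move=> jm; apply/negP => bj; have m1 := met_size met.
have m2 := predn2_lt met.
have e2 := predn2_succ met.
have := strip_last tT nab met m2; rewrite (dE met m2) inE e2 (met_last met) andbT => /negP[].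
apply: (strip_convex tT nab met (i := j) (k := m.-1)); try by move: jm; clear; lia.
  by [].
exact: met_last met.
Qed.

(** Whatever crosses ab at v from position p on would put v in a triangle that is excluded; nor is v
    equal to b, which belongs to the last triangle. *)
Lemma even_sum0 p v : (p <= m.-1.*2)%N ->
  (forall j, (j < m)%N -> (p <= j.*2)%N -> v \notin tri j) -> even_sum p v = 0.
Proof.
move=> pm h; have m1 := met_size met; rewrite walk_sum_even.
have -> : v == b = false.
  apply/eqP => e; have := h m.-1; rewrite e (met_last met) pm => /(_ _ isT).
  by move=> /(_ _)/negP[] //; move: m1; clear; lia.
rewrite add0r !big_pred0 ?addr0 // => [k|w]; apply/negbTE/negP.
  case/andP=> /eqP e pk; have := h k (ltn_ord k) pk.
  by rewrite -e (center_tri met cen (ltn_ord k)).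
case/andP=> _; case E: (arcpos v w) => [q|] // pq.
have [k [km e eq]] := position_ArcP E.
have := h k.+1 km; rewrite (d_in_triS met km) -?e ?set21 // => /(_ _)/negP[] //.
by move: pq; rewrite eq; clear; lia.
Qed.

Lemma arcpos_odd v w q : arcpos v w = Some q -> exists2 k, q = k.*2.+1 & (k.+1 < m)%N /\ d k = [set v; w].
Proof. by case/position_ArcP => k [km e ->]; exists k. Qed.

Lemma even_sum_sigma k v : (k < m)%N -> even_sum k.*2 v =
  (if u k == v then (sw k *: ((-1) ^+ (~~ right k) * th (tri k))) *
     \sum_(j : 'I_m | (k < j)%N) (sw j *: th (tri j)) * odd_sum j.*2.+1 (u j) else 0)
  + even_sum k.*2.+1 v.
Proof.
move=> km; pose k' := Ordinal km; rewrite !walk_sum_even [RHS]addrCA; congr (_ + _).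
  congr (_ + _); apply: eq_big => [w|w]; case E: (arcpos v w) => [q|]; rewrite ?andbF //.
    by case: (arcpos_odd E) => i -> _; congr (_ && _); clear; lia.
  by rewrite /next_pos E.
rewrite -(walk_sum_theta_next tri d u b T tail x k').
rewrite (bigID (pred1 k')) /=; congr (_ + _); last first.
  apply: eq_bigl => j; rewrite -andbA; congr (_ && _).
  by rewrite leq_double ltn_double -val_eqE ltn_neqAle eq_sym andbC.
case: eqP => e; last first.
  by rewrite big_pred0 // => j; apply/negP => /andP[/andP[/eqP h _] /eqP ej]; rewrite ej in h.
rewrite (big_pred1 k') // => j; rewrite andbC /=; case: (eqVneq j k') => [->|/negbTE nj] /=.
  by rewrite e !eqxx leqnn.
by [].
Qed.

Lemma even_sum_diag k v w : (k.+1 < m)%N -> d k = [set v; w] -> even_sum k.*2.+1 v =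
  (x (d k))^-1 *: odd_sum k.*2.+2 w + even_sum k.*2.+2 v.
Proof.
move=> km ed; have := d_card tT met km; rewrite ed cards2; case: eqVneq => // nvw _.
have hw : arcpos v w = Some k.*2.+1 by rewrite -ed (position_d tT nab met km).
have adj : adjacent m tri v w.
  rewrite /adjacent nvw; apply/existsP; exists (Ordinal (ltnW km)) => /=.
  by rewrite -ed; apply/subsetP => z; apply: (d_in_tri met km).
rewrite !walk_sum_even -!addrA [RHS]addrCA; congr (_ + _); rewrite [RHS]addrA; congr (_ + _); last first.
  by apply: eq_bigl => j; congr (_ && _); clear; lia.
rewrite (bigD1 w) ?adj ?hw ?ltnSn //; congr (_ + _).
  by rewrite /next_pos hw.
apply: eq_big => [w'|w' /andP[]]; case E: (arcpos v w') => [q|]; rewrite ?andbF //=; last first.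
  by rewrite /next_pos E.
case: (arcpos_odd E) => i -> [im ed']; rewrite -andbA; congr (_ && _).
apply/andP/idP => [[h nw]|h].
  have : i != k; last by move: h; clear; lia.
  by apply: contraNneq nw => ei; move: ed'; rewrite ei ed => /eq_set2[[_ ->]|[<- ->]].
split; first by move: h; clear; lia.
apply: contraTneq h => ew; rewrite ew -ed in ed'; rewrite (d_inj tT nab met im km ed').
by clear; lia.
Qed.
Lemma even_sum_notin k v : (k.+1 < m)%N -> v \notin d k ->
  even_sum k.*2.+1 v = even_sum k.*2.+2 v.
Proof.
move=> km vd; rewrite !walk_sum_even; congr (_ + _ + _).
  apply: eq_big => [w|w]; case E: (arcpos v w) => [q|]; rewrite ?andbF //.
    case: (arcpos_odd E) => i -> [im ed]; congr (_ && _).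
    have : i != k by apply: contraNneq vd => <-; rewrite ed set21.
    clear; lia.
  by rewrite /next_pos E.
by apply: eq_bigl => j; congr (_ && _); clear; lia.
Qed.

(** The first term is the use of d_k as an odd edge. Any other odd step from v ends off d_k, so
    position 2k + 1 no longer matters to it. *)
Lemma odd_sum_diag k v w : (k.+1 < m)%N -> d k = [set v; w] -> odd_sum k.*2.+1 v =
  x (d k) *: even_sum k.*2.+2 w + odd_sum k.*2.+2 v.
Proof.
move=> km ed; have := d_card tT met km; rewrite ed cards2; case: eqVneq => // nvw _.
have hw : arcpos v w = Some k.*2.+1 by rewrite -ed (position_d tT nab met km).
have adj : adjacent m tri v w.
  rewrite /adjacent nvw; apply/existsP; exists (Ordinal (ltnW km)) => /=.
  by rewrite -ed; apply/subsetP => z; apply: (d_in_tri met km).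
rewrite !walk_sum_odd (bigD1 w) ?adj ?hw //=; congr (_ + _).
  by rewrite /next_pos hw.
have eqp w' : adjacent m tri v w' && (if arcpos v w' is Some q then (k.*2 < q)%N else true) && (w' != w) =
    adjacent m tri v w' && (if arcpos v w' is Some q then (k.*2.+1 < q)%N else true).
  rewrite -andbA; congr (_ && _); case E: (arcpos v w') => [q|].
    case: (arcpos_odd E) => i -> [im ed']; apply/andP/idP => [[h nw]|h].
      have : i != k; last by move: h; clear; lia.
      by apply: contraNneq nw => ei; move: ed'; rewrite ei ed => /eq_set2[[_ ->]|[<- ->]].
    split; first by move: h; clear; lia.
    apply: contraTneq h => ew; rewrite ew -ed in ed'; rewrite (d_inj tT nab met im km ed').
    by clear; lia.
  by apply: contra_eqT E => /negbNE/eqP ->; rewrite hw.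
rewrite (eq_bigl _ _ eqp); apply: eq_bigr => w'; rewrite -eqp => /andP[/andP[/andP[nvw' _] _] nw].
rewrite /next_pos; case: (arcpos v w') => [q|] //.
by rewrite (even_sum_notin km) // ed !inE negb_or eq_sym nvw' nw.
Qed.

(** Position 2k belongs to sigma_k, which could only be taken from u_k at the second step, and the
    first step has just left u_k. *)
Lemma odd_sum_center k : (k < m)%N -> odd_sum k.*2 (u k) = odd_sum k.*2.+1 (u k).
Proof.
move=> km; rewrite !walk_sum_odd.
apply: eq_big => [w|w /andP[/andP[nw _]]]; case E: (arcpos _ w) => [q|] //.
  by case: (arcpos_odd E) => i -> _; congr (_ && _); clear; lia.
  by rewrite /next_pos E.
by rewrite /next_pos E (even_sum_sigma w km) (negbTE nw) add0r.
Qed.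

(** As v lies in no later triangle, edges at v that cross ab do so before position 2k. An end w
    outside [tri k] has also been left behind and contributes nothing. *)
Lemma odd_sum_last k v : (k < m)%N -> v \in tri k ->
  (forall j, (j < m)%N -> v \in tri j -> (j <= k)%N) ->
  odd_sum k.*2 v = \sum_(w in tri k :\ v | arcpos v w == None) x [set v; w] *: even_sum k.*2 w.
Proof.
move=> km vk h; have none w : v != w ->
    (if arcpos v w is Some q then (k.*2 <= q)%N else true) = (arcpos v w == None).
  move=> nvw; case E: (arcpos v w) => [q|] //; case: (arcpos_odd E) => i -> [im ed].
  have := h i.+1 im; rewrite (d_in_triS met im) ?ed ?set21 // => /(_ isT).
  by move=> ik; apply/negbTE; move: ik; clear; lia.
rewrite walk_sum_odd (bigID (fun w => w \in tri k)) [X in _ + X = _]big1 ?addr0.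
  apply: eq_big => [w|w /andP[/andP[/andP[nvw _] hq] wk]].
    have [->|nvw] := eqVneq v w; first by rewrite /adjacent eqxx !inE eqxx.
    rewrite none // !inE [w == v]eq_sym nvw /=; case wk: (w \in tri k); rewrite ?andbF ?andbT //.
    have -> // : adjacent m tri v w.
    rewrite /adjacent nvw; apply/existsP; exists (Ordinal km) => /=.
    by apply/subsetP => z /set2P[] ->.
  by move: hq; rewrite none // => /eqP E; rewrite /next_pos E.
move=> w /andP[/andP[/andP[nvw /existsP[j /subsetP sj]] hq] wk].
move: hq; rewrite none // => /eqP E; rewrite /next_pos E even_sum0 ?scaler0 //.
  by rewrite leq_double; move: km; clear; lia.
move=> i im; rewrite leq_double => ki; apply: contra wk => wi.
have jk : (j <= k)%N by apply: h => //; apply: sj; rewrite set21.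
by apply: (strip_convex tT nab met jk ki im) => //; apply: sj; rewrite set22.
Qed.

Lemma even_sum_end v : even_sum m.-1.*2 v = (v == b)%:R.
Proof.
have m1 := met_size met; have mm : (m.-1 < m)%N by move: m1; clear; lia.
rewrite even_sum_sigma // big_pred0 => [|j]; last first.
  by apply/negbTE; rewrite -leqNgt; have := ltn_ord j; move: m1; clear; lia.
rewrite mulr0 if_same add0r walk_sum_even !big_pred0 ?addr0 // => [j|w]; apply/negbTE/negP.
  by case/andP=> _; have := ltn_ord j; move: m1; clear; lia.
case/andP=> _; case E: (arcpos v w) => [q|] //.
by case: (arcpos_odd E) => i -> [im _]; move: im; clear; lia.
Qed.

Lemma odd_sum_apex k y o z : (k.+1 < m)%N -> d k = [set y; o] -> tri k.+1 = [set y; o; z] ->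
  z \notin d k -> (forall j, (j < m)%N -> o \in tri j -> (j <= k.+1)%N) ->
  odd_sum k.*2.+2 o = x [set o; z] *: even_sum k.*2.+2 z.
Proof.
move=> km ed et zd ho.
have ot : o \in tri k.+1 by rewrite et !inE eqxx orbT.
have zo : z != o by apply: contraNneq zd => ->; rewrite ed set22.
rewrite (odd_sum_last km ot ho) (big_pred1 z) // => w.
have yd : arcpos o y = Some k.*2.+1 by rewrite set2C -ed (position_d tT nab met km).
have zn : arcpos o z = None.
  case E: (arcpos o z) => [q|] //; exfalso; case: (arcpos_odd E) => i _ [im ei].
  have ik : (i <= k)%N by apply: (ho i.+1); rewrite // (d_in_triS met im) // ei set21.
  case/negP: zd; rewrite (dE met km) inE et !inE eqxx !orbT andbT.
  apply: (strip_convex tT nab met ik (leqnSn k) km); first by rewrite (d_in_tri met) // ei set22.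
  by rewrite et !inE eqxx !orbT.
apply/andP/eqP => [[]|->]; last by rewrite zn et !inE eqxx zo orbT.
rewrite et !inE => /andP[/negbTE->]; rewrite orbF => /orP[]/eqP-> //.
by rewrite yd.
Qed.

(* The equations below hold for l v = lambda_vb. *)
Variable l : 'I_n -> A.

(** If f j is the sum over the walks from u_j just after sigma_j, this is the sum over the walks
    from theta_k, as in [walk_sum_theta_next]. *)
Definition tail_sum (f : nat -> 'I_n -> A) (k : nat) : A :=
  \sum_(j : 'I_m | (k < j)%N) (sw j *: th (tri j)) * f j (u j).

Hypothesis l_last : forall v, v \in d m.-2 -> l v = (x [set v; b])%:A.
Hypothesis l_apex : forall k z o, (k.+1 < m)%N -> d k = [set u k; z] ->
  tri k = [set u k; z; o] -> u k != z -> o \notin d k ->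
  l o = (x [set o; z] / x (d k)) *: l (u k) + (x [set o; u k] / x (d k)) *: l z +
    x [set o; u k] *: ((sw k *: ((-1) ^+ (~~ right k) * th (tri k))) * tail_sum (fun=> l) k).

Lemma odd_sum_base v : v \in d m.-2 -> odd_sum m.-1.*2 v = l v.
Proof.
have m1 := met_size met; have e2 := predn2_succ met.
have m2 := predn2_lt met.
move=> vd; rewrite l_last //.
have [w ed nvw] : exists2 w, d m.-2 = [set w; v] & v != w.
  have := d_card tT met m2 => /eqP/cards2P[y [z [nyz ed]]].
  move: vd; rewrite ed => /set2P[] ->; first by exists z; rewrite // set2C.
  by exists y; rewrite // eq_sym.
have := odd_sum_apex (z := b) m2 ed; rewrite -doubleS e2 even_sum_end eqxx mulr1n => h; apply: h.
- apply/esym/eqP; rewrite eqEcard (tri_card met) ?e2; last by move: m1; clear; lia.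
  have nb y : y \in d m.-2 -> y != b by move=> yd; apply: contraNneq (strip_last tT nab met m2) => <-.
  rewrite -ed setUC cardsU1 (strip_last tT nab met m2) (d_card tT met m2) andbT.
  apply/subsetP => y /setU1P[->|/(d_in_triS met m2)]; rewrite ?e2 //; exact: met_last met.
- exact (strip_last tT nab met m2).
- by move=> j; move: m1; clear; lia.
Qed.

Lemma odd_sum_center_last : odd_sum m.-1.*2.+1 (u m.-1) = l (u m.-1).
Proof.
have m1 := met_size met; have e2 := predn2_succ met.
have m2 := predn2_lt met.
have h := center_dS cen m2; rewrite e2 in h.
rewrite -odd_sum_base // odd_sum_center //; by move: m1; clear; lia.
Qed.

(** Even sums are carried along with odd ones because each step turns one parity into the other;
    crossing d_k leads to its other end, hence l w. *)
Definition solved k := forall v w, d k = [set v; w] ->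
  odd_sum k.*2.+1 v = l v /\ even_sum k.*2.+1 v = (x (d k))^-1 *: l w.

Lemma tail_sum_solved k : (forall j, (k < j)%N -> (j.+1 < m)%N -> solved j) ->
  tail_sum (fun j v => odd_sum j.*2.+1 v) k = tail_sum (fun=> l) k.
Proof.
move=> h; apply: eq_bigr => j kj; congr (_ * _).
have [jm|jm] := ltnP j.+1 m.
  have uj := center_d met cen jm; have := d_card tT met jm => /eqP/cards2P[y [z [nyz ed]]].
  move: uj; rewrite ed => /set2P[] e; first by rewrite e; case: (h j kj jm y z ed).
  by rewrite set2C in ed; rewrite e; case: (h j kj jm z y ed).
have -> : (j : nat) = m.-1 by have := ltn_ord j; move: jm; clear; lia.
exact: odd_sum_center_last.
Qed.

Lemma solved_last : solved m.-2.
Proof.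
have m1 := met_size met; have e2 := predn2_succ met.
have m2 := predn2_lt met.
have e3 : m.-2.*2.+2 = m.-1.*2 by rewrite -doubleS e2.
move=> v w ed; have vd : v \in d m.-2 by rewrite ed set21.
have wd : w \in d m.-2 by rewrite ed set22.
have nb y : y \in d m.-2 -> (y == b) = false.
  by move=> yd; apply: contraNF (strip_last tT nab met m2) => /eqP <-.
rewrite (odd_sum_diag m2 ed) (even_sum_diag m2 ed) e3 !even_sum_end !nb //.
by rewrite !odd_sum_base // scaler0 add0r addr0.
Qed.

Lemma solved_prev k : (k.+2 < m)%N -> (forall j, (k < j)%N -> (j.+1 < m)%N -> solved j) ->
  solved k.
Proof.
move=> km h; have k1 : (k.+1 < m)%N := ltnW km; have sk := h k.+1 (leqnn _) km.
have [o [w [edk edk1 et [nuo nuw now] od]]] := fan_step tT nab met cen km.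
have ou : forall j, (j < m)%N -> o \in tri j -> (j <= k.+1)%N.
  move=> j jm oj; rewrite leqNgt; apply: contra od => kj; rewrite (dE met km) inE.
  have ok1 : o \in tri k.+1 by rewrite et !inE eqxx orbT.
  by rewrite ok1; apply: (strip_convex tT nab met (i := k.+1) (k := j)).
have wd : w \notin d k by rewrite edk !inE negb_or [w == u _]eq_sym nuw [w == o]eq_sym now.
(* No triangle beyond [tri k.+1] contains o, nor does its next diagonal, and o is not its center: no
   crossing is left at o. *)
have uo0 : even_sum k.*2.+2 o = 0.
  rewrite -doubleS even_sum_sigma // (negbTE nuo) add0r even_sum_notin // -doubleS even_sum0 //.
    by rewrite leq_double; move: km; clear; lia.
  move=> j jm; rewrite leq_double => kj; apply/negP => /(ou j jm); move: kj; clear; lia.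
have [uu1 uu2] := sk _ _ edk1; have edk1' := edk1; rewrite set2C in edk1'.
have [ww1 ww2] := sk _ _ edk1'.
have ul : odd_sum k.*2.+1 (u k.+1) = l (u k.+1).
  by rewrite (odd_sum_diag k1 edk) uo0 scaler0 add0r -doubleS odd_sum_center.
have wl : even_sum k.*2.+2 w = (x (d k.+1))^-1 *: l (u k.+1).
  by rewrite -doubleS even_sum_sigma // (negbTE nuw) add0r.
have edk' := edk; rewrite set2C in edk'.
have ol2 : odd_sum k.*2.+2 o = x [set o; w] *: even_sum k.*2.+2 w.
  by apply: (odd_sum_apex (y := u k.+1)).
(* The ways out of o, through the center and through w, give the three terms of [l_apex]; the one
   through the center includes the detour along a sigma-edge. *)
have ol : odd_sum k.*2.+1 o = l o.
  rewrite (odd_sum_diag k1 edk') ol2 wl -doubleS even_sum_sigma // eqxx uu2.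
  rewrite -/(tail_sum (fun j v => odd_sum j.*2.+1 v) k.+1) tail_sum_solved; last first.
    by move=> j /ltnW; exact: h.
  have et' : tri k.+1 = [set u k.+1; w; o].
    by rewrite et; apply/setP => y; rewrite !inE orbAC.
  rewrite (l_apex km edk1 et' nuw od) edk' scalerDr scalerA [RHS]addrC -addrA; congr (_ + _).
  by rewrite scalerA addrC.
have dk0 : x (d k) != 0 by have [_ dT _] := met_diag met k1; exact: lt0r_neq0 (x_gt0 dT).
have uk2 : odd_sum k.*2.+2 (u k.+1) = l (u k.+1).
  by rewrite -ul (odd_sum_diag k1 edk) uo0 scaler0 add0r.
have hu : even_sum k.*2.+1 (u k.+1) = (x (d k))^-1 *: l o.
  by rewrite (even_sum_diag k1 edk) -ol (odd_sum_diag k1 edk') scalerDr scalerA mulVf // scale1r addrC.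
have ho : even_sum k.*2.+1 o = (x (d k))^-1 *: l (u k.+1).
  by rewrite (even_sum_diag k1 edk') uo0 addr0 uk2.
move=> y z; rewrite edk => /eq_set2[[<- <-]|[<- <-]]; by rewrite -edk.
Qed.

Lemma solved_all k : (k.+1 < m)%N -> solved k.
Proof.
move=> km; have [j ej] : {j | (j + k.+2 = m)%N} by exists (m - k.+2)%N; move: km; clear; lia.
elim/ltn_ind: j k ej km => j IH k ej km.
have [km2|] := ltnP k.+2 m; last first.
  move=> h; have -> : k = m.-2 by move: km h; clear; lia.
  exact: solved_last.
apply: solved_prev => // i ki im; apply: (IH (m - i.+2)%N) => //.
  by move: ki im ej; clear; lia.
by move: im; clear; lia.
Qed.

(** The odd steps from a lead to the two ends of d_0, and [l_apex] for k = 0 adds up their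
    contributions. *)
Lemma walk_sum_solution : odd_sum 0 a = l a.
Proof.
have m1 := met_size met; have s0 := solved_all m1.
have ud := center_d met cen m1.
have [z nuz ed] : exists2 z, u 0 != z & d 0 = [set u 0; z].
  have := d_card tT met m1 => /eqP/cards2P[y1 [y2 [ny ey]]].
  move: ud; rewrite ey => /set2P[] ->; first by exists y2.
  by exists y1; rewrite 1?eq_sym // set2C.
have ad := strip_first tT nab met m1.
have et : tri 0 = [set u 0; z; a].
  apply/esym/eqP; rewrite eqEcard (tri_card met (ltnW m1)).
  rewrite -ed setUC cardsU1 ad (d_card tT met m1) andbT.
  by apply/subsetP => y /setU1P[->|/(d_in_tri met m1)] //; exact: met_first met.
have aone w : arcpos a w = None.
  case E: (arcpos a w) => [q|] //; case: (arcpos_odd E) => i _ [im ei].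
  by have := strip_first tT nab met im; rewrite ei set21.
rewrite -[0%N]/(0%N.*2) odd_sum_last ?(ltnW m1) ?(met_first met) //; last first.
  by move=> j jm /(in_tri_a tT nab met jm) ->.
have [nau naz] : a != u 0 /\ a != z by move: ad; rewrite ed !inE negb_or => /andP.
rewrite (eq_bigl (mem [set u 0; z])); last first.
  move=> w; rewrite aone eqxx andbT et !inE; have [->|_] := eqVneq w a; last by rewrite orbF.
  by rewrite (negbTE nau) (negbTE naz).
rewrite big_setU1 ?inE //= big_set1 !even_sum_sigma ?(ltnW m1) // eqxx (negbTE nuz) add0r.
have [_ ->] := s0 _ _ ed; have ed' := ed; rewrite set2C in ed'; have [_ ->] := s0 _ _ ed'.
rewrite -/(tail_sum (fun j v => odd_sum j.*2.+1 v) 0) tail_sum_solved; last first.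
  by move=> j _; exact: solved_all.
rewrite (l_apex m1 ed et nuz ad) scalerDr !scalerA -addrA addrC -addrA addrA; by rewrite [X in X + _]addrC.
Qed.

End WalkSumSolution.

(** * The values of the sums over walks *)

(** The weight of a sigma-edge times the two sides at the center is the square root of the product
    of the three sides, which is the normalization of volumes. *)
Lemma sqrt_quotient (K : rcfType) (p q o : K) : 0 < p -> 0 < q -> 0 < o ->
  let r := p * q * Num.sqrt (o / (p * q)) in 0 < r /\ r * r = p * q * o.
Proof.
move=> p0 q0 o0 r; have pq0 := mulr_gt0 p0 q0; split.
  by rewrite /r mulr_gt0 // sqrtr_gt0 divr_gt0.
rewrite /r mulrACA -[X in _ * X]expr2 sqr_sqrtr ?divr_ge0 ?ltW //.
by field; rewrite !gt_eqF.
Qed.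

Lemma signMM (R : pzRingType) (b1 b2 : bool) (v w : R) :
  ((-1) ^+ b1 * v) * ((-1) ^+ b2 * w) = (-1) ^+ (b1 (+) b2) * (v * w).
Proof. by rewrite signr_addb; case: b1; case: b2; rewrite !(mul1r, mulN1r, mulNr, mulrN, opprK). Qed.

Lemma plucker_signs (R : pzRingType) (luo luw lub nuow nuwb nuob : R) (g o w b c : bool) :
  nuow * lub = lub * nuow -> luw * nuob = luo * nuwb + lub * nuow ->
  ((-1) ^+ (g (+) ~~ c) * nuow) * ((-1) ^+ b * lub) +
    (-1) ^+ o * (luo * ((-1) ^+ (g (+) o (+) b (+) ~~ c) * nuwb)) =
  (-1) ^+ w * (luw * ((-1) ^+ (g (+) w (+) b (+) ~~ c) * nuob)).
Proof.
move=> e1 e2; rewrite signMM e1; case: g; case: o; case: w; case: b; case: c;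
  by rewrite /= ?expr0 ?expr1 !(mul1r, mulN1r, mulNr, mulrN, opprK) e2 ?opprD addrC.
Qed.

(** [zu], [ou], [bu] stand for the comparisons of z, o, b with u, [nc] for the failure of u, z, b to
    be counterclockwise, and [g] for the gauge. Once the signs cancel, this is the quadratic
    relation multiplied out. *)
Lemma apex_signs (R : pzRingType) (luz luo lub loz lob lzb nuoz nuzb : R) (g nc zu ou bu : bool) :
  lub * loz = loz * lub -> luz * (luz * lob - luo * lzb - lub * loz) = nuoz * nuzb ->
  (-1) ^+ zu * (luz * ((-1) ^+ zu * (luz * ((-1) ^+ (nc (+) ou (+) bu) * lob)))) =
  (-1) ^+ zu * (luz * ((-1) ^+ (nc (+) ou (+) zu) * (loz * ((-1) ^+ bu * lub)))) +
  (-1) ^+ zu * (luz * ((-1) ^+ ou * (luo * ((-1) ^+ (nc (+) zu (+) bu) * lzb)))) +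
  ((-1) ^+ nc * ((-1) ^+ (g (+) nc) * nuoz)) * ((-1) ^+ (g (+) ou (+) bu (+) nc) * nuzb).
Proof.
move=> e1; rewrite e1 => e2.
have e : luz * (luz * lob) = luz * (loz * lub) + luz * (luo * lzb) + nuoz * nuzb.
  by rewrite -e2 !mulrBr [RHS]addrC addrA !subrK.
by case: g; case: nc; case: zu; case: ou; case: bu;
  rewrite /= ?expr0 ?expr1 !(mul1r, mulN1r, mulNr, mulrN, opprK) e ?opprD.
Qed.

(** * Pairings with b solve the recurrences *)

Section SpinorSolution.
Variables (n m : nat) (tri d : nat -> {set 'I_n}) (u : nat -> 'I_n) (a b : 'I_n).
Variables (K : rcfType) (T : {set {set 'I_n}}) (tail : {set 'I_n} -> 'I_n) (x : {set 'I_n} -> K).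
Notation A := (super_alg K T).
Notation E := (evens K {D : {set 'I_n} | D \in triangles T}).
Hypothesis tT : triangulation T.
Hypothesis nab : a != b.
Hypothesis met : met_in_order T a b m tri d.
Hypothesis cen : centers m d u.
Hypothesis dft : default_orientation m d u tail.
Hypothesis x_gt0 : forall e, e \in T -> 0 < x e.
Variables (p q : 'I_n -> E) (xi : 'I_n -> A) (g : {set 'I_n} -> bool).
Hypothesis xi_odd : forall i, homog true (xi i).
Hypothesis spin : compat p q xi (initial T tail x) g.
Notation pr := (pairing (@even_val K _) p q xi).
Notation vol := (osp_vol (@even_val K _) p q xi).
Notation right k := (right_of tail (d k) (tri k)).
Notation th := (theta K T).
Notation sw := (sigma_weight tri u x).
Notation iev := (@homog_evens K _).
Implicit Types (v w y z o X Y Z : 'I_n) (k : nat).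

Lemma arc_pairing X Y (v : A) : [set X; Y] \in T ->
  x [set X; Y] *: v = (-1) ^+ (Y < X)%N * (pr X Y * v).
Proof.
by move=> XY; rewrite mulrA -(compat_lam spin XY) -scalerAl mul1r.
Qed.

(** Both cyclic orders are covered, as exchanging two vertices negates the volume. *)
Lemma theta_vol X Y Z D : D \in triangles T -> D = [set X; Y; Z] ->
  X != Y -> Y != Z -> X != Z ->
  (x [set X; Y] * x [set X; Z] * Num.sqrt (x [set Y; Z] / (x [set X; Y] * x [set X; Z]))) *: th D
  = (-1) ^+ (g D (+) ~~ ccw X Y Z) * vol X Y Z.
Proof.
move=> DT eD nXY nYZ nXZ.
have [XD YD ZD] : [/\ X \in D, Y \in D & Z \in D] by rewrite eD !inE !eqxx !orbT.
have XYT := triangles_arc DT XD YD nXY; have YZT := triangles_arc DT YD ZD nYZ.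
have XZT := triangles_arc DT XD ZD nXZ.
have [] := sqrt_quotient (x_gt0 XYT) (x_gt0 XZT) (x_gt0 YZT).
set r := _ * Num.sqrt _ => r0 rr.
have sq (c : K) : c = x [set X; Y] * x [set X; Z] * x [set Y; Z] -> is_sqrt (c%:A : A) r%:A.
  by move=> ->; split; rewrite ?body_scalar // -rr -scalerAl mul1r scalerA.
have alg (c1 c2 c3 : K) : (c1%:A : A) * c2%:A * c3%:A = (c1 * c2 * c3)%:A.
  rewrite -!scalerAl !mul1r -!scalerAl !mul1r. by rewrite !scalerA ?mulrA.
have rth : r *: th D = th D * r%:A by rewrite -scalerAr mulr1.
rewrite rth; have [c|nc] := boolP (ccw X Y Z).
  rewrite addbF eD; apply: (compat_mu spin c) => //=.
  by rewrite alg; apply: sq; ring.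
have c : ccw Y X Z by have := ccw_total nXY nYZ nXZ; rewrite (negbTE nc).
have eD' : D = [set Y; X; Z] by rewrite eD [[set X; Y]]set2C.
have YXT : [set Y; X] \in T by rewrite set2C.
have := compat_mu (r := r%:A) spin c YXT XZT YZT.
rewrite -eD' => -> /=; last by rewrite alg; apply: sq; rewrite [[set Y; X]]set2C; ring.
by rewrite (osp_vol_swap iev p q xi_odd Y) addbT signrN mulNr mulrN.
Qed.

Definition lam_b (v : 'I_n) : A := (-1) ^+ (b < v)%N * pr v b.
Notation C := (tail_sum m tri u x (fun=> lam_b)).

Lemma ltn_ccw P X Y : P != X -> X != Y -> P != Y ->
  (Y < X)%N = ~~ ccw P X Y (+) (X < P)%N (+) (Y < P)%N.
Proof.
move=> nPX nXY nPY; have [c|nc] := boolP (ccw P X Y); first by rewrite (ccw_ltn c).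
have c : ccw P Y X.
  have := ccw_total nPX nXY nPY; rewrite (negbTE nc) /= => c.
  by move: c; rewrite /ccw; clear; lia.
by rewrite (ltn_neqN (X := Y)) 1?eq_sym // (ccw_ltn c) addTb addNb addbC.
Qed.

Lemma diag_sides k y z o w : (k.+1 < m)%N -> d k = [set y; z] -> y != z ->
  o \in tri k -> o \notin d k -> w \in tri k.+1 -> w \notin d k ->
  ccw y z w = ccw y z b /\ ccw y o z = ccw y z b.
Proof.
move=> km ed nyz ok od wk wd; have bd := strip_last tT nab met km.
move: (bd); rewrite ed !inE negb_or => /andP[nby nbz].
have [c|nc] := boolP (ccw y z b).
  have [/(_ ok od) h1 _] := strip_sides tT nab met o km ed c.
  have [_ /(_ wk wd) h2] := strip_sides tT nab met w km ed c.
  by rewrite h2 ccw_rot ccw_rot h1.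
have c : ccw z y b.
  have nyb : y != b by rewrite eq_sym.
  have nzb : z != b by rewrite eq_sym.
  by have := ccw_total nyz nzb nyb; rewrite (negbTE nc).
have ed' : d k = [set z; y] by rewrite set2C.
have [/(_ ok od) h1 _] := strip_sides tT nab met o km ed' c.
have [_ /(_ wk wd) h2] := strip_sides tT nab met w km ed' c.
by split; apply/negbTE; move: h1 h2; rewrite /ccw; clear; lia.
Qed.

Lemma sigma_theta_vol k y z : (k < m)%N -> tri k = [set u k; y; z] ->
  u k != y -> y != z -> u k != z ->
  (x [set u k; y] * x [set u k; z] * sw k) *: th (tri k) =
  (-1) ^+ (g (tri k) (+) ~~ ccw (u k) y z) * vol (u k) y z.
Proof.
move=> km et nuy nyz nuz; rewrite -(theta_vol (tri_T met km) et) // /sigma_weight.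
have -> : tri k :\ u k = [set y; z].
  apply/setP => v; rewrite et !inE; have [->|] //= := eqVneq v (u k).
  by rewrite (negbTE nuy) (negbTE nuz).
by rewrite big_setU1 ?inE // big_set1.
Qed.

(** By the default orientation d_k starts at u_k, and [tri k] lies on the side of d_k away from b:
    it is on the right exactly when b is on the left. *)
Lemma right_ccw k z o : (k.+1 < m)%N -> d k = [set u k; z] -> u k != z ->
  tri k = [set u k; z; o] -> o \notin d k -> right k = ccw (u k) z b.
Proof.
move=> km ed nuz et od; have ok : o \in tri k by rewrite et !inE eqxx orbT.
have tu : tail [set u k; z] = u k by rewrite -ed dft.
have h : ccw (u k) o z = ccw (u k) z b.
  have [w wk wd] := apexS_ex tT met km.
  by have [] := diag_sides km ed nuz ok od wk wd.
rewrite -h /right_of ed (arc_headE nuz tu) tu et; apply/existsP/idP => [[w]|c]; last first.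
  by exists o; rewrite !inE eqxx orbT /=; move: c; rewrite /ccw; clear; lia.
rewrite !inE => /andP[/orP[/orP[]|] /eqP->] /=; rewrite /ccw; clear; lia.
Qed.

Lemma tail_sumS k : (k.+1 < m)%N -> C k = (sw k.+1 *: th (tri k.+1)) * lam_b (u k.+1) + C k.+1.
Proof.
move=> km; rewrite /tail_sum (bigD1 (Ordinal km)) //=; congr (_ + _).
apply: eq_bigl => j; rewrite -val_eqE /= [RHS]ltn_neqAle eq_sym andbC.
by [].
Qed.

Lemma tail_sum_last : C m.-1 = 0.
Proof.
rewrite /tail_sum big_pred0 // => j; apply/negbTE; rewrite -leqNgt.
by have := ltn_ord j; clear; lia.
Qed.

(** The sign is read in [tri k.+1], the first triangle beyond d_k, because the induction comes from
    the far end of the strip. *)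
Definition tail_sum_value k := forall y z w, d k = [set y; z] -> y != z ->
  tri k.+1 = [set y; z; w] -> w \notin d k -> x (d k) *: C k =
  (-1) ^+ (g (tri k.+1) (+) (w < y)%N (+) (b < y)%N (+) ~~ ccw y z b) * vol y z b.

(** Here the sign is read in [tri k] instead: [compat_tail] across d_k, whose tail is u_k by the
    default orientation, exchanges the two triangles. *)
Lemma tail_sum_apex k z o : (k.+1 < m)%N -> tail_sum_value k -> d k = [set u k; z] -> u k != z ->
  tri k = [set u k; z; o] -> o \notin d k -> x (d k) *: C k =
  (-1) ^+ (g (tri k) (+) (o < u k)%N (+) (b < u k)%N (+) ~~ ccw (u k) z b) * vol (u k) z b.
Proof.
move=> km Ck ed nuz et od.
have [ud zd] : u k \in d k /\ z \in d k by rewrite ed !inE !eqxx orbT.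
have [w [et' nwu nwz]] := set3_of (tri_card met km) (d_in_triS met km ud) (d_in_triS met km zd) nuz.
have wd : w \notin d k by rewrite ed !inE negb_or nwu.
rewrite (Ck _ _ _ ed nuz et' wd); congr (_ ^+ nat_of_bool _ * _); congr (_ (+) _ (+) _).
have ok : o \in tri k by rewrite et !inE eqxx orbT.
have uk : u k \in tri k by rewrite et !inE eqxx.
have zk : z \in tri k by rewrite et !inE eqxx orbT.
have wk : w \in tri k.+1 by rewrite et' !inE eqxx orbT.
have uk' : u k \in tri k.+1 by rewrite et' !inE eqxx.
have zk' : z \in tri k.+1 by rewrite et' !inE eqxx orbT.
have [nou noz] : o != u k /\ o != z by apply/andP; rewrite -negb_or; move: od; rewrite ed !inE.
have km' := ltnW km; have side1 := tri_side_T met km'; have side2 := tri_side_T met km.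
have [s1 s2] := diag_sides km ed nuz ok od wk wd.
have dT : [set u k; z] \in T by apply: side1.
have e1 : [set u k; o] \in T by apply: side1; rewrite // eq_sym.
have e2 : [set o; z] \in T by apply: side1.
have e3 : [set z; w] \in T by apply: side2; rewrite // eq_sym.
have e4 : [set w; u k] \in T by apply: side2.
have tu : tail [set u k; z] = u k by rewrite -ed dft.
have [c|nc] := boolP (ccw (u k) z b).
  have cy : cyc4 (u k) o z w by move: s1 s2 c; rewrite /cyc4 /ccw; clear; lia.
  have qT : quad (arcs (initial T tail x)) (u k) o z w by split.
  have := compat_tail spin cy qT dT; rewrite /= tu -et' => <-.
  by rewrite et; congr (g _ (+) _); apply/setP => v; rewrite !inE orbAC.
have cy : cyc4 z o (u k) w.
  have nuo : u k != o by rewrite eq_sym.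
  have nzw : z != w by rewrite eq_sym.
  have nuw : u k != w by rewrite eq_sym.
  have := ccw_total nuo noz nuz; rewrite s2 (negbTE nc) /= ccw_rot => c1.
  have := ccw_total nuz nzw nuw; rewrite s1 (negbTE nc) /= => c2.
  by rewrite /cyc4 c1 c2.
have qT : quad (arcs (initial T tail x)) z o (u k) w by split; rewrite set2C.
have dT' : [set z; u k] \in T by rewrite set2C.
have := compat_tail spin cy qT dT'; rewrite /= [[set z; u k]]set2C tu -et' => <-.
by rewrite et; congr (g _ (+) _); apply/setP => v; rewrite !inE orbC orbA.
Qed.

(* The value of tail_sum does not depend on the order of the ends of d k. *)
Lemma tail_sum_value_sym k y z w : (k.+1 < m)%N -> d k = [set y; z] -> y != z ->
  tri k.+1 = [set y; z; w] -> w \notin d k ->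
  (-1) ^+ (g (tri k.+1) (+) (w < y)%N (+) (b < y)%N (+) ~~ ccw y z b) * vol y z b =
  (-1) ^+ (g (tri k.+1) (+) (w < z)%N (+) (b < z)%N (+) ~~ ccw z y b) * vol z y b.
Proof.
move=> km ed nyz et wd; rewrite (osp_vol_swap iev p q xi_odd z) mulrN -mulNr -signrN.
have bd := strip_last tT nab met km.
have [nby nbz] : b != y /\ b != z by apply/andP; rewrite -negb_or; move: bd; rewrite ed !inE.
have [nwy nwz] : w != y /\ w != z by apply/andP; rewrite -negb_or; move: wd; rewrite ed !inE.
have wk : w \in tri k.+1 by rewrite et !inE eqxx orbT.
have [o ok od] := apex_ex tT met km.
have [s1 _] := diag_sides km ed nyz ok od wk wd.
have nzy : z != y by rewrite eq_sym.
have nzw : z != w by rewrite eq_sym.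
have nyw : y != w by rewrite eq_sym.
have nzb : z != b by rewrite eq_sym.
have nyb : y != b by rewrite eq_sym.
have -> : ccw z y b = ~~ ccw y z b.
  have := ccw_total nyz nzb nyb; have := @ccw_asym _ y z b.
  by case: (ccw y z b) => [/(_ isT)/negbTE|_ /=].
rewrite (ltn_ccw nyz nzw nyw) (ltn_ccw nyz nzb nyb) s1; congr (_ ^+ nat_of_bool _ * _).
by case: (g _); case: (ccw _ _ _); case: (w < y)%N; case: (z < y)%N; case: (b < y)%N.
Qed.

Lemma vol_mulC X Y Z v : vol X Y Z * pr v b = pr v b * vol X Y Z.
Proof. exact/esym/homog_central/(pairing_even iev p q xi_odd v b). Qed.

(** Only the sigma-edge of the last triangle contributes, followed by the side from its center to b,
    and the volume is that of this triangle. *)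
Lemma tail_sum_value_last : tail_sum_value m.-2.
Proof.
have m1 := met_size met; have e2 := predn2_succ met.
have km := predn2_lt met.
have key y z : y = u m.-1 -> d m.-2 = [set y; z] -> y != z -> x (d m.-2) *: C m.-2 =
  (-1) ^+ (g (tri m.-1) (+) (b < y)%N (+) (b < y)%N (+) ~~ ccw y z b) * vol y z b.
  move=> ey ed nyz; have bd := strip_last tT nab met km.
  have bt := met_last met; have mm : (m.-1 < m)%N by rewrite -e2.
  have [yd zd] : y \in d m.-2 /\ z \in d m.-2 by rewrite ed !inE !eqxx orbT.
  have yt := d_in_triS met km yd; have zt := d_in_triS met km zd; rewrite e2 in yt zt.
  have [nyb nzb] : y != b /\ z != b.
    by move: bd; rewrite ed !inE negb_or eq_sym [b == z]eq_sym => /andP.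
  have et : tri m.-1 = [set y; z; b].
    have [w [e nwy nwz]] := set3_of (tri_card met mm) yt zt nyz.
    by move: bt; rewrite e inE -ed (negbTE bd) inE => /eqP ->.
  have ybT := tri_side_T met mm yt bt nyb.
  rewrite tail_sumS // e2 tail_sum_last addr0 -ey.
  have -> : lam_b y = (x [set y; b])%:A by rewrite (arc_pairing _ ybT) mulr1.
  rewrite -scalerAr mulr1 !scalerA addbK ed ey.
  by rewrite -(sigma_theta_vol mm) -?ey //; congr (_ *: _); ring.
move=> y z w ed nyz; rewrite e2 => et wd.
have ewb : w = b.
  by have := met_last met; rewrite et inE -ed (negbTE (strip_last tT nab met km)) inE => /eqP.
rewrite ewb in et wd *; rewrite -e2 in et.
have h := center_dS cen km; rewrite e2 ed in h; case/set2P: h => eu; first exact: key.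
have ed' : d m.-2 = [set z; y] by rewrite set2C.
have nzy : z != y by rewrite eq_sym.
rewrite (key z y (esym eu) ed' nzy); have := tail_sum_value_sym km ed nyz et wd.
by rewrite e2.
Qed.

(** Multiplied by the sides uo and uw of [tri k.+1], the new term is the volume of u, o, w times
    L_ub and the old one is L_uo times the volume of u, w, b, up to signs; the linear relation adds
    them to L_uw times the volume of u, o, b. *)
Lemma tail_sum_value_prev k : (k.+2 < m)%N -> tail_sum_value k.+1 -> tail_sum_value k.
Proof.
move=> km Ck; have k1 : (k.+1 < m)%N := ltnW km.
have [o [w [edk edk1 et [nuo nuw now] od]]] := fan_step tT nab met cen km.
have ot : o \in tri k.+1 by rewrite et !inE eqxx orbT.
have ut : u k.+1 \in tri k.+1 by rewrite et !inE eqxx.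
have wt : w \in tri k.+1 by rewrite et !inE eqxx !orbT.
have wd : w \notin d k by rewrite edk !inE negb_or [w == u _]eq_sym nuw [w == o]eq_sym now.
have uoT := tri_side_T met k1 ut ot nuo; have uwT := tri_side_T met k1 ut wt nuw.
have et' : tri k.+1 = [set u k.+1; w; o].
  by rewrite et; apply/setP => v; rewrite !inE orbAC.
have h := tail_sum_apex km Ck edk1 nuw et' od; rewrite edk1 in h.
have st := sigma_theta_vol k1 et nuo now nuw.
have [v vk vd] := apex_ex tT met k1.
have [c1 _] := diag_sides k1 edk nuo vk vd wt wd.
have [v' vk' vd'] := apexS_ex tT met km.
have [_ c2] := diag_sides km edk1 nuw ot od vk' vd'.
have key : x [set u k.+1; o] *: C k =
    (-1) ^+ (g (tri k.+1) (+) (w < u k.+1)%N (+) (b < u k.+1)%N (+) ~~ ccw (u k.+1) o b) * vol (u k.+1) o b.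
  have x0 : x [set u k.+1; w] != 0 by exact: lt0r_neq0 (x_gt0 uwT).
  apply: (scalerI x0); rewrite tail_sumS // !scalerDr.
  have -> : x [set u k.+1; w] *: (x [set u k.+1; o] *: ((sw k.+1 *: th (tri k.+1)) * lam_b (u k.+1))) =
      ((x [set u k.+1; o] * x [set u k.+1; w] * sw k.+1) *: th (tri k.+1)) * lam_b (u k.+1).
    by rewrite -!scalerAl !scalerA; congr (_ *: _); ring.
  rewrite st scalerA mulrC -scalerA h (arc_pairing _ uoT) (arc_pairing _ uwT) -c1 c2.
  exact: (plucker_signs _ _ _ _ _ (vol_mulC _ _ _ _) (osp_vol_plucker iev p q xi_odd (u k.+1) o w b)).
move=> y z w' ed nyz ew wd'.
have ew' : w' = w.
  have : w' \in tri k.+1 by rewrite ew !inE eqxx orbT.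
  by rewrite et inE -edk (negbTE wd') inE => /eqP.
subst w'; move: ed; rewrite edk => /eq_set2[[<- <-]|[<- <-]]; first exact: key.
by rewrite key; apply: tail_sum_value_sym.
Qed.

Lemma tail_sum_valueP k : (k.+1 < m)%N -> tail_sum_value k.
Proof.
move=> km; have [j ej] : {j | (j + k.+2 = m)%N} by exists (m - k.+2)%N; move: km; clear; lia.
elim: j k ej km => [|j IH] k ej km.
  have -> : k = m.-2 by move: ej; clear; lia.
  exact: tail_sum_value_last.
by apply: tail_sum_value_prev; [|apply: IH]; move: ej; clear; lia.
Qed.

Lemma lam_b_last v : v \in d m.-2 -> lam_b v = (x [set v; b])%:A.
Proof.
have m1 := met_size met; have e2 := predn2_succ met.
have km := predn2_lt met.
move=> vd; have vt := d_in_triS met km vd; have bt := met_last met; rewrite e2 in km vt.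
have nvb : v != b by apply: contraNneq (strip_last tT nab met (j := m.-2) _) => [<- //|]; rewrite e2.
by rewrite (arc_pairing _ (tri_side_T met km vt bt nvb)) mulr1.
Qed.

(** Multiplied twice by x_(d_k), the equation becomes the quadratic relation for u, o, z, b: the
    last term turns into the product of the volumes of [tri k] and of u, z, b. *)
Lemma lam_b_apex k z o : (k.+1 < m)%N -> d k = [set u k; z] ->
  tri k = [set u k; z; o] -> u k != z -> o \notin d k ->
  lam_b o = (x [set o; z] / x (d k)) *: lam_b (u k) + (x [set o; u k] / x (d k)) *: lam_b z +
    x [set o; u k] *: ((sw k *: ((-1) ^+ (~~ right k) * th (tri k))) * C k).
Proof.
move=> km ed et nuz od; rewrite (right_ccw km ed nuz et od).
have hC := tail_sum_apex km (tail_sum_valueP km) ed nuz et od.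
have ok : o \in tri k by rewrite et !inE eqxx orbT.
have uk : u k \in tri k by rewrite et !inE eqxx.
have zk : z \in tri k by rewrite et !inE eqxx orbT.
have [nou noz] : o != u k /\ o != z by apply/andP; rewrite -negb_or; move: od; rewrite ed !inE.
have nuo : u k != o by rewrite eq_sym.
have nzo : z != o by rewrite eq_sym.
have bd := strip_last tT nab met km.
have [nbu nbz] : b != u k /\ b != z by apply/andP; rewrite -negb_or; move: bd; rewrite ed !inE.
have km' := ltnW km.
have uzT := tri_side_T met km' uk zk nuz; have uoT := tri_side_T met km' uk ok nuo.
have ozT := tri_side_T met km' ok zk noz.
have et' : tri k = [set u k; o; z] by rewrite et; apply/setP => v; rewrite !inE orbAC.
have st := sigma_theta_vol km' et' nuo noz nuz.
have [w wk wd] := apexS_ex tT met km.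
have [_ c1] := diag_sides km ed nuz ok od wk wd.
have nob : o != b by apply: contraTneq ok => ->; apply: (b_notin_tri tT nab met).
have [nub nzb] : u k != b /\ z != b by rewrite eq_sym [z == b]eq_sym.
have c2 : ccw (u k) o b = ccw (u k) z b.
  have h1 := ccw_total nuo noz nuz; have h2 := ccw_total nuz nzb nub.
  rewrite c1 in h1; have [c|nc] := boolP (ccw (u k) z b).
    by rewrite c in c1; exact: ccw_trans c1 c.
  rewrite (negbTE nc) /= in h1 h2; apply/negbTE/ccw_asym; rewrite ccw_rot.
  by rewrite ccw_rot in h2; rewrite ccw_rot in h1; exact: ccw_trans h2 h1.
have x0 : x (d k) != 0 by rewrite ed; exact: lt0r_neq0 (x_gt0 uzT).
apply: (scalerI x0); apply: (scalerI x0).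
have cancel (r : K) (f : A) : x (d k) *: (x (d k) *: ((r / x (d k)) *: f)) = x (d k) *: (r *: f).
  by rewrite !scalerA; congr (_ *: _); field.
have term (f1 f2 : A) e : x (d k) *: (x (d k) *: (x [set o; u k] *: ((sw k *: ((-1) ^+ e * f1)) * f2))) =
    ((-1) ^+ e * ((x [set u k; o] * x [set u k; z] * sw k) *: f1)) * (x (d k) *: f2).
  rewrite -scalerAr -!scalerAl !scalerA -ed [[set o; _]]set2C.
  by rewrite -scalerAr -scalerAl scalerA; congr (_ *: _); ring.
rewrite !scalerDr !cancel term st hC ed [[set o; u k]]set2C.
rewrite !(arc_pairing _ uzT) (arc_pairing _ ozT) (arc_pairing _ uoT) /lam_b.
rewrite (ltn_ccw nuz nzb nub) (ltn_ccw nuo nob nub) (ltn_ccw nuo noz nuz) c1 c2.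
apply: apex_signs; last exact: (super_plucker iev p q xi_odd).
exact/homog_central/(pairing_even iev p q xi_odd).
Qed.

Lemma walk_sum_spinors : walk_sum (m := m) tri d u b T tail x (inl a) false 0 = lam_b a.
Proof. exact: (walk_sum_solution tT nab met cen x_gt0 lam_b_last lam_b_apex). Qed.

End SpinorSolution.

Theorem theorem5p9 (K : rcfType) (n : nat) (T : {set {set 'I_n}})
    (x : {set 'I_n} -> K) (tail : {set 'I_n} -> 'I_n)
    (a b : 'I_n) (m : nat) (tri d : nat -> {set 'I_n}) (u : nat -> 'I_n) :
  (2 < n)%N ->
  triangulation T ->
  (forall e, e \in T -> 0 < x e) ->
  (forall e, e \in T -> tail e \in e) ->
  a != b -> [set a; b] \notin T ->
  met_in_order T a b m tri d ->
  centers m d u ->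
  default_orientation m d u tail ->
  forall v : super_alg K T,
    is_lambda_length (initial T tail x) a b v <->
    v = super_path_sum m T tri d u a b tail x.
Proof.
move=> n2 tT x0 tt nab _ met cen dft v.
case: n n2 T x tail a b tri d u tT x0 tt nab met cen dft v => // n' _ T x tail a b tri d u.
move=> tT x0 tt nab met cen dft v.
have gs := initial_good tT x0 tt.
have [p [q [xi [g [oxi spin]]]]] := good_compat gs.
have h := is_lambda_lengthP v oxi gs spin nab.
by rewrite h (super_path_sumE tail x tT nab met cen)
  (walk_sum_spinors tT nab met cen dft x0 oxi spin).
Qed.
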